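(* Let $\mathcal{A}$ be a weakly idempotent complete (WIC) exact category with enough projectives and let $\mathcal{M}_1=(\mathcal{C}_1,\mathcal{W}_1)$, $\mathcal{M}_2=(\mathcal{C}_2,\mathcal{W}_2)$, $\mathcal{M}_3=(\mathcal{C}_3,\mathcal{W}_3)$ be three projective cotorsion pairs in $\mathcal{A}$ such that $\mathcal{C}_2,\mathcal{C}_3\subseteq\mathcal{C}_1$. If $\mathcal{W}_3\cap\mathcal{C}_1=\mathcal{C}_2$ (or equivalently, $\mathcal{W}_2\cap\mathcal{W}_3=\mathcal{W}_1$ and $\mathcal{C}_2\subseteq\mathcal{W}_3$), then the left localization $\mathcal{M}_2\backslash\mathcal{M}_1$ is Quillen equivalent to $\mathcal{M}_3$, and the left localization $\mathcal{M}_3\backslash\mathcal{M}_1$ is Quillen equivalent to $\mathcal{M}_2$. In fact, there is a recollement $$\mathcal{C}_2/\!\sim\ \xrightarrow{\ I\ }\ \mathcal{C}_1/\!\sim\ \xrightarrow{\ Q\ }\ \mathcal{A}/\mathcal{W}_3,$$ where $I$ is the inclusion, with left adjoint $\mathrm{E}(\mathcal{M}_3)$ and right adjoint $\mathrm{C}(\mathcal{M}_2)$, and $Q$ is the quotient functor $Q([f])=\gamma_{\mathcal{W}_3}(f)$, with left adjoint $\lambda=\mathrm{C}(\mathcal{M}_3)$ and right adjoint $\rho=\mathrm{E}(\mathcal{M}_2)\circ\mathrm{C}(\mathcal{M}_1)$. The essential image of $\lambda$ is $\mathcal{C}_3/\!\sim$ and the essential image of $\rho$ is $(\mathcal{W}_2\cap\mathcal{C}_1)/\!\sim$,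 and they provide an equivalence $\lambda:(\mathcal{W}_2\cap\mathcal{C}_1)/\!\sim\ \longleftrightarrow\ \mathcal{C}_3/\!\sim\ :\rho$.
   Context: Exact categories are in the sense of Quillen; the distinguished kernel-cokernel pairs $A\rightarrowtail B\twoheadrightarrow C$ are called admissible short exact sequences, and their two maps admissible monomorphisms and admissible epimorphisms. An exact category is WIC exact if its underlying additive category is weakly idempotent complete (every split monomorphism has a cokernel). Projective/injective objects, enough projectives/injectives, and Yoneda $\mathrm{Ext}^1$ are with respect to admissible sequences. A pair of classes of objects $(\mathcal{X},\mathcal{Y})$ is a cotorsion pair if $\mathcal{X}=\{A:\mathrm{Ext}^1(A,Y)=0\ \forall Y\in\mathcal{Y}\}$ and $\mathcal{Y}=\{A:\mathrm{Ext}^1(X,A)=0\ \forall X\in\mathcal{X}\}$. It is complete if for each object $A$ there are admissible short exact sequences $Y\rightarrowtail X\twoheadrightarrow A$ and $A\rightarrowtail Y'\twoheadrightarrow X'$ with $X,X'\in\mathcal{X}$, $Y,Y'\in\mathcal{Y}$. A class is thick if it is closed under retracts and, whenever two of the three terms of an admissible short exact sequence lie in it, so does the third. A projective cotorsion pair in $\mathcal{A}$ is a complete cotorsion pair $(\mathcal{C},\mathcal{W})$ with $\mathcal{W}$ thick and $\mathcal{C}\cap\mathcal{W}$ equal to the class of projective objects. A Hovey triple $(\mathcal{Q},\mathcal{W},\mathcal{R})$ is a triple of classes with $\mathcal{W}$ thick and $(\mathcal{Q},\mathcal{R}\cap\mathcal{W})$, $(\mathcal{Q}\cap\mathcal{W},\mathcal{R})$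 complete cotorsion pairs. It determines an exact model structure: (trivial) cofibrations are the admissible monomorphisms with cokernel in $\mathcal{Q}$ (in $\mathcal{Q}\cap\mathcal{W}$), (trivial) fibrations are the admissible epimorphisms with kernel in $\mathcal{R}$ (in $\mathcal{R}\cap\mathcal{W}$), and weak equivalences are the composites of a trivial cofibration followed by a trivial fibration. The weak equivalences depend only on $\mathcal{W}$; $\gamma_{\mathcal{W}}:\mathcal{A}\to\mathcal{A}/\mathcal{W}$ denotes the localization at them, i.e. the homotopy category, with its standard triangulated structure. (Model structures here need not live on bicomplete categories.) A projective cotorsion pair $\mathcal{M}=(\mathcal{C},\mathcal{W})$ is identified with the model structure given by the Hovey triple $(\mathcal{C},\mathcal{W},\mathcal{A})$. For projective cotorsion pairs $\mathcal{M}_i=(\mathcal{C}_i,\mathcal{W}_i)$ and $\mathcal{M}_j=(\mathcal{C}_j,\mathcal{W}_j)$ with $\mathcal{C}_j\subseteq\mathcal{C}_i$, Becker's left localization $\mathcal{M}_j\backslash\mathcal{M}_i$ is the model structure given by the Hovey triple $(\mathcal{C}_i,\mathcal{W},\mathcal{W}_j)$, where $\mathcal{W}$ is the unique thick class with $\mathcal{C}_i\cap\mathcal{W}=\mathcal{C}_j$ and $\mathcal{W}\cap\mathcal{W}_j=\mathcal{W}_i$. Two model structures on $\mathcal{A}$ are Quillen equivalent here via the identity functors of $\mathcal{A}$ (a Quillen adjunction whose derived functors are equivalences). For a full subcategory $\mathcal{S}$ of $\mathcal{A}$, $\mathcal{S}/\!\sim$ has the same objects, and morphisms are morphisms of $\mathcal{A}$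 modulo $f\sim g$ iff $g-f$ factors through a projective object. Each $\mathcal{C}_i$ (with the inherited exact structure) is a Frobenius category with projective-injective objects the projectives of $\mathcal{A}$, and $\mathcal{C}_i/\!\sim$ is its stable triangulated category, equivalent to $\mathcal{A}/\mathcal{W}_i$. For a complete cotorsion pair $\mathcal{M}=(\mathcal{X},\mathcal{Y})$: $\mathrm{E}(\mathcal{M})$ sends $A$ to $Y'$ in a chosen admissible sequence $A\rightarrowtail Y'\twoheadrightarrow X'$ with $Y'\in\mathcal{Y}$, $X'\in\mathcal{X}$; $\mathrm{C}(\mathcal{M})$ sends $A$ to $X$ in a chosen admissible sequence $Y\rightarrowtail X\twoheadrightarrow A$ with $X\in\mathcal{X}$, $Y\in\mathcal{Y}$; these are taken as the induced functors between the indicated quotient/homotopy categories. A recollement $\mathcal{T}'\xrightarrow{I}\mathcal{T}\xrightarrow{Q}\mathcal{T}''$ of triangulated categories consists of exact functors $I,Q$, each having a left and a right adjoint, such that $I$ and the adjoints of $Q$ are fully faithful and the essential image of $I$ equals the kernel of $Q$. *)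

(* Defs.v *)
(* Categories have setoids of morphisms: hom-sets carry an equivalence [f ≈ g]
   playing the role of equality, so that quotient categories and localizations
   keep the morphisms they are built from and only coarsen [≈]. *)
From Stdlib Require Export RelationClasses Morphisms Setoid.

Set Implicit Arguments.
Unset Strict Implicit.
Unset Printing Implicit Defensive.

Declare Scope cat_scope.
Delimit Scope cat_scope with cat.
Open Scope cat_scope.

Reserved Notation "f ≈ g" (at level 70, no associativity).
Reserved Notation "g ∘ f" (at level 40, left associativity).
Reserved Notation "G ⊚ F" (at level 40, left associativity).

Record Cat : Type := {
  ob :> Type;
  hom : ob -> ob -> Type;
  heq : forall {x y : ob}, hom x y -> hom x y -> Prop;
  idm : forall x : ob, hom x x;
  comp : forall {x y z : ob}, hom y z -> hom x y -> hom x z;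
  heq_equiv : forall x y : ob, Equivalence (@heq x y);
  comp_proper : forall x y z : ob,
      Proper (@heq y z ==> @heq x y ==> @heq x z) (@comp x y z);
  comp_id_l : forall (x y : ob) (f : hom x y), heq (comp (idm y) f) f;
  comp_id_r : forall (x y : ob) (f : hom x y), heq (comp f (idm x)) f;
  comp_assoc : forall (x y z t : ob) (h : hom z t) (g : hom y z) (f : hom x y),
      heq (comp h (comp g f)) (comp (comp h g) f) }.

Arguments hom {c} x y : rename.
Arguments heq {c x y} f g : rename.
Arguments idm {c} x : rename.
Arguments comp {c x y z} g f : rename.

Notation "f ≈ g" := (heq f g) : cat_scope.
Notation "g ∘ f" := (comp g f) : cat_scope.

#[export] Existing Instance heq_equiv.
#[export] Existing Instance comp_proper.

Definition exists_unique_hom (C : Cat) (x y : C) (P : hom x y -> Prop) : Prop :=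
  exists u, P u /\ forall v, P v -> v ≈ u.

Definition is_iso (C : Cat) (x y : C) (f : hom x y) : Prop :=
  exists g : hom y x, g ∘ f ≈ idm x /\ f ∘ g ≈ idm y.

Definition isomorphic (C : Cat) (x y : C) : Prop :=
  exists f : hom x y, is_iso f.

Definition is_zero_object (C : Cat) (z : C) : Prop :=
  (forall x, exists f : hom z x, forall g, g ≈ f) /\
  (forall x, exists f : hom x z, forall g, g ≈ f).

Definition is_retract (C : Cat) (x y : C) : Prop :=
  exists (i : hom x y) (r : hom y x), r ∘ i ≈ idm x.

Record Functor (C D : Cat) : Type := {
  fob :> C -> D;
  fmap : forall {x y : C}, hom x y -> hom (fob x) (fob y);
  fmap_proper : forall x y : C, Proper (heq ==> heq) (@fmap x y);
  fmap_id : forall x : C, fmap (idm x) ≈ idm (fob x);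
  fmap_comp : forall (x y z : C) (g : hom y z) (f : hom x y),
      fmap (g ∘ f) ≈ fmap g ∘ fmap f }.

Arguments fmap {C D} F {x y} f : rename.
#[export] Existing Instance fmap_proper.

Definition functor_id (C : Cat) : Functor C C.
Proof.
  refine {| fob := fun x : C => x; fmap := fun x y f => f |}; try reflexivity.
  intros x y f g H; exact H.
Defined.

Definition functor_comp (C D E : Cat) (G : Functor D E) (F : Functor C D) :
  Functor C E.
Proof.
  refine {| fob := fun x => G (F x); fmap := fun x y f => fmap G (fmap F f) |}.
  - intros x y f g H; now rewrite H.
  - intros x; now rewrite !fmap_id.
  - intros x y z g f; now rewrite !fmap_comp.
Defined.

Notation "G ⊚ F" := (functor_comp G F) : cat_scope.

Record NatTrans (C D : Cat) (F G : Functor C D) : Type := {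
  component :> forall x : C, hom (F x) (G x);
  naturality : forall (x y : C) (f : hom x y),
      component y ∘ fmap F f ≈ fmap G f ∘ component x }.

Definition naturally_isomorphic (C D : Cat) (F G : Functor C D) : Prop :=
  exists t : NatTrans F G, forall x, is_iso (t x).

Definition is_equivalence (C D : Cat) (F : Functor C D) : Prop :=
  exists G : Functor D C,
    naturally_isomorphic (G ⊚ F) (functor_id C) /\
    naturally_isomorphic (F ⊚ G) (functor_id D).

Definition fully_faithful (C D : Cat) (F : Functor C D) : Prop :=
  (forall (x y : C) (f g : hom x y), fmap F f ≈ fmap F g -> f ≈ g) /\
  (forall (x y : C) (g : hom (F x) (F y)), exists f : hom x y, fmap F f ≈ g).

Definition in_essential_image (C D : Cat) (F : Functor C D) (y : D) : Prop :=
  exists x : C, isomorphic (F x) y.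

Definition adjoint (C D : Cat) (L : Functor C D) (R : Functor D C) : Prop :=
  exists (unit : NatTrans (functor_id C) (R ⊚ L))
         (counit : NatTrans (L ⊚ R) (functor_id D)),
    (forall x : C, counit (L x) ∘ fmap L (unit x) ≈ idm (L x)) /\
    (forall y : D, fmap R (counit y) ∘ unit (R y) ≈ idm (R y)).

(** Kan extensions along [G : C -> C']; when [G] is the localization of a model
    category, these are the total derived functors of [F]. *)

Definition is_right_kan (C C' D : Cat) (G : Functor C C') (F : Functor C D)
    (L : Functor C' D) (e : NatTrans (L ⊚ G) F) : Prop :=
  forall (K : Functor C' D) (s : NatTrans (K ⊚ G) F),
    exists t : NatTrans K L,
      (forall x : C, e x ∘ t (G x) ≈ s x) /\
      (forall t' : NatTrans K L,
          (forall x : C, e x ∘ t' (G x) ≈ s x) -> forall y : C', t' y ≈ t y).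

Definition is_left_kan (C C' D : Cat) (G : Functor C C') (F : Functor C D)
    (R : Functor C' D) (e : NatTrans F (R ⊚ G)) : Prop :=
  forall (K : Functor C' D) (s : NatTrans F (K ⊚ G)),
    exists t : NatTrans R K,
      (forall x : C, t (G x) ∘ e x ≈ s x) /\
      (forall t' : NatTrans R K,
          (forall x : C, t' (G x) ∘ e x ≈ s x) -> forall y : C', t' y ≈ t y).

(** Gabriel-Zisman construction: same objects; morphisms are the formal
    composites of morphisms of [C] and formal inverses of members of [W],
    modulo the congruence generated by the relations of [C] and the two
    inverse laws. *)

Section Localization.
Context (C : Cat) (W : forall x y : C, hom x y -> Prop).

Inductive loc_hom : C -> C -> Type :=
| loc_map (x y : C) (f : hom x y) : loc_hom x y
| loc_inv (x y : C) (s : hom x y) (hs : W s) : loc_hom y x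
| loc_comp (x y z : C) (g : loc_hom y z) (f : loc_hom x y) : loc_hom x z.

Inductive loc_eq : forall x y : C, loc_hom x y -> loc_hom x y -> Prop :=
| loc_eq_refl x y (f : loc_hom x y) : loc_eq f f
| loc_eq_sym x y (f g : loc_hom x y) : loc_eq f g -> loc_eq g f
| loc_eq_trans x y (f g h : loc_hom x y) :
    loc_eq f g -> loc_eq g h -> loc_eq f h
| loc_eq_cong x y z (g g' : loc_hom y z) (f f' : loc_hom x y) :
    loc_eq g g' -> loc_eq f f' -> loc_eq (loc_comp g f) (loc_comp g' f')
| loc_eq_assoc x y z t (h : loc_hom z t) (g : loc_hom y z) (f : loc_hom x y) :
    loc_eq (loc_comp h (loc_comp g f)) (loc_comp (loc_comp h g) f)
| loc_eq_id_l x y (f : loc_hom x y) : loc_eq (loc_comp (loc_map (idm y)) f) f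
| loc_eq_id_r x y (f : loc_hom x y) : loc_eq (loc_comp f (loc_map (idm x))) f
| loc_eq_map x y (f g : hom x y) : f ≈ g -> loc_eq (loc_map f) (loc_map g)
| loc_eq_map_comp x y z (g : hom y z) (f : hom x y) :
    loc_eq (loc_map (g ∘ f)) (loc_comp (loc_map g) (loc_map f))
| loc_eq_inv_l x y (s : hom x y) (hs : W s) :
    loc_eq (loc_comp (loc_inv hs) (loc_map s)) (loc_map (idm x))
| loc_eq_inv_r x y (s : hom x y) (hs : W s) :
    loc_eq (loc_comp (loc_map s) (loc_inv hs)) (loc_map (idm y)).

Definition localization : Cat.
Proof.
  refine {| ob := ob C; hom := loc_hom; heq := loc_eq;
            idm := fun x => loc_map (idm x); comp := loc_comp |}.
  - intros x y; split.
    + exact (@loc_eq_refl x y).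
    + exact (@loc_eq_sym x y).
    + exact (@loc_eq_trans x y).
  - intros x y z g g' Hg f f' Hf; now apply loc_eq_cong.
  - exact loc_eq_id_l.
  - exact loc_eq_id_r.
  - exact loc_eq_assoc.
Defined.

Definition loc_functor : Functor C localization.
Proof.
  refine {| fob := fun x : C => x : localization;
            fmap := fun x y f => loc_map f : @hom localization x y |}.
  - intros x y f g H; now apply loc_eq_map.
  - intros x; reflexivity.
  - intros x y z g f; apply loc_eq_map_comp.
Defined.

End Localization.

Record Preadditive (C : Cat) : Type := {
  hzero : forall x y : C, hom x y;
  hadd : forall {x y : C}, hom x y -> hom x y -> hom x y;
  hopp : forall {x y : C}, hom x y -> hom x y;
  hadd_proper : forall x y : C, Proper (heq ==> heq ==> heq) (@hadd x y);
  hopp_proper : forall x y : C, Proper (heq ==> heq) (@hopp x y);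
  hadd_assoc : forall (x y : C) (f g h : hom x y),
      hadd f (hadd g h) ≈ hadd (hadd f g) h;
  hadd_comm : forall (x y : C) (f g : hom x y), hadd f g ≈ hadd g f;
  hadd_zero : forall (x y : C) (f : hom x y), hadd f (hzero x y) ≈ f;
  hadd_opp : forall (x y : C) (f : hom x y), hadd f (hopp f) ≈ hzero x y;
  comp_add_l : forall (x y z : C) (g g' : hom y z) (f : hom x y),
      hadd g g' ∘ f ≈ hadd (g ∘ f) (g' ∘ f);
  comp_add_r : forall (x y z : C) (g : hom y z) (f f' : hom x y),
      g ∘ hadd f f' ≈ hadd (g ∘ f) (g ∘ f') }.

Arguments hzero {C} P x y : rename.
Arguments hadd {C} P {x y} f g : rename.
Arguments hopp {C} P {x y} f : rename.
#[export] Existing Instance hadd_proper.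
#[export] Existing Instance hopp_proper.

Definition is_biproduct (C : Cat) (P : Preadditive C) (x y s : C)
    (i : hom x s) (j : hom y s) (p : hom s x) (q : hom s y) : Prop :=
  p ∘ i ≈ idm x /\ q ∘ j ≈ idm y /\
  p ∘ j ≈ hzero P y x /\ q ∘ i ≈ hzero P x y /\
  hadd P (i ∘ p) (j ∘ q) ≈ idm s.

Definition additive (C : Cat) (P : Preadditive C) : Prop :=
  (exists z : C, is_zero_object z) /\
  (forall x y : C, exists (s : C) (i : hom x s) (j : hom y s)
                          (p : hom s x) (q : hom s y), is_biproduct P i j p q).

Definition is_kernel (C : Cat) (P : Preadditive C) (x y z : C)
    (k : hom x y) (g : hom y z) : Prop :=
  g ∘ k ≈ hzero P x z /\
  forall (t : C) (f : hom t y), g ∘ f ≈ hzero P t z ->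
    exists_unique_hom (fun u : hom t x => k ∘ u ≈ f).

Definition is_cokernel (C : Cat) (P : Preadditive C) (x y z : C)
    (k : hom x y) (g : hom y z) : Prop :=
  g ∘ k ≈ hzero P x z /\
  forall (t : C) (f : hom y t), f ∘ k ≈ hzero P x t ->
    exists_unique_hom (fun u : hom z t => u ∘ g ≈ f).

Definition is_pushout (C : Cat) (a b a' b' : C)
    (f : hom a b) (k : hom a a') (f' : hom a' b') (k' : hom b b') : Prop :=
  k' ∘ f ≈ f' ∘ k /\
  forall (t : C) (u : hom b t) (v : hom a' t), u ∘ f ≈ v ∘ k ->
    exists_unique_hom (fun w : hom b' t => w ∘ k' ≈ u /\ w ∘ f' ≈ v).

Definition is_pullback (C : Cat) (a b a' b' : C)
    (f : hom a b) (k : hom a' a) (f' : hom a' b') (k' : hom b' b) : Prop :=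
  f ∘ k ≈ k' ∘ f' /\
  forall (t : C) (u : hom t a) (v : hom t b'), f ∘ u ≈ k' ∘ v ->
    exists_unique_hom (fun w : hom t a' => k ∘ w ≈ u /\ f' ∘ w ≈ v).

Record ExactCat : Type := {
  ecat :> Cat;
  epre : Preadditive ecat;
  eadditive : additive epre;
  (* [conf i p]: the pair (i, p) is an admissible short exact sequence *)
  conf : forall {x y z : ecat}, hom x y -> hom y z -> Prop;
  conf_kernel : forall (x y z : ecat) (i : hom x y) (p : hom y z),
      conf i p -> is_kernel epre i p;
  conf_cokernel : forall (x y z : ecat) (i : hom x y) (p : hom y z),
      conf i p -> is_cokernel epre i p;
  conf_iso : forall (x y z x' y' z' : ecat)
      (i : hom x y) (p : hom y z) (i' : hom x' y') (p' : hom y' z')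
      (a : hom x x') (b : hom y y') (c : hom z z'),
      is_iso a -> is_iso b -> is_iso c ->
      b ∘ i ≈ i' ∘ a -> c ∘ p ≈ p' ∘ b -> conf i p -> conf i' p';
  id_mono : forall x : ecat, exists (z : ecat) (p : hom x z), conf (idm x) p;
  id_epi : forall x : ecat, exists (z : ecat) (i : hom z x), conf i (idm x);
  mono_comp : forall (x y z : ecat) (i : hom x y) (j : hom y z),
      (exists (c : ecat) (p : hom y c), conf i p) ->
      (exists (c : ecat) (p : hom z c), conf j p) ->
      exists (c : ecat) (p : hom z c), conf (j ∘ i) p;
  epi_comp : forall (x y z : ecat) (p : hom x y) (q : hom y z),
      (exists (k : ecat) (i : hom k x), conf i p) ->
      (exists (k : ecat) (i : hom k y), conf i q) ->
      exists (k : ecat) (i : hom k x), conf i (q ∘ p);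
  mono_pushout : forall (a b a' : ecat) (f : hom a b) (k : hom a a'),
      (exists (c : ecat) (p : hom b c), conf f p) ->
      exists (b' : ecat) (f' : hom a' b') (k' : hom b b'),
        is_pushout f k f' k' /\ exists (c : ecat) (p : hom b' c), conf f' p;
  epi_pullback : forall (a b b' : ecat) (f : hom a b) (k' : hom b' b),
      (exists (c : ecat) (i : hom c a), conf i f) ->
      exists (a' : ecat) (k : hom a' a) (f' : hom a' b'),
        is_pullback f k f' k' /\ exists (c : ecat) (i : hom c a'), conf i f' }.

Arguments conf {e x y z} i p : rename.

Definition weakly_idempotent_complete (A : ExactCat) : Prop :=
  forall (x y : A) (i : hom x y) (r : hom y x), r ∘ i ≈ idm x ->
    exists (z : A) (p : hom y z), is_cokernel (epre A) i p.

Definition adm_mono_with_coker_in (A : ExactCat) (S : A -> Prop) (x y : A)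
    (i : hom x y) : Prop :=
  exists (z : A) (p : hom y z), conf i p /\ S z.

Definition adm_epi_with_ker_in (A : ExactCat) (S : A -> Prop) (y z : A)
    (p : hom y z) : Prop :=
  exists (x : A) (i : hom x y), conf i p /\ S x.

Definition is_projective (A : ExactCat) (P : A) : Prop :=
  forall (x y z : A) (i : hom x y) (p : hom y z), conf i p ->
    forall f : hom P z, exists g : hom P y, p ∘ g ≈ f.

Definition enough_projectives (A : ExactCat) : Prop :=
  forall a : A, exists (k P : A) (i : hom k P) (p : hom P a),
    is_projective P /\ conf i p.

(** Yoneda Ext: every extension of [a] by [b] is Yoneda equivalent to the
    split one. *)
Definition ext1_zero (A : ExactCat) (a b : A) : Prop :=
  forall (e : A) (i : hom b e) (p : hom e a), conf i p ->
    exists (s : A) (i1 : hom b s) (i2 : hom a s) (p1 : hom s b) (p2 : hom s a),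
      is_biproduct (epre A) i1 i2 p1 p2 /\
      exists f : hom e s, f ∘ i ≈ i1 /\ p2 ∘ f ≈ p.

Definition subclass (T : Type) (X Y : T -> Prop) : Prop := forall a, X a -> Y a.
Definition same_class (T : Type) (X Y : T -> Prop) : Prop := forall a, X a <-> Y a.
Definition capc (T : Type) (X Y : T -> Prop) : T -> Prop := fun a => X a /\ Y a.
Definition allc (T : Type) : T -> Prop := fun _ => True.
Arguments allc {T}.

Definition cotorsion_pair (A : ExactCat) (X Y : A -> Prop) : Prop :=
  same_class X (fun a => forall b, Y b -> ext1_zero a b) /\
  same_class Y (fun b => forall a, X a -> ext1_zero a b).

Definition complete_cotorsion_pair (A : ExactCat) (X Y : A -> Prop) : Prop :=
  cotorsion_pair X Y /\
  (forall a : A, exists (y x : A) (i : hom y x) (p : hom x a),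
      conf i p /\ Y y /\ X x) /\
  (forall a : A, exists (y x : A) (i : hom a y) (p : hom y x),
      conf i p /\ Y y /\ X x).

Definition thick (A : ExactCat) (W : A -> Prop) : Prop :=
  (forall x y : A, is_retract x y -> W y -> W x) /\
  (forall (x y z : A) (i : hom x y) (p : hom y z), conf i p ->
     (W x -> W y -> W z) /\ (W x -> W z -> W y) /\ (W y -> W z -> W x)).

Definition projective_cotorsion_pair (A : ExactCat) (C W : A -> Prop) : Prop :=
  complete_cotorsion_pair C W /\ thick W /\
  same_class (capc C W) (@is_projective A).

Record Triple (A : ExactCat) : Type := {
  cofibrant : A -> Prop; trivial : A -> Prop; fibrant : A -> Prop }.

Definition hovey_triple (A : ExactCat) (M : Triple A) : Prop :=
  thick (trivial M) /\
  complete_cotorsion_pair (cofibrant M) (capc (fibrant M) (trivial M)) /\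
  complete_cotorsion_pair (capc (cofibrant M) (trivial M)) (fibrant M).

Section Model.
Context (A : ExactCat) (M : Triple A).

Definition cofibration (x y : A) : hom x y -> Prop :=
  @adm_mono_with_coker_in A (cofibrant M) x y.
Definition trivial_cofibration (x y : A) : hom x y -> Prop :=
  @adm_mono_with_coker_in A (capc (cofibrant M) (trivial M)) x y.
Definition fibration (x y : A) : hom x y -> Prop :=
  @adm_epi_with_ker_in A (fibrant M) x y.
Definition trivial_fibration (x y : A) : hom x y -> Prop :=
  @adm_epi_with_ker_in A (capc (fibrant M) (trivial M)) x y.
Definition weak_equivalence (x y : A) (f : hom x y) : Prop :=
  exists (t : A) (i : hom x t) (p : hom t y),
    trivial_cofibration i /\ trivial_fibration p /\ f ≈ p ∘ i.

Definition Ho : Cat := localization weak_equivalence.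
Definition gamma : Functor A Ho := loc_functor weak_equivalence.
End Model.

Arguments Ho {A} M.
Arguments gamma {A} M.

(** The identity of [A] is a left Quillen equivalence from [M] to [N], with the
    identity from [N] to [M] as its right adjoint. *)
Definition quillen_equivalence_via_id (A : ExactCat) (M N : Triple A) : Prop :=
  (forall (x y : A) (f : hom x y), cofibration M f -> cofibration N f) /\
  (forall (x y : A) (f : hom x y),
      trivial_cofibration M f -> trivial_cofibration N f) /\
  (forall (x y : A) (f : hom x y), fibration N f -> fibration M f) /\
  (forall (x y : A) (f : hom x y),
      trivial_fibration N f -> trivial_fibration M f) /\
  (exists (L : Functor (Ho M) (Ho N)) (e : NatTrans (L ⊚ gamma M) (gamma N)),
      is_right_kan e /\ is_equivalence L) /\
  (exists (R : Functor (Ho N) (Ho M)) (e : NatTrans (gamma M) (R ⊚ gamma N)),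
      is_left_kan e /\ is_equivalence R).

Definition projective_triple (A : ExactCat) (C W : A -> Prop) : Triple A :=
  {| cofibrant := C; trivial := W; fibrant := allc |}.

(** [N] is the left localization of (Ci, Wi) by (Cj, Wj), written
    M_j \ M_i. *)
Definition is_left_localization (A : ExactCat) (Cj Wj Ci Wi : A -> Prop)
    (N : Triple A) : Prop :=
  let defining (W : A -> Prop) :=
    thick W /\ same_class (capc Ci W) Cj /\ same_class (capc W Wj) Wi in
  cofibrant N = Ci /\ fibrant N = Wj /\
  defining (trivial N) /\
  (forall W : A -> Prop, defining W -> same_class W (trivial N)) /\
  hovey_triple N.

Definition full_sub (A : Cat) (S : A -> Prop) : Cat.
Proof.
  refine {| ob := {x : A | S x};
            hom := fun x y => hom (proj1_sig x) (proj1_sig y);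
            heq := fun x y f g => f ≈ g;
            idm := fun x => idm (proj1_sig x);
            comp := fun x y z g f => g ∘ f |}.
  - intros x y f; apply comp_id_l.
  - intros x y f; apply comp_id_r.
  - intros x y z t h g f; apply comp_assoc.
Defined.

Definition full_sub_incl (A : Cat) (S : A -> Prop) : Functor (full_sub S) A.
Proof.
  refine {| fob := fun x : full_sub S => proj1_sig x;
            fmap := fun x y f => f |}; try reflexivity.
  intros x y f g H; exact H.
Defined.

Definition stable_eq (A : ExactCat) (x y : A) (f g : hom x y) : Prop :=
  exists (P : A) (a : hom x P) (b : hom P y),
    is_projective P /\ hadd (epre A) g (hopp (epre A) f) ≈ b ∘ a.

Section PreadditiveFacts.
Context (C : Cat) (P : Preadditive C).
Local Notation "f + g" := (hadd P f g).
Local Notation "- f" := (hopp P f).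
Local Notation "0" := (hzero P _ _).

Lemma hadd_zero_l (x y : C) (f : hom x y) : 0 + f ≈ f.
Proof. now rewrite hadd_comm, hadd_zero. Qed.

Lemma hadd_cancel (x y : C) (f g h : hom x y) : f + h ≈ g + h -> f ≈ g.
Proof.
  intros H.
  rewrite <- (hadd_zero P f), <- (hadd_zero P g), <- (hadd_opp P h),
    !hadd_assoc, H; reflexivity.
Qed.

Lemma comp_zero_l (x y z : C) (f : hom x y) : hzero P y z ∘ f ≈ 0.
Proof.
  apply (hadd_cancel (h := hzero P y z ∘ f)).
  now rewrite <- comp_add_l, hadd_zero, hadd_zero_l.
Qed.

Lemma comp_zero_r (x y z : C) (g : hom y z) : g ∘ hzero P x y ≈ 0.
Proof.
  apply (hadd_cancel (h := g ∘ hzero P x y)).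
  now rewrite <- comp_add_r, hadd_zero, hadd_zero_l.
Qed.

Lemma hopp_unique (x y : C) (f g : hom x y) : f + g ≈ 0 -> g ≈ - f.
Proof.
  intros H. apply (hadd_cancel (h := f)).
  now rewrite (hadd_comm P g f), H, hadd_comm, hadd_opp.
Qed.

Lemma comp_opp_l (x y z : C) (g : hom y z) (f : hom x y) : (- g) ∘ f ≈ - (g ∘ f).
Proof.
  apply hopp_unique. now rewrite <- comp_add_l, hadd_opp, comp_zero_l.
Qed.

Lemma comp_opp_r (x y z : C) (g : hom y z) (f : hom x y) : g ∘ (- f) ≈ - (g ∘ f).
Proof.
  apply hopp_unique. now rewrite <- comp_add_r, hadd_opp, comp_zero_r.
Qed.

Lemma hopp_sub (x y : C) (f g : hom x y) : - (g + - f) ≈ f + - g.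
Proof.
  symmetry. apply hopp_unique.
  rewrite hadd_assoc, <- (hadd_assoc P g (- f) f), (hadd_comm P (- f) f).
  now rewrite hadd_opp, hadd_zero, hadd_opp.
Qed.

Lemma sub_trans (x y : C) (f g h : hom x y) :
  h + - f ≈ (h + - g) + (g + - f).
Proof.
  rewrite hadd_assoc, <- (hadd_assoc P h (- g) g), (hadd_comm P (- g) g).
  now rewrite hadd_opp, hadd_zero.
Qed.

Lemma biproduct_out_eq (x y s t : C) (i : hom x s) (j : hom y s)
    (p : hom s x) (q : hom s y) (u v : hom s t) :
  is_biproduct P i j p q -> u ∘ i ≈ v ∘ i -> u ∘ j ≈ v ∘ j -> u ≈ v.
Proof.
  intros (_ & _ & _ & _ & E) Hi Hj.
  rewrite <- (comp_id_r u), <- (comp_id_r v), <- E, !comp_add_r, !comp_assoc.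
  now rewrite Hi, Hj.
Qed.
End PreadditiveFacts.

Section StableFacts.
Context (A : ExactCat).
Local Notation P := (epre A).

Lemma zero_object_projective (z : A) : is_zero_object z -> is_projective z.
Proof.
  intros [Hi _] a b c i p _ f.
  destruct (Hi b) as [g _], (Hi c) as [h Hh].
  exists g. now rewrite (Hh f), (Hh (p ∘ g)).
Qed.

Lemma biproduct_projective (x y s : A) (i : hom x s) (j : hom y s)
    (p : hom s x) (q : hom s y) :
  is_biproduct P i j p q -> is_projective x -> is_projective y ->
  is_projective s.
Proof.
  intros B Hx Hy a b c k r H f.
  destruct (Hx _ _ _ _ _ H (f ∘ i)) as [g Hg], (Hy _ _ _ _ _ H (f ∘ j)) as [h Hh].
  exists (hadd P (g ∘ p) (h ∘ q)).
  destruct B as (_ & _ & _ & _ & E).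
  rewrite comp_add_r, !comp_assoc, Hg, Hh, <- !comp_assoc, <- comp_add_r, E.
  apply comp_id_r.
Qed.

Lemma stable_eq_of_heq (x y : A) (f g : hom x y) : f ≈ g -> stable_eq f g.
Proof.
  intros H. destruct (eadditive A) as [[z Hz] _].
  exists z, (hzero P _ _), (hzero P _ _).
  split; [now apply zero_object_projective|].
  now rewrite H, hadd_opp, comp_zero_l.
Qed.

Lemma stable_eq_equiv (x y : A) : Equivalence (@stable_eq A x y).
Proof.
  split.
  - intros f; now apply stable_eq_of_heq.
  - intros f g (Q & a & b & HQ & E). exists Q, a, (hopp P b); split; [easy|].
    now rewrite comp_opp_l, <- E, hopp_sub.
  - intros f g h (Q & a & b & HQ & E) (Q' & a' & b' & HQ' & E').
    destruct (eadditive A) as [_ B].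
    destruct (B Q Q') as (s & i & j & p & q & Hs).
    exists s, (hadd P (i ∘ a) (j ∘ a')), (hadd P (b ∘ p) (b' ∘ q)).
    split; [now apply (biproduct_projective Hs)|].
    destruct Hs as (E1 & E2 & E3 & E4 & _).
    rewrite (sub_trans P f g h), E, E'.
    rewrite comp_add_l, !comp_add_r.
    rewrite <- (comp_assoc b p (i ∘ a)), (comp_assoc p i a), E1, comp_id_l.
    rewrite <- (comp_assoc b p (j ∘ a')), (comp_assoc p j a'), E3.
    rewrite <- (comp_assoc b' q (i ∘ a)), (comp_assoc q i a), E4.
    rewrite <- (comp_assoc b' q (j ∘ a')), (comp_assoc q j a'), E2, comp_id_l.
    rewrite !comp_zero_l, !comp_zero_r, hadd_zero, hadd_zero_l.
    apply hadd_comm.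
Qed.

Lemma stable_eq_comp (x y z : A) (g g' : hom y z) (f f' : hom x y) :
  stable_eq g g' -> stable_eq f f' -> stable_eq (g ∘ f) (g' ∘ f').
Proof.
  intros (Q & a & b & HQ & E) (Q' & a' & b' & HQ' & E').
  destruct (stable_eq_equiv x z) as [_ _ T]. apply (T _ (g' ∘ f) _).
  - exists Q, (a ∘ f), b; split; [easy|].
    now rewrite comp_assoc, <- E, comp_add_l, comp_opp_l.
  - exists Q', a', (g' ∘ b'); split; [easy|].
    now rewrite <- comp_assoc, <- E', comp_add_r, comp_opp_r.
Qed.
End StableFacts.

(** [stab S] is S/~. *)
Definition stab (A : ExactCat) (S : A -> Prop) : Cat.
Proof.
  refine {| ob := {x : A | S x};
            hom := fun x y => hom (proj1_sig x) (proj1_sig y);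
            heq := fun x y f g => stable_eq f g;
            idm := fun x => idm (proj1_sig x);
            comp := fun x y z g f => g ∘ f |}.
  - intros x y; apply stable_eq_equiv.
  - intros x y z g g' Hg f f' Hf; now apply stable_eq_comp.
  - intros x y f; apply stable_eq_of_heq, comp_id_l.
  - intros x y f; apply stable_eq_of_heq, comp_id_r.
  - intros x y z t h g f; apply stable_eq_of_heq, comp_assoc.
Defined.

Definition stab_quot (A : ExactCat) (S : A -> Prop) :
  Functor (full_sub S) (stab S).
Proof.
  refine {| fob := fun x : full_sub S => x : stab S;
            fmap := fun x y (f : @hom (full_sub S) x y) =>
                      f : @hom (stab S) x y |}; try reflexivity.
  intros x y f g H; now apply stable_eq_of_heq.
Defined.

Definition stab_incl (A : ExactCat) (S S' : A -> Prop) (H : subclass S S') :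
  Functor (stab S) (stab S').
Proof.
  refine {| fob := fun x : stab S =>
              exist _ (proj1_sig x) (H _ (proj2_sig x)) : stab S';
            fmap := fun x y f => f |}; try reflexivity.
  intros x y f g E; exact E.
Defined.

Lemma capc_r (T : Type) (X Y : T -> Prop) : subclass (capc X Y) Y.
Proof. intros a [_ H]; exact H. Qed.

Section StableToHo.
Context (A : ExactCat) (C W : A -> Prop).
Context (hCW : same_class (capc C W) (@is_projective A)).
Local Notation P := (epre A).

Lemma biproduct_conf (x y s : A) (i : hom x s) (j : hom y s)
    (p : hom s x) (q : hom s y) :
  is_biproduct P i j p q -> conf i q.
Proof.
  intros B. destruct (id_epi y) as (z & k & Hk).
  assert (Hz : forall (t : A) (f g : hom z t), f ≈ g).
  { assert (H1 : idm z ≈ hzero P z z).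
    { destruct (conf_kernel Hk) as [E U].
      destruct (U z (hzero P _ _)) as (u & _ & Hu); [now apply comp_zero_r|].
      rewrite (Hu (idm z)), (Hu (hzero P z z)); [reflexivity| |].
      - now apply comp_zero_r.
      - now rewrite comp_id_r, <- (comp_id_l k). }
    intros t f g.
    now rewrite <- (comp_id_r f), <- (comp_id_r g), H1, !comp_zero_r. }
  destruct (mono_pushout (f := k) (hzero P z x)) as (b & f' & k' & [_ PU] & c & r & Hr).
  { now exists y, (idm y). }
  destruct (PU s j i (Hz _ _ _)) as (u & [Hu1 Hu2] & _).
  destruct (PU b k' f' (Hz _ _ _)) as (w & _ & Hw).
  pose proof B as (E1 & E2 & E3 & E4 & E5).
  set (v := hadd P (f' ∘ p) (k' ∘ q)).
  assert (Vi : v ∘ i ≈ f').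
  { unfold v. rewrite comp_add_l, <- !comp_assoc, E1, E4, comp_zero_r.
    now rewrite comp_id_r, hadd_zero. }
  assert (Vj : v ∘ j ≈ k').
  { unfold v. rewrite comp_add_l, <- !comp_assoc, E2, E3, comp_zero_r.
    now rewrite comp_id_r, hadd_zero_l. }
  assert (Uiso : is_iso u).
  { exists v; split.
    - rewrite (Hw (v ∘ u)), (Hw (idm b)); [reflexivity| |].
      + now rewrite !comp_id_l.
      + now rewrite <- !comp_assoc, Hu1, Hu2.
    - apply (biproduct_out_eq B); rewrite <- comp_assoc, comp_id_l.
      + now rewrite Vi.
      + now rewrite Vj. }
  destruct (conf_cokernel Hr) as [Er Ur].
  assert (Q0 : q ∘ u ∘ f' ≈ hzero P x y) by now rewrite <- comp_assoc, Hu2.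
  destruct (Ur y _ Q0) as (d & Hd & _).
  destruct (Ur c r Er) as (e & _ & He).
  assert (Rv : r ∘ v ≈ r ∘ k' ∘ q).
  { unfold v. rewrite comp_add_r, !comp_assoc, Er, comp_zero_l.
    now rewrite hadd_zero_l. }
  assert (VU : v ∘ u ≈ idm b).
  { rewrite (Hw (v ∘ u)), (Hw (idm b)); [reflexivity| |].
    + now rewrite !comp_id_l.
    + now rewrite <- !comp_assoc, Hu1, Hu2. }
  refine (conf_iso (a := idm x) (b := u) (c := d) _ Uiso _ _ _ Hr).
  - exists (idm x); split; apply comp_id_l.
  - exists (r ∘ k'); split.
    + rewrite (He (r ∘ k' ∘ d)), (He (idm c)); [reflexivity| |].
      * apply comp_id_l.
      * rewrite <- (comp_assoc (r ∘ k') d r), Hd, comp_assoc, <- Rv.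
        now rewrite <- comp_assoc, VU, comp_id_r.
    + now rewrite comp_assoc, Hd, <- comp_assoc, Hu1.
  - now rewrite comp_id_r, Hu2.
  - now rewrite Hd.
Qed.

Lemma gamma_stable (x y : A) (f g : hom x y) :
  stable_eq f g ->
  fmap (gamma (projective_triple C W)) f ≈ fmap (gamma (projective_triple C W)) g.
Proof.
  intros (Q & a & b & HQ & E).
  set (M := projective_triple C W).
  destruct (eadditive A) as [_ B].
  destruct (B x Q) as (s & i & j & p & q & Hs).
  assert (We : weak_equivalence M i).
  { exists s, i, (idm s). repeat split.
    - exists Q, q. split; [exact (biproduct_conf Hs)|now apply hCW].
    - destruct (id_epi s) as (k & c & Hc). exists k, c. split; [exact Hc|].
      split; [exact I|]. apply (hCW k).
      intros t t' t'' l m _ f0. exists (hzero P _ _).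
      destruct (conf_kernel Hc) as [E0 U0].
      destruct (U0 k (hzero P _ _)) as (u & _ & Hu); [now apply comp_zero_r|].
      assert (H1 : idm k ≈ hzero P k k).
      { rewrite (Hu (idm k)), (Hu (hzero P k k)); [reflexivity| |].
        - now apply comp_zero_r.
        - now rewrite comp_id_r, <- (comp_id_l c). }
      now rewrite comp_zero_r, <- (comp_id_r f0), H1, comp_zero_r.
    - now rewrite comp_id_l. }
  pose proof Hs as (E1 & E2 & E3 & E4 & E5).
  set (i' := hadd P i (j ∘ a)). set (h := hadd P (f ∘ p) (b ∘ q)).
  assert (Pi' : p ∘ i' ≈ idm x).
  { unfold i'. now rewrite comp_add_r, E1, comp_assoc, E3, comp_zero_l, hadd_zero. }
  assert (Hf : h ∘ i ≈ f).
  { unfold h. rewrite comp_add_l, <- !comp_assoc, E1, E4, comp_zero_r.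
    now rewrite comp_id_r, hadd_zero. }
  assert (Hg : h ∘ i' ≈ g).
  { unfold h. rewrite comp_add_l, <- !comp_assoc, Pi', comp_id_r.
    unfold i'. rewrite comp_add_r, E4, comp_assoc, E2, comp_id_l, hadd_zero_l, <- E.
    rewrite (hadd_comm P g), hadd_assoc, hadd_opp. apply hadd_zero_l. }
  set (G := gamma M).
  assert (Inv : exists r : hom (G s) (G x),
             r ∘ fmap G i ≈ idm _ /\ fmap G i ∘ r ≈ idm _).
  { exists (loc_inv We). split; [apply loc_eq_inv_l|apply loc_eq_inv_r]. }
  destruct Inv as (r & Hr1 & Hr2).
  assert (Rp : fmap G p ≈ r).
  { rewrite <- (comp_id_r (fmap G p)), <- Hr2, comp_assoc, <- fmap_comp, E1.
    now rewrite fmap_id, comp_id_l. }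
  assert (Eq : fmap G i' ≈ fmap G i).
  { rewrite <- (comp_id_l (fmap G i')), <- Hr2, <- comp_assoc, <- Rp.
    now rewrite <- fmap_comp, Pi', fmap_id, comp_id_r. }
  now rewrite <- Hf, <- Hg, !fmap_comp, Eq.
Qed.

End StableToHo.

Definition stab_to_Ho (A : ExactCat) (S C W : A -> Prop)
    (h : projective_cotorsion_pair C W) :
  Functor (stab S) (Ho (projective_triple C W)).
Proof.
  refine {| fob := fun x : stab S => gamma (projective_triple C W) (proj1_sig x);
            fmap := fun x y (f : @hom (stab S) x y) =>
              @fmap _ _ (gamma (projective_triple C W))
                (proj1_sig x) (proj1_sig y) f |}.
  - intros x y f g H; exact (gamma_stable (proj2 (proj2 h)) H).
  - intros x; exact (fmap_id (gamma (projective_triple C W)) (proj1_sig x)).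
  - intros x y z g f.
    exact (@fmap_comp _ _ (gamma (projective_triple C W))
             (proj1_sig x) (proj1_sig y) (proj1_sig z) g f).
Defined.

(** [F] is the functor C(X, Y) on [B]: it is induced by a choice of admissible
    sequences y >-> F b ->> J b with F b in X and y in Y. *)
Definition is_C_functor (A : ExactCat) (X Y : A -> Prop) (B : Cat)
    (J : Functor B A) (S : A -> Prop) (F : Functor B (stab S)) : Prop :=
  exists eps : forall b : B, hom (proj1_sig (F b)) (J b),
    (forall b : B, X (proj1_sig (F b)) /\ adm_epi_with_ker_in Y (eps b)) /\
    (forall (b b' : B) (f : hom b b'),
        exists g : hom (proj1_sig (F b)) (proj1_sig (F b')),
          stable_eq (fmap F f) g /\ eps b' ∘ g ≈ fmap J f ∘ eps b).

(** [F] is the functor E(X, Y) on [B]: it is induced by a choice of admissible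
    sequences J b >-> F b ->> x with F b in Y and x in X. *)
Definition is_E_functor (A : ExactCat) (X Y : A -> Prop) (B : Cat)
    (J : Functor B A) (S : A -> Prop) (F : Functor B (stab S)) : Prop :=
  exists eta : forall b : B, hom (J b) (proj1_sig (F b)),
    (forall b : B, Y (proj1_sig (F b)) /\ adm_mono_with_coker_in X (eta b)) /\
    (forall (b b' : B) (f : hom b b'),
        exists g : hom (proj1_sig (F b)) (proj1_sig (F b')),
          stable_eq (fmap F f) g /\ g ∘ eta b ≈ eta b' ∘ fmap J f).

Definition triangle_iso (C : Cat) (S : Functor C C) (x y z x' y' z' : C)
    (f : hom x y) (g : hom y z) (h : hom z (S x))
    (f' : hom x' y') (g' : hom y' z') (h' : hom z' (S x')) : Prop :=
  exists (a : hom x x') (b : hom y y') (c : hom z z'),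
    is_iso a /\ is_iso b /\ is_iso c /\
    b ∘ f ≈ f' ∘ a /\ c ∘ g ≈ g' ∘ b /\ fmap S a ∘ h ≈ h' ∘ c.

Record Triangulation (C : Cat) : Type := {
  tpre : Preadditive C;
  tadditive : additive tpre;
  shift : Functor C C;
  shift_equivalence : is_equivalence shift;
  dist : forall {x y z : C}, hom x y -> hom y z -> hom z (shift x) -> Prop;
  tr1_iso : forall (x y z x' y' z' : C)
      (f : hom x y) (g : hom y z) (h : hom z (shift x))
      (f' : hom x' y') (g' : hom y' z') (h' : hom z' (shift x')),
      triangle_iso f g h f' g' h' -> dist f g h -> dist f' g' h';
  tr1_id : forall x z : C, is_zero_object z ->
      dist (idm x) (hzero tpre x z) (hzero tpre z (shift x));
  tr1_cone : forall (x y : C) (f : hom x y),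
      exists (z : C) (g : hom y z) (h : hom z (shift x)), dist f g h;
  tr2_rotate : forall (x y z : C)
      (f : hom x y) (g : hom y z) (h : hom z (shift x)),
      dist f g h <-> dist g h (hopp tpre (fmap shift f));
  tr3_fill : forall (x y z x' y' z' : C)
      (f : hom x y) (g : hom y z) (h : hom z (shift x))
      (f' : hom x' y') (g' : hom y' z') (h' : hom z' (shift x'))
      (a : hom x x') (b : hom y y'),
      dist f g h -> dist f' g' h' -> b ∘ f ≈ f' ∘ a ->
      exists c : hom z z', c ∘ g ≈ g' ∘ b /\ fmap shift a ∘ h ≈ h' ∘ c;
  tr4_octahedral : forall (x y z x' y' z' : C)
      (f : hom x y) (f' : hom y z') (f'' : hom z' (shift x))
      (g : hom y z) (g' : hom z x') (g'' : hom x' (shift y))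
      (h' : hom z y') (h'' : hom y' (shift x)),
      dist f f' f'' -> dist g g' g'' -> dist (g ∘ f) h' h'' ->
      exists (u : hom z' y') (v : hom y' x'),
        dist u v (fmap shift f' ∘ g'') /\
        u ∘ f' ≈ h' ∘ g /\ h'' ∘ u ≈ f'' /\
        v ∘ h' ≈ g' /\ g'' ∘ v ≈ fmap shift f ∘ h'' }.

Arguments dist {C} t {x y z} f g h : rename.

Definition exact_functor (C D : Cat) (TC : Triangulation C) (TD : Triangulation D)
    (F : Functor C D) : Prop :=
  exists t : NatTrans (F ⊚ shift TC) (shift TD ⊚ F),
    (forall x, is_iso (t x)) /\
    (forall (x y z : C) (f : hom x y) (g : hom y z) (h : hom z (shift TC x)),
        dist TC f g h -> dist TD (fmap F f) (fmap F g) (t x ∘ fmap F h)).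

(** [D] has objects taken from [A] through [U], and [q] sends morphisms of [A] to
    morphisms of [D].  The triangulation [T] is the standard one: the shift is
    induced by chosen admissible sequences U x >-> t x ->> U (shift x) with
    t x in [V] and U (shift x) in [K], and the triangles are, up to isomorphism,
    u, v, w for (u, v) an admissible sequence with cokernel in [K] and w the
    induced map to the chosen sequence of the first term. *)
Definition standard_triangulation (A : ExactCat) (V K : A -> Prop) (D : Cat)
    (U : D -> A) (q : forall x y : D, hom (U x) (U y) -> hom x y)
    (T : Triangulation D) : Prop :=
  exists (t : D -> A) (i : forall x : D, hom (U x) (t x))
         (p : forall x : D, hom (t x) (U (shift T x))),
    (forall x : D, conf (i x) (p x) /\ V (t x) /\ K (U (shift T x))) /\
    (forall (x y : D) (f : hom (U x) (U y)),
        exists (phi : hom (t x) (t y)) (g : hom (U (shift T x)) (U (shift T y))),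
          phi ∘ i x ≈ i y ∘ f /\ g ∘ p x ≈ p y ∘ phi /\
          fmap (shift T) (q x y f) ≈ q _ _ g) /\
    (forall (x y z : D) (f : hom x y) (g : hom y z) (h : hom z (shift T x)),
        dist T f g h <->
        exists (x' y' z' : D) (u : hom (U x') (U y')) (v : hom (U y') (U z'))
               (w : hom (U z') (U (shift T x'))) (phi : hom (U y') (t x')),
          conf u v /\ K (U z') /\ phi ∘ u ≈ i x' /\ w ∘ v ≈ p x' ∘ phi /\
          triangle_iso (S := shift T) (q _ _ u) (q _ _ v) (q _ _ w) f g h).

Definition stable_triangulation (A : ExactCat) (C : A -> Prop)
    (T : Triangulation (stab C)) : Prop :=
  @standard_triangulation A (@is_projective A) C (stab C)
    (fun x => proj1_sig x) (fun x y f => f) T.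

(** Suspensions and cofibre sequences of the exact model structure: the chosen
    sequences are x >-> t ->> shift x with t trivially fibrant and shift x
    cofibrant, and the triangles come from cofibrations. *)
Definition homotopy_triangulation (A : ExactCat) (M : Triple A)
    (T : Triangulation (Ho M)) : Prop :=
  @standard_triangulation A (capc (fibrant M) (trivial M)) (cofibrant M) (Ho M)
    (fun x => x) (fun x y f => @fmap _ _ (gamma M) x y f) T.

(** Recollement C' --I--> C --Q--> C''; [Il], [Ir] (resp. [Ql], [Qr]) are the
    left and right adjoints of [I] (resp. [Q]). *)
Definition recollement (C' C C'' : Cat)
    (T' : Triangulation C') (T : Triangulation C) (T'' : Triangulation C'')
    (I : Functor C' C) (Q : Functor C C'')
    (Il Ir : Functor C C') (Ql Qr : Functor C'' C) : Prop :=
  exact_functor T' T I /\ exact_functor T T'' Q /\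
  adjoint Il I /\ adjoint I Ir /\ adjoint Ql Q /\ adjoint Q Qr /\
  fully_faithful I /\ fully_faithful Ql /\ fully_faithful Qr /\
  (forall x : C, in_essential_image I x <-> is_zero_object (Q x)).

(* Main.v *)
From Stdlib Require Import ClassicalEpsilon List PeanoNat.
Require Import Defs.

(** Everything takes place in stable categories. Let [(C, W)] be a projective
    cotorsion pair. The class [C] is closed under extensions and under kernels of
    admissible epimorphisms ([C_ker]), and every [x] in [C] has a row
    [x >-> b ->> s] with [b] projective and [s] in [C], the shift of [x]. So [C] is
    Frobenius, and [stab C] is triangulated by the conflations of [C]
    ([stab_triangulation]). Maps from [C] to [W] are null ([C_to_W_null]); hence a
    map of kernels determines the induced map between the cokernels of such rows up
    to stable equality ([row_map_unique]), and this carries all the compatibilities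
    that the axioms require. Octahedra are instances of Noether's isomorphism. For
    the same reason covers and hulls are stably unique, that is, coreflections and
    reflections. The homotopy category of [(C, W)] is equivalent to [stab C] by the
    cover [x ↦ cov x], and inherits its triangulation ([Ho_triangulation]).

    Now let [W3 ∩ C1 = C2]. The kernel of the [C3]-cover and the [W3]-hull of an
    object of [C1] lie in [C2] ([cover3_kernel], [hull3_C2]). So the inclusion [I]
    of [stab C2] in [stab C1] has the [W3]-hull as left adjoint and the [C2]-cover
    as right adjoint. The functor [Q] is bijective on maps out of objects of [C3],
    since these are cofibrant ([Ho_faithful], [Ho_full]). It is also bijective on
    maps from [C1] into [W2]: such maps in the homotopy category live on the
    [C3]-cover of the source, and they descend along it because its kernel in [C2]
    is invisible to [W2] ([Q_faithful_into], [Q_full_into]). Now [Q] has two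
    sections: [lambda], the [C3]-cover, and [rho], the [W2]-hull of [lambda], whose
    image under [Q] is that of [lambda] as the cokernel of the hull is in [C2], which
    lies in [W3]. The two bijectivity statements say that [lambda] is left adjoint
    and [rho] right adjoint to [Q] and that both are fully faithful
    ([lambda_adjoint], [rho_adjoint]). The objects of [stab C1] that [Q] kills are
    those of [W3 ∩ C1 = C2] ([Q_zero]).

    The left localization of the first pair at the second has [W3] as its class of
    trivial objects. Its weak equivalences and those of the third pair are inverted
    by each other's localizations, so the identity of [A] induces an equivalence of
    homotopy categories ([loc2_quillen]). In the localization at the third pair the trivial objects are
    the quotients of objects of [C3] by objects of [W1]. They form a thick class by
    the horseshoe lemma and the closure of [C3] under cokernels in [C1]
    ([C3_cokernel], [W_loc3_thick]). The objects that are both cofibrant and fibrant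
    are those of [C1 ∩ W3 = C2], and replacement by them identifies the homotopy
    category with [stab C2], which is also that of the second pair
    ([loc3_quillen]). Derived functors are recognized as Kan extensions by their
    values on replacements. *)

Set Implicit Arguments.
Unset Strict Implicit.

(** * Computing in preadditive categories *)

Section AbelianGroup.
Context (C : Cat) (P : Preadditive C) (x y : C).

Lemma hadd_zero_left (f : hom x y) : hadd P (hzero P x y) f ≈ f.
Proof. apply hadd_zero_l. Qed.

Lemma hopp_zero : hopp P (hzero P x y) ≈ hzero P x y.
Proof. symmetry. apply hopp_unique, hadd_zero. Qed.

Lemma hopp_opp (f : hom x y) : hopp P (hopp P f) ≈ f.
Proof. symmetry. apply hopp_unique. rewrite hadd_comm. apply hadd_opp. Qed.

Inductive aexp : Type :=
| AVar (n : nat) | AZero | AAdd (a b : aexp) | AOpp (a : aexp).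

Fixpoint aval (env : list (hom x y)) (e : aexp) : hom x y :=
  match e with
  | AVar n => nth n env (hzero P x y)
  | AZero => hzero P x y
  | AAdd a b => hadd P (aval env a) (aval env b)
  | AOpp a => hopp P (aval env a)
  end.

Fixpoint sumv (env : list (hom x y)) (l : list nat) : hom x y :=
  match l with
  | nil => hzero P x y
  | n :: l => hadd P (nth n env (hzero P x y)) (sumv env l)
  end.

(** The pair stands for the difference of two multisets of variables, so that
    no signs occur and equality in every abelian group becomes equality of
    multisets. *)
Fixpoint anorm (e : aexp) : list nat * list nat :=
  match e with
  | AVar n => (n :: nil, nil)
  | AZero => (nil, nil)
  | AAdd a b => (fst (anorm a) ++ fst (anorm b), snd (anorm a) ++ snd (anorm b))
  | AOpp a => (snd (anorm a), fst (anorm a))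
  end.

Fixpoint remove1 (n : nat) (l : list nat) : option (list nat) :=
  match l with
  | nil => None
  | m :: l => if Nat.eqb n m then Some l
              else option_map (cons m) (remove1 n l)
  end.

Fixpoint same_multiset (l l' : list nat) : bool :=
  match l with
  | nil => match l' with nil => true | _ => false end
  | n :: l => match remove1 n l' with
              | Some l'' => same_multiset l l''
              | None => false
              end
  end.

Lemma sumv_app env l l' :
  sumv env (l ++ l') ≈ hadd P (sumv env l) (sumv env l').
Proof.
  induction l as [|n l IH]; simpl.
  - now rewrite hadd_zero_left.
  - now rewrite IH, hadd_assoc.
Qed.

Lemma remove1_sumv env n l l' :
  remove1 n l = Some l' ->
  sumv env l ≈ hadd P (nth n env (hzero P x y)) (sumv env l').
Proof.
  revert l'; induction l as [|m l IH]; simpl; [discriminate|].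
  intros l'. destruct (Nat.eqb n m) eqn:E.
  - apply Nat.eqb_eq in E. intros H; injection H as <-. now rewrite E.
  - destruct (remove1 n l) as [k|]; simpl; [|discriminate].
    intros H; injection H as <-. simpl. rewrite (IH _ eq_refl).
    rewrite !hadd_assoc, (hadd_comm P (nth m env _)). reflexivity.
Qed.

Lemma same_multiset_sumv env l l' :
  same_multiset l l' = true -> sumv env l ≈ sumv env l'.
Proof.
  revert l'; induction l as [|n l IH]; simpl.
  - destruct l'; [reflexivity|discriminate].
  - intros l'. destruct (remove1 n l') as [k|] eqn:E; [|discriminate].
    intros H. now rewrite (remove1_sumv env E), (IH _ H).
Qed.

Lemma anorm_correct env e :
  hadd P (aval env e) (sumv env (snd (anorm e))) ≈ sumv env (fst (anorm e)).
Proof.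
  induction e as [n| |a IHa b IHb|a IH]; simpl.
  - reflexivity.
  - apply hadd_zero.
  - rewrite !sumv_app, <- IHa, <- IHb, !hadd_assoc.
    rewrite <- (hadd_assoc P (aval env a) (aval env b)).
    rewrite <- (hadd_assoc P (aval env a) (sumv env (snd (anorm a)))).
    now rewrite (hadd_comm P (aval env b) (sumv env (snd (anorm a)))).
  - rewrite <- IH, hadd_assoc, (hadd_comm P (hopp P _)), hadd_opp.
    apply hadd_zero_left.
Qed.

Lemma abel_correct env e e' :
  same_multiset (fst (anorm e) ++ snd (anorm e'))
                (fst (anorm e') ++ snd (anorm e)) = true ->
  aval env e ≈ aval env e'.
Proof.
  intros H. apply (same_multiset_sumv env) in H. rewrite !sumv_app in H.
  rewrite <- !anorm_correct in H.
  apply (hadd_cancel (P := P)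
    (h := hadd P (sumv env (snd (anorm e))) (sumv env (snd (anorm e'))))).
  rewrite hadd_assoc, H, <- hadd_assoc.
  now rewrite (hadd_comm P (sumv env (snd (anorm e')))).
Qed.

End AbelianGroup.

Ltac env_index a l :=
  match l with
  | a :: _ => constr:(0)
  | _ :: ?l' => let n := env_index a l' in constr:(S n)
  end.

Ltac env_add P a l :=
  match a with
  | hzero _ _ _ => l
  | hadd _ ?f ?g => let l1 := env_add P f l in env_add P g l1
  | hopp _ ?f => env_add P f l
  | _ => match l with
         | _ => let n := env_index a l in l
         | _ => constr:(a :: l)
         end
  end.

Ltac reify a l :=
  match a with
  | hzero _ _ _ => constr:(AZero)
  | hadd _ ?f ?g => let e1 := reify f l in let e2 := reify g l in constr:(AAdd e1 e2)
  | hopp _ ?f => let e := reify f l in constr:(AOpp e)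
  | _ => let n := env_index a l in constr:(AVar n)
  end.

(** Decides equations that hold in every abelian group. *)
Ltac abel :=
  match goal with
  | |- @heq ?C ?x ?y ?f ?g =>
      match f with context [@hzero _ ?P _ _] => abel_with C P x y f g
      | context [@hadd _ ?P _ _ _ _] => abel_with C P x y f g
      | context [@hopp _ ?P _ _ _] => abel_with C P x y f g
      | _ => match g with
         | context [@hzero _ ?P _ _] => abel_with C P x y f g
         | context [@hadd _ ?P _ _ _ _] => abel_with C P x y f g
         | context [@hopp _ ?P _ _ _] => abel_with C P x y f g
         | _ => reflexivity
      end end
  end
with abel_with C P x y f g :=
  let l := env_add P f (@nil (@hom C x y)) in
  let l := env_add P g l in
  let e1 := reify f l in
  let e2 := reify g l in
  exact (@abel_correct C P x y l e1 e2 eq_refl).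

Lemma comp_assoc_pre (C : Cat) (x y z t : C) (g : hom y z) (f : hom x y)
  (h : hom x z) : g ∘ f ≈ h -> forall k : hom t x, g ∘ (f ∘ k) ≈ h ∘ k.
Proof. intros H k. now rewrite comp_assoc, H. Qed.

(** The normal form is a sum of right-bracketed composites. *)
Ltac expand :=
  repeat first
    [ rewrite comp_add_l | rewrite comp_add_r | rewrite comp_opp_l
    | rewrite comp_opp_r | rewrite comp_zero_l | rewrite comp_zero_r
    | rewrite comp_id_l | rewrite comp_id_r | rewrite <- comp_assoc ].

(** The composite [g ∘ f] is not a subterm of [g ∘ (f ∘ k)], which is what [expand]
    leaves; hence the first alternative. *)
Tactic Notation "crw" constr(H) :=
  first [ rewrite (comp_assoc_pre H) | rewrite H ].
Tactic Notation "crw" "<-" constr(H) :=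
  let H' := constr:(symmetry H) in
  first [ rewrite (comp_assoc_pre H') | rewrite H' ].

(** * Isomorphisms, equivalences and adjunctions *)

(** Approximations are given by existence statements; functors on them need a
    simultaneous choice. *)
Definition chosen (T : Type) (P : T -> Prop) (H : exists x, P x) : {x | P x} :=
  constructive_indefinite_description P H.

Definition the_hom (C : Cat) (x y : C) (P : hom x y -> Prop)
  (H : exists_unique_hom P) : hom x y := proj1_sig (chosen H).

Lemma the_hom_spec (C : Cat) (x y : C) (P : hom x y -> Prop)
  (H : exists_unique_hom P) : P (the_hom H).
Proof. exact (proj1 (proj2_sig (chosen H))). Qed.

Definition inv_of (C : Cat) (x y : C) (f : hom x y) (H : is_iso f) : hom y x :=
  proj1_sig (chosen H).

Lemma inv_of_l (C : Cat) (x y : C) (f : hom x y) (H : is_iso f) :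
  inv_of H ∘ f ≈ idm x.
Proof. exact (proj1 (proj2_sig (chosen H))). Qed.

Lemma inv_of_r (C : Cat) (x y : C) (f : hom x y) (H : is_iso f) :
  f ∘ inv_of H ≈ idm y.
Proof. exact (proj2 (proj2_sig (chosen H))). Qed.

Section Isos.
Context (C : Cat).

Lemma iso_id (x : C) : is_iso (idm x).
Proof. exists (idm x); split; apply comp_id_l. Qed.

Lemma iso_comp (x y z : C) (g : hom y z) (f : hom x y) :
  is_iso g -> is_iso f -> is_iso (g ∘ f).
Proof.
  intros (g' & G1 & G2) (f' & F1 & F2). exists (f' ∘ g'). split; expand.
  - crw G1. now rewrite comp_id_l.
  - crw F2. now rewrite comp_id_l.
Qed.

Lemma iso_heq (x y : C) (f g : hom x y) : f ≈ g -> is_iso f -> is_iso g.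
Proof. intros E (h & H1 & H2). exists h. now rewrite <- E. Qed.

Lemma iso_inv (x y : C) (f : hom x y) (g : hom y x) :
  g ∘ f ≈ idm x -> f ∘ g ≈ idm y -> is_iso g.
Proof. intros H1 H2. now exists f. Qed.

Lemma iso_epi (x y z : C) (f : hom x y) (g h : hom y z) :
  is_iso f -> g ∘ f ≈ h ∘ f -> g ≈ h.
Proof.
  intros (f' & _ & H) E.
  now rewrite <- (comp_id_r g), <- (comp_id_r h), <- H, !comp_assoc, E.
Qed.

Lemma iso_mono (x y z : C) (f : hom y z) (g h : hom x y) :
  is_iso f -> f ∘ g ≈ f ∘ h -> g ≈ h.
Proof.
  intros (f' & H & _) E.
  now rewrite <- (comp_id_l g), <- (comp_id_l h), <- H, <- !comp_assoc, E.
Qed.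

Lemma iso_cancel_r (x y z : C) (g : hom y z) (f : hom x y) :
  is_iso f -> is_iso (g ∘ f) -> is_iso g.
Proof.
  intros (f' & F1 & F2) H. apply (iso_heq (f := (g ∘ f) ∘ f')).
  - rewrite <- comp_assoc, F2. apply comp_id_r.
  - apply iso_comp; [easy|]. now apply (iso_inv F1).
Qed.

Lemma iso_cancel_l (x y z : C) (g : hom y z) (f : hom x y) :
  is_iso g -> is_iso (g ∘ f) -> is_iso f.
Proof.
  intros (f' & F1 & F2) H. apply (iso_heq (f := f' ∘ (g ∘ f))).
  - rewrite comp_assoc, F1. apply comp_id_l.
  - apply iso_comp; [|easy]. now apply (iso_inv F1).
Qed.

Lemma isomorphic_sym (x y : C) : isomorphic x y -> isomorphic y x.
Proof. intros (f & g & H1 & H2). exists g. now exists f. Qed.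

Lemma zero_object_maps (z x : C) (f g : hom z x) : is_zero_object z -> f ≈ g.
Proof. intros [H _]. destruct (H x) as [h Hh]. now rewrite (Hh f), (Hh g). Qed.

Lemma zero_object_comaps (z x : C) (f g : hom x z) : is_zero_object z -> f ≈ g.
Proof. intros [_ H]. destruct (H x) as [h Hh]. now rewrite (Hh f), (Hh g). Qed.

Lemma zero_object_id (P : Preadditive C) (z : C) :
  is_zero_object z <-> idm z ≈ hzero P z z.
Proof.
  split; [intros H; now apply zero_object_maps|].
  intros E; split; intros x; exists (hzero P _ _); intros g.
  - rewrite <- (comp_id_r g), E. apply comp_zero_r.
  - rewrite <- (comp_id_l g), E. apply comp_zero_l.
Qed.

Lemma zero_object_iso (x y : C) :
  isomorphic x y -> is_zero_object x -> is_zero_object y.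
Proof.
  intros (f & g & H1 & H2) [K1 K2]. split; intros t.
  - destruct (K1 t) as [h Hh]. exists (h ∘ g). intros k.
    now rewrite <- (Hh (k ∘ f)), <- comp_assoc, H2, comp_id_r.
  - destruct (K2 t) as [h Hh]. exists (f ∘ h). intros k.
    now rewrite <- (Hh (g ∘ k)), comp_assoc, H2, comp_id_l.
Qed.

End Isos.

Lemma fmap_iso (C D : Cat) (F : Functor C D) (x y : C) (f : hom x y) :
  is_iso f -> is_iso (fmap F f).
Proof.
  intros (g & H1 & H2). exists (fmap F g).
  now rewrite <- !fmap_comp, H1, H2, !fmap_id.
Qed.

Lemma ff_reflects_iso (C D : Cat) (F : Functor C D) (x y : C) (f : hom x y) :
  fully_faithful F -> is_iso (fmap F f) -> is_iso f.
Proof.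
  intros [Fa Fu] (g & H1 & H2). destruct (Fu _ _ g) as [h Hh].
  exists h. split; apply Fa; now rewrite fmap_comp, fmap_id, Hh.
Qed.

Lemma fmap_eq (C D : Cat) (F : Functor C D) (x y : C) (f g : hom x y) :
  f ≈ g -> fmap F f ≈ fmap F g.
Proof. apply fmap_proper. Qed.

Lemma fmap_functor_comp (B C D : Cat) (G : Functor C D) (F : Functor B C)
  (x y : B) (f : hom x y) : fmap (G ⊚ F) f ≈ fmap G (fmap F f).
Proof. reflexivity. Qed.

Lemma fmap_section (C D : Cat) (F : Functor C D) (x y : C) (f : hom x y)
  (g : hom y x) : g ∘ f ≈ idm x -> fmap F g ∘ fmap F f ≈ idm (F x).
Proof. intros H. now rewrite <- fmap_comp, H, fmap_id. Qed.

(** ** Natural isomorphisms *)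

Section NaturalIsos.
Context (C D : Cat).

Lemma nat_iso_intro (F G : Functor C D) (t : forall x, hom (F x) (G x)) :
  (forall x, is_iso (t x)) ->
  (forall x y (f : hom x y), t y ∘ fmap F f ≈ fmap G f ∘ t x) ->
  naturally_isomorphic F G.
Proof. intros H N. now exists {| component := t; naturality := N |}. Qed.

Lemma nat_iso_sym (F G : Functor C D) :
  naturally_isomorphic F G -> naturally_isomorphic G F.
Proof.
  intros (t & Ht).
  set (s := fun x => inv_of (Ht x)).
  assert (S1 : forall x, s x ∘ t x ≈ idm _) by (intros x; apply inv_of_l).
  assert (S2 : forall x, t x ∘ s x ≈ idm _) by (intros x; apply inv_of_r).
  apply (nat_iso_intro (t := s)).
  - intros x. now exists (t x).
  - intros x y f. apply (iso_mono (Ht y)). apply (iso_epi (Ht x)).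
    expand. rewrite (S1 x), comp_id_r, <- (naturality t).
    rewrite comp_assoc, (S2 y). apply comp_id_l.
Qed.

Lemma nat_iso_trans (F G H : Functor C D) :
  naturally_isomorphic F G -> naturally_isomorphic G H -> naturally_isomorphic F H.
Proof.
  intros (t & Ht) (s & Hs).
  apply (nat_iso_intro (t := fun x => s x ∘ t x)).
  - intros x. now apply iso_comp.
  - intros x y f. rewrite <- comp_assoc, (naturality t), !comp_assoc.
    now rewrite (naturality s).
Qed.

End NaturalIsos.

Lemma nat_iso_postcomp (C D E : Cat) (H : Functor D E) (F G : Functor C D) :
  naturally_isomorphic F G -> naturally_isomorphic (H ⊚ F) (H ⊚ G).
Proof.
  intros (t & Ht).
  apply (nat_iso_intro (F := H ⊚ F) (G := H ⊚ G) (t := fun x => fmap H (t x))).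
  - intros x. exact (fmap_iso H (Ht x)).
  - intros x y f. simpl. now rewrite <- !fmap_comp, (naturality t).
Qed.

Lemma equivalence_comp (C D E : Cat) (F : Functor C D) (G : Functor D E) :
  is_equivalence F -> is_equivalence G -> is_equivalence (G ⊚ F).
Proof.
  intros (F' & (f1 & Hf1) & (f2 & Hf2)) (G' & (g1 & Hg1) & (g2 & Hg2)).
  exists (F' ⊚ G'). split.
  - apply (nat_iso_intro (F := F' ⊚ G' ⊚ (G ⊚ F)) (G := functor_id C)
             (t := fun x => f1 x ∘ fmap F' (g1 (F x)))).
    + intros x. apply iso_comp; [apply Hf1|exact (fmap_iso F' (Hg1 (F x)))].
    + intros x y f. simpl. rewrite <- comp_assoc, <- fmap_comp.
      pose proof (naturality g1 (fmap F f)) as N1. pose proof (naturality f1 f) as N2.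
      simpl in N1, N2. now rewrite N1, fmap_comp, !comp_assoc, N2.
  - apply (nat_iso_intro (F := G ⊚ F ⊚ (F' ⊚ G')) (G := functor_id E)
             (t := fun x => g2 x ∘ fmap G (f2 (G' x)))).
    + intros x. apply iso_comp; [apply Hg2|exact (fmap_iso G (Hf2 (G' x)))].
    + intros x y f. simpl. rewrite <- comp_assoc, <- fmap_comp.
      pose proof (naturality f2 (fmap G' f)) as N1. pose proof (naturality g2 f) as N2.
      simpl in N1, N2. now rewrite N1, fmap_comp, !comp_assoc, N2.
Qed.

Lemma equivalence_ff (C D : Cat) (F : Functor C D) (G : Functor D C) :
  naturally_isomorphic (G ⊚ F) (functor_id C) ->
  naturally_isomorphic (F ⊚ G) (functor_id D) -> fully_faithful F.
Proof.
  intros (t & Ht) (s & Hs).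
  assert (Fa : forall x y (f g : hom x y), fmap F f ≈ fmap F g -> f ≈ g).
  { intros x y f g E. apply (iso_epi (Ht x)).
    pose proof (naturality t f) as Nf. pose proof (naturality t g) as Ng.
    simpl in Nf, Ng. now rewrite <- Nf, <- Ng, E. }
  assert (Ga : forall x y (f g : hom x y), fmap G f ≈ fmap G g -> f ≈ g).
  { intros x y f g E. apply (iso_epi (Hs x)).
    pose proof (naturality s f) as Nf. pose proof (naturality s g) as Ng.
    simpl in Nf, Ng. now rewrite <- Nf, <- Ng, E. }
  split; [exact Fa|]. intros x y g.
  destruct (Ht x) as (t' & T1 & T2).
  exists (t y ∘ fmap G g ∘ t'). apply Ga.
  apply (iso_mono (Ht y)).
  pose proof (naturality t (t y ∘ fmap G g ∘ t')) as N. simpl in N.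
  rewrite N. rewrite <- comp_assoc. simpl. rewrite T1. now rewrite comp_id_r.
Qed.

(** ** Adjoints from universal arrows *)

(** The counit is the map induced by an identity; the universal property gives its
    naturality. *)
Lemma adjoint_of_unit (C D : Cat) (L : Functor C D) (R : Functor D C)
    (eta : forall x, hom x (R (L x))) :
  (forall x y (f : hom x y), eta y ∘ f ≈ fmap R (fmap L f) ∘ eta x) ->
  (forall x d (f : hom x (R d)),
     exists_unique_hom (fun g : hom (L x) d => fmap R g ∘ eta x ≈ f)) ->
  adjoint L R.
Proof.
  intros N univ.
  assert (Eq : forall x d (g g' : hom (L x) d),
             fmap R g ∘ eta x ≈ fmap R g' ∘ eta x -> g ≈ g').
  { intros x d g g' E. destruct (univ _ _ (fmap R g' ∘ eta x)) as (u & _ & U).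
    now rewrite (U g E), (U g'). }
  set (c := fun d => the_hom (univ _ _ (idm (R d)))).
  assert (Hc : forall d, fmap R (c d) ∘ eta (R d) ≈ idm (R d))
    by (intros d; exact (the_hom_spec (univ _ _ _))).
  exists (Build_NatTrans (F := functor_id C) (G := R ⊚ L) N).
  unshelve eexists {| component := c : forall d, hom ((L ⊚ R) d) (functor_id D d) |}.
  - intros x y f. apply Eq.
    change (fmap R (c y ∘ fmap L (fmap R f)) ∘ eta (R x) ≈ fmap R (f ∘ c x) ∘ eta (R x)).
    rewrite !fmap_comp, <- !comp_assoc, <- N, Hc, comp_assoc, Hc.
    now rewrite comp_id_l, comp_id_r.
  - split; [|exact Hc]. intros x. apply Eq.
    change (fmap R (c (L x) ∘ fmap L (eta x)) ∘ eta x ≈ fmap R (idm (L x)) ∘ eta x).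
    now rewrite fmap_comp, <- comp_assoc, <- N, comp_assoc, Hc, fmap_id.
Qed.

Lemma adjoint_of_counit (C D : Cat) (L : Functor C D) (R : Functor D C)
    (eps : forall x, hom (L (R x)) x) :
  (forall x y (f : hom x y), eps y ∘ fmap L (fmap R f) ≈ f ∘ eps x) ->
  (forall d x (f : hom (L d) x),
     exists_unique_hom (fun g : hom d (R x) => eps x ∘ fmap L g ≈ f)) ->
  adjoint L R.
Proof.
  intros N univ.
  assert (Eq : forall d x (g g' : hom d (R x)),
             eps x ∘ fmap L g ≈ eps x ∘ fmap L g' -> g ≈ g').
  { intros d x g g' E. destruct (univ _ _ (eps x ∘ fmap L g')) as (u & _ & U).
    now rewrite (U g E), (U g'). }
  set (c := fun d => the_hom (univ _ _ (idm (L d)))).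
  assert (Hc : forall d, eps (L d) ∘ fmap L (c d) ≈ idm (L d))
    by (intros d; exact (the_hom_spec (univ _ _ _))).
  unshelve eexists {| component := c : forall d, hom (functor_id C d) ((R ⊚ L) d) |}.
  { intros x y f. apply Eq.
    change (eps (L y) ∘ fmap L (c y ∘ f) ≈ eps (L y) ∘ fmap L (fmap R (fmap L f) ∘ c x)).
    rewrite !fmap_comp, !comp_assoc, N, Hc, <- comp_assoc, Hc.
    now rewrite comp_id_l, comp_id_r. }
  exists (Build_NatTrans (F := L ⊚ R) (G := functor_id D) N).
  split; [exact Hc|]. intros x. apply Eq.
  change (eps x ∘ fmap L (fmap R (eps x) ∘ c (R x)) ≈ eps x ∘ fmap L (idm (R x))).
  now rewrite fmap_comp, comp_assoc, N, <- comp_assoc, Hc, fmap_id.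
Qed.

Section LeftAdjoint.
Context (C D : Cat) (R : Functor D C) (L0 : C -> D)
  (eta : forall x, hom x (R (L0 x)))
  (univ : forall x d (f : hom x (R d)),
      exists_unique_hom (fun g : hom (L0 x) d => fmap R g ∘ eta x ≈ f)).

Lemma universal_eq x d (g g' : hom (L0 x) d) :
  fmap R g ∘ eta x ≈ fmap R g' ∘ eta x -> g ≈ g'.
Proof.
  intros E. destruct (univ (fmap R g' ∘ eta x)) as (u & _ & U).
  now rewrite (U g E), (U g').
Qed.

Definition left_functor : Functor C D.
Proof.
  refine {| fob := L0;
            fmap := fun x y f => the_hom (univ (eta y ∘ f)) |}.
  - intros x y f g E. apply universal_eq.
    now rewrite (the_hom_spec (univ _)), (the_hom_spec (univ _)), E.
  - intros x. apply universal_eq.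
    now rewrite (the_hom_spec (univ _)), fmap_id, comp_id_l, comp_id_r.
  - intros x y z g f. apply universal_eq.
    rewrite (the_hom_spec (univ _)), fmap_comp, <- comp_assoc.
    rewrite (the_hom_spec (univ _)), !comp_assoc.
    now rewrite (the_hom_spec (univ _)).
Defined.

Lemma left_functor_spec x y (f : hom x y) :
  fmap R (fmap left_functor f) ∘ eta x ≈ eta y ∘ f.
Proof. exact (the_hom_spec (univ _)). Qed.

Lemma left_functor_adjoint : adjoint left_functor R.
Proof.
  apply (adjoint_of_unit (L := left_functor) (eta := eta)); [|exact univ].
  intros x y f. symmetry. apply left_functor_spec.
Qed.
End LeftAdjoint.

Section RightAdjoint.
Context (C D : Cat) (L : Functor D C) (R0 : C -> D)
  (eps : forall x, hom (L (R0 x)) x)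
  (univ : forall d x (f : hom (L d) x),
      exists_unique_hom (fun g : hom d (R0 x) => eps x ∘ fmap L g ≈ f)).

Lemma couniversal_eq d x (g g' : hom d (R0 x)) :
  eps x ∘ fmap L g ≈ eps x ∘ fmap L g' -> g ≈ g'.
Proof.
  intros E. destruct (univ (eps x ∘ fmap L g')) as (u & _ & U).
  now rewrite (U g E), (U g').
Qed.

Definition right_functor : Functor C D.
Proof.
  refine {| fob := R0;
            fmap := fun x y f => the_hom (univ (f ∘ eps x)) |}.
  - intros x y f g E. apply couniversal_eq.
    now rewrite (the_hom_spec (univ _)), (the_hom_spec (univ _)), E.
  - intros x. apply couniversal_eq.
    now rewrite (the_hom_spec (univ _)), fmap_id, comp_id_l, comp_id_r.
  - intros x y z g f. apply couniversal_eq.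
    rewrite (the_hom_spec (univ _)), fmap_comp, comp_assoc.
    rewrite (the_hom_spec (univ _)), <- !comp_assoc.
    now rewrite (the_hom_spec (univ _)).
Defined.

Lemma right_functor_spec x y (f : hom x y) :
  eps y ∘ fmap L (fmap right_functor f) ≈ f ∘ eps x.
Proof. exact (the_hom_spec (univ _)). Qed.

Lemma right_functor_adjoint : adjoint L right_functor.
Proof.
  apply (adjoint_of_counit (R := right_functor) (eps := eps)); [|exact univ].
  exact right_functor_spec.
Qed.
End RightAdjoint.

Lemma equivalence_of_ff (C D : Cat) (F : Functor C D) :
  fully_faithful F -> (forall d, exists c, isomorphic (F c) d) -> is_equivalence F.
Proof.
  intros HF Es. pose proof HF as [Fa Fu].
  set (R0 := fun d => proj1_sig (chosen (Es d))).
  assert (E : forall d, exists e : hom (F (R0 d)) d, is_iso e)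
    by (intros d; exact (proj2_sig (chosen (Es d)))).
  set (eps := fun d => proj1_sig (chosen (E d))).
  assert (He : forall d, is_iso (eps d)) by (intros d; exact (proj2_sig (chosen (E d)))).
  assert (univ : forall c d (f : hom (F c) d),
             exists_unique_hom (fun g : hom c (R0 d) => eps d ∘ fmap F g ≈ f)).
  { intros c d f. destruct (Fu _ _ (inv_of (He d) ∘ f)) as (g & Hg).
    exists g. split.
    - now rewrite Hg, comp_assoc, inv_of_r, comp_id_l.
    - intros v Hv. apply Fa. apply (iso_mono (He d)).
      now rewrite Hv, Hg, comp_assoc, inv_of_r, comp_id_l. }
  exists (right_functor univ). split.
  - set (n := fun c => proj1_sig (chosen (Fu _ _ (eps (F c))))).
    assert (Hn : forall c, fmap F (n c) ≈ eps (F c))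
      by (intros c; exact (proj2_sig (chosen (Fu _ _ (eps (F c)))))).
    apply (nat_iso_intro (F := right_functor univ ⊚ F) (G := functor_id C) (t := n)).
    + intros c. apply (ff_reflects_iso (F := F)); [exact HF|].
      now apply (iso_heq (symmetry (Hn c))).
    + intros x y f. apply Fa.
      change (fmap F (n y ∘ fmap (right_functor univ) (fmap F f)) ≈ fmap F (f ∘ n x)).
      rewrite !fmap_comp, !Hn. apply right_functor_spec.
  - apply (nat_iso_intro (F := F ⊚ right_functor univ) (G := functor_id D) (t := eps)).
    + exact He.
    + intros x y f. apply right_functor_spec.
Qed.

(** Let [L] be a section of [Q], up to the isomorphism [t]. If [Q] is bijective
    on the maps out of the values of [L], then the inverse of [t] is universal,
    that is, the unit of an adjunction; if it is bijective on the maps into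
    them, then [t] is a counit. *)
Section Sections.
Context (C D : Cat) (Q : Functor C D) (L : Functor D C) (t : forall x, hom (Q (L x)) x)
  (Ht : forall x, is_iso (t x))
  (N : forall x y (f : hom x y), t y ∘ fmap Q (fmap L f) ≈ f ∘ t x).

Lemma section_ff :
  (forall x y (f g : hom (L x) (L y)), fmap Q f ≈ fmap Q g -> f ≈ g) ->
  fully_faithful L.
Proof.
  intros Fa. split.
  - intros x y f g E. apply (iso_epi (Ht x)). rewrite <- !N. now rewrite E.
  - intros x y g. exists (t y ∘ fmap Q g ∘ inv_of (Ht x)). apply Fa.
    apply (iso_mono (Ht y)). rewrite N, <- comp_assoc, inv_of_l. apply comp_id_r.
Qed.

Lemma left_adjoint_of_section :
  (forall x y (f g : hom (L x) y), fmap Q f ≈ fmap Q g -> f ≈ g) ->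
  (forall x y (g : hom (Q (L x)) (Q y)), exists f, fmap Q f ≈ g) ->
  adjoint L Q.
Proof.
  intros Fa Fu. apply (adjoint_of_unit (L := L) (R := Q) (eta := fun x => inv_of (Ht x))).
  - intros x y f. apply (iso_mono (Ht y)). apply (iso_epi (Ht x)).
    rewrite !comp_assoc, inv_of_r, comp_id_l, N.
    now rewrite <- comp_assoc, inv_of_l, comp_id_r.
  - intros x d f. destruct (Fu _ _ (f ∘ t x)) as (g & Hg). exists g. split.
    + now rewrite Hg, <- comp_assoc, inv_of_r, comp_id_r.
    + intros v Hv. apply Fa.
      now rewrite Hg, <- Hv, <- comp_assoc, inv_of_l, comp_id_r.
Qed.

Lemma right_adjoint_of_section :
  (forall x y (f g : hom y (L x)), fmap Q f ≈ fmap Q g -> f ≈ g) ->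
  (forall x y (g : hom (Q y) (Q (L x))), exists f, fmap Q f ≈ g) ->
  adjoint Q L.
Proof.
  intros Fa Fu. apply (adjoint_of_counit (L := Q) (R := L) (eps := t)); [exact N|].
  intros d x f. destruct (Fu _ _ (inv_of (Ht x) ∘ f)) as (g & Hg). exists g. split.
  - now rewrite Hg, comp_assoc, inv_of_r, comp_id_l.
  - intros v Hv. apply Fa.
    now rewrite Hg, <- Hv, comp_assoc, inv_of_l, comp_id_l.
Qed.
End Sections.

(** * Localizations *)

Section LocalizationProperty.
Context (C : Cat) (W : forall x y : C, hom x y -> Prop).
Local Notation loc := (localization W).
Local Notation Γ := (loc_functor W).

Definition inverts (D : Cat) (F : Functor C D) : Prop :=
  forall x y (f : hom x y), W f -> is_iso (fmap F f).

Lemma loc_functor_inverts : inverts Γ.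
Proof.
  intros x y f H. exists (loc_inv H). split; [apply loc_eq_inv_l|apply loc_eq_inv_r].
Qed.

Section Lift.
Context (D : Cat) (F : Functor C D) (HF : inverts F).

Fixpoint lift_map (x y : C) (f : loc_hom W x y) : hom (F x) (F y) :=
  match f in loc_hom _ x y return hom (F x) (F y) with
  | @loc_map _ _ a b f => fmap F f
  | @loc_inv _ _ a b s hs => inv_of (HF hs)
  | @loc_comp _ _ a b c g f => lift_map g ∘ lift_map f
  end.

Lemma lift_map_proper (x y : C) (f g : loc_hom W x y) :
  loc_eq f g -> lift_map f ≈ lift_map g.
Proof.
  induction 1 as [| | | | | | | |x y z g f|x y s hs|x y s hs]; simpl.
  - reflexivity.
  - now symmetry.
  - etransitivity; eassumption.
  - now apply comp_proper.
  - apply comp_assoc.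
  - now rewrite fmap_id, comp_id_l.
  - now rewrite fmap_id, comp_id_r.
  - now apply fmap_proper.
  - apply fmap_comp.
  - rewrite fmap_id. apply inv_of_l.
  - rewrite fmap_id. apply inv_of_r.
Qed.

Definition lift : Functor loc D.
Proof.
  refine {| fob := fun x : loc => F x; fmap := lift_map |}.
  - intros x y f g H. now apply lift_map_proper.
  - intros x. apply fmap_id.
  - intros x y z g f. reflexivity.
Defined.

Lemma lift_gamma (x y : C) (f : hom x y) : fmap lift (fmap Γ f) ≈ fmap F f.
Proof. reflexivity. Qed.

End Lift.

(** Naturality with respect to an isomorphism passes to its inverse, and the
    maps of a localization are composites of maps of [C] and inverses. *)
Lemma loc_natural (D : Cat) (K L : Functor loc D) (t : forall x : C, hom (K x) (L x)) :
  (forall (x y : C) (f : hom x y), t y ∘ fmap K (fmap Γ f) ≈ fmap L (fmap Γ f) ∘ t x) ->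
  forall (x y : loc) (f : hom x y), t y ∘ fmap K f ≈ fmap L f ∘ t x.
Proof.
  intros N x y f.
  induction f as [x y f|x y s hs|x y z g IHg f IHf].
  - apply N.
  - assert (E1 : (loc_inv hs : @hom loc y x) ∘ fmap Γ s ≈ idm (x : loc)) by apply loc_eq_inv_l.
    assert (E2 : fmap Γ s ∘ (loc_inv hs : @hom loc y x) ≈ idm (y : loc)) by apply loc_eq_inv_r.
    apply (iso_epi (f := fmap K (fmap Γ s))).
    { apply fmap_iso. now apply loc_functor_inverts. }
    rewrite <- !comp_assoc, N, <- fmap_comp, E1, fmap_id.
    rewrite comp_assoc, <- fmap_comp. now rewrite E1, fmap_id, comp_id_l, comp_id_r.
  - change (loc_comp g f : hom (x:loc) (z:loc)) with ((g : hom (y:loc) (z:loc)) ∘ (f : hom (x:loc) (y:loc))).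
    rewrite !fmap_comp, comp_assoc, IHg, <- comp_assoc, IHf. apply comp_assoc.
Qed.

End LocalizationProperty.

Arguments lift {C W D F} HF.

(** Derived functors exist along deformations. Let every object [x] of [C] have
    an approximation [e x : r x -> x], inverted by [Γ], on which the comparison
    [c] of [L] with [F] is invertible. A transformation to [L] whose composite
    with [c] is given is then forced on [r x], and so on [x]; hence [L] is the
    total left derived functor of [F]. *)
Section Deformation.
Context (C H D : Cat) (Γ : Functor C H) (F : Functor C D) (K L : Functor H D).

Lemma left_deformation (c : forall x, hom (L (Γ x)) (F x))
    (s : forall x, hom (K (Γ x)) (F x)) (r : C -> C) (e : forall x, hom (r x) x) :
  (forall x y (f : hom x y), c y ∘ fmap L (fmap Γ f) ≈ fmap F f ∘ c x) ->
  (forall x y (f : hom x y), s y ∘ fmap K (fmap Γ f) ≈ fmap F f ∘ s x) ->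
  (forall x y (f : hom x y), exists g, e y ∘ g ≈ f ∘ e x) ->
  (forall x, is_iso (fmap Γ (e x))) ->
  (forall x, is_iso (c (r x))) ->
  exists t : forall x, hom (K (Γ x)) (L (Γ x)),
    (forall x y (f : hom x y),
        t y ∘ fmap K (fmap Γ f) ≈ fmap L (fmap Γ f) ∘ t x) /\
    (forall x, c x ∘ t x ≈ s x) /\
    (forall t' : NatTrans K L, (forall x, c x ∘ t' (Γ x) ≈ s x) ->
       forall x, t' (Γ x) ≈ t x).
Proof.
  intros Nc Ns He HΓ Hc.
  assert (HK : forall x, is_iso (fmap K (fmap Γ (e x)))) by (intros x; now apply fmap_iso).
  set (t := fun x => fmap L (fmap Γ (e x)) ∘ (inv_of (Hc x) ∘ (s (r x) ∘ inv_of (HK x)))).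
  assert (T : forall x, t x ∘ fmap K (fmap Γ (e x))
                        ≈ fmap L (fmap Γ (e x)) ∘ (inv_of (Hc x) ∘ s (r x))).
  { intros x. unfold t. rewrite <- !comp_assoc, inv_of_l. now rewrite comp_id_r. }
  exists t. split; [|split].
  - intros x y f. destruct (He x y f) as (g & Hg).
    apply (iso_epi (HK x)).
    rewrite <- !comp_assoc, T, <- !fmap_comp, <- Hg, !fmap_comp, comp_assoc, T.
    rewrite (comp_assoc (fmap L (fmap Γ f))), <- !fmap_comp, <- Hg, !fmap_comp.
    rewrite <- !comp_assoc. apply comp_proper; [reflexivity|]. apply (iso_mono (Hc y)).
    rewrite !comp_assoc, inv_of_r, comp_id_l, Ns, Nc.
    now rewrite <- (comp_assoc _ (c (r x))), inv_of_r, comp_id_r.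
  - intros x. apply (iso_epi (HK x)).
    rewrite <- comp_assoc, T, !comp_assoc, Nc, Ns.
    now rewrite <- (comp_assoc _ (c (r x))), inv_of_r, comp_id_r.
  - intros t' H' x. apply (iso_epi (HK x)).
    rewrite T, (naturality t' (fmap Γ (e x))).
    apply comp_proper; [reflexivity|].
    apply (iso_mono (Hc x)). rewrite comp_assoc, inv_of_r, comp_id_l. apply H'.
Qed.

Lemma right_deformation (c : forall x, hom (F x) (L (Γ x)))
    (s : forall x, hom (F x) (K (Γ x))) (r : C -> C) (e : forall x, hom x (r x)) :
  (forall x y (f : hom x y), c y ∘ fmap F f ≈ fmap L (fmap Γ f) ∘ c x) ->
  (forall x y (f : hom x y), s y ∘ fmap F f ≈ fmap K (fmap Γ f) ∘ s x) ->
  (forall x y (f : hom x y), exists g, g ∘ e x ≈ e y ∘ f) ->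
  (forall x, is_iso (fmap Γ (e x))) ->
  (forall x, is_iso (c (r x))) ->
  exists t : forall x, hom (L (Γ x)) (K (Γ x)),
    (forall x y (f : hom x y),
        t y ∘ fmap L (fmap Γ f) ≈ fmap K (fmap Γ f) ∘ t x) /\
    (forall x, t x ∘ c x ≈ s x) /\
    (forall t' : NatTrans L K, (forall x, t' (Γ x) ∘ c x ≈ s x) ->
       forall x, t' (Γ x) ≈ t x).
Proof.
  intros Nc Ns He HΓ Hc.
  assert (HK : forall x, is_iso (fmap K (fmap Γ (e x)))) by (intros x; now apply fmap_iso).
  set (t := fun x => inv_of (HK x) ∘ s (r x) ∘ inv_of (Hc x) ∘ fmap L (fmap Γ (e x))).
  assert (T : forall x, fmap K (fmap Γ (e x)) ∘ t x
                        ≈ s (r x) ∘ inv_of (Hc x) ∘ fmap L (fmap Γ (e x))).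
  { intros x. unfold t. rewrite !comp_assoc, inv_of_r. now rewrite comp_id_l. }
  exists t. split; [|split].
  - intros x y f. destruct (He x y f) as (g & Hg).
    apply (iso_mono (HK y)).
    rewrite !comp_assoc, T, <- !fmap_comp, <- Hg, !fmap_comp, <- (comp_assoc (fmap K _)), T.
    rewrite <- (comp_assoc _ (fmap L (fmap Γ (e y)))), <- !fmap_comp, <- Hg, !fmap_comp.
    rewrite !comp_assoc. apply comp_proper; [|reflexivity]. apply (iso_epi (Hc x)).
    rewrite <- !comp_assoc, inv_of_l, comp_id_r, <- Ns, <- Nc.
    now rewrite (comp_assoc (inv_of _)), inv_of_l, comp_id_l.
  - intros x. apply (iso_mono (HK x)).
    rewrite comp_assoc, T, <- !comp_assoc, <- Nc, <- Ns.
    now rewrite (comp_assoc (inv_of _)), inv_of_l, comp_id_l.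
  - intros t' H' x. apply (iso_mono (HK x)).
    rewrite T, <- (naturality t' (fmap Γ (e x))).
    apply comp_proper; [|reflexivity].
    apply (iso_epi (Hc x)). rewrite <- comp_assoc, inv_of_l, comp_id_r. apply H'.
Qed.
End Deformation.

Section Derived.
Context (C D : Cat) (W : forall x y : C, hom x y -> Prop).
Local Notation Γ := (loc_functor W).
Context (F : Functor C D) (L : Functor (localization W) D).

Lemma right_kan_of_deformation (c : NatTrans (L ⊚ Γ) F)
    (r : C -> C) (e : forall x, hom (r x) x) :
  (forall x y (f : hom x y), exists g, e y ∘ g ≈ f ∘ e x) ->
  (forall x, is_iso (fmap Γ (e x))) ->
  (forall x, is_iso (c (r x))) ->
  is_right_kan c.
Proof.
  intros He HΓ Hc K s.
  destruct (left_deformation (K := K) (naturality c) (naturality s) He HΓ Hc)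
    as (t & N & T & U).
  exists {| component := t : forall x : localization W, hom (K x) (L x);
            naturality := loc_natural N |}.
  split; assumption.
Qed.

Lemma left_kan_of_deformation (c : NatTrans F (L ⊚ Γ))
    (r : C -> C) (e : forall x, hom x (r x)) :
  (forall x y (f : hom x y), exists g, g ∘ e x ≈ e y ∘ f) ->
  (forall x, is_iso (fmap Γ (e x))) ->
  (forall x, is_iso (c (r x))) ->
  is_left_kan c.
Proof.
  intros He HΓ Hc K s.
  destruct (right_deformation (K := K) (naturality c) (naturality s) He HΓ Hc)
    as (t & N & T & U).
  exists {| component := t : forall x : localization W, hom (L x) (K x);
            naturality := loc_natural N |}.
  split; assumption.
Qed.
End Derived.

(** * Exact categories *)

(** ** Duality *)

Definition op_cat (C : Cat) : Cat.
Proof.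
  refine {| ob := ob C; hom := fun x y => @hom C y x;
            heq := fun x y f g => @heq C y x f g;
            idm := fun x => @idm C x;
            comp := fun x y z g f => @comp C z y x f g |}.
  - intros x y z g g' Hg f f' Hf. now rewrite Hg, Hf.
  - intros x y f. apply comp_id_r.
  - intros x y f. apply comp_id_l.
  - intros x y z t h g f. symmetry. apply comp_assoc.
Defined.

Definition op_pre (C : Cat) (P : Preadditive C) : Preadditive (op_cat C).
Proof.
  refine {| hzero := fun x y : op_cat C => @hzero C P y x : @hom (op_cat C) x y;
            hadd := fun x y : op_cat C => @hadd C P y x;
            hopp := fun x y : op_cat C => @hopp C P y x |}; simpl; intros.
  - exact (@hadd_proper C P y x).
  - exact (@hopp_proper C P y x).
  - apply hadd_assoc.
  - apply hadd_comm.
  - apply hadd_zero.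
  - apply hadd_opp.
  - apply comp_add_r.
  - apply comp_add_l.
Defined.

Lemma op_biproduct (C : Cat) (P : Preadditive C) (x y s : C)
    (i : hom x s) (j : hom y s) (p : hom s x) (q : hom s y) :
  is_biproduct P i j p q -> @is_biproduct (op_cat C) (op_pre P) x y s p q i j.
Proof. intros (E1 & E2 & E3 & E4 & E5). now repeat split. Qed.

(** The opposite of an exact category is exact, so each statement on
    conflations below also yields its dual. *)
Definition op_exact (A : ExactCat) : ExactCat.
Proof.
  refine {| ecat := op_cat A; epre := op_pre (epre A);
            conf := fun x y z (i : @hom (op_cat A) x y) p => @conf A z y x p i |}.
  - destruct (eadditive A) as [(z & Z1 & Z2) B]. split.
    + exists z. now split.
    + intros x y. destruct (B x y) as (s & i & j & p & q & H).
      exists s, p, q, i, j. now apply op_biproduct.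
  - intros x y z i p H. exact (conf_cokernel H).
  - intros x y z i p H. exact (conf_kernel H).
  - intros x y z x' y' z' i p i' p' a b c Ha Hb Hc E1 E2 H.
    destruct Ha as (a' & A1 & A2), Hb as (b' & B1 & B2), Hc as (c' & C1 & C2).
    simpl in *.
    refine (conf_iso (a := c') (b := b') (c := a') _ _ _ _ _ H).
    + now exists c.
    + now exists b.
    + now exists a.
    + rewrite <- (comp_id_r (b' ∘ p)), <- C1, !comp_assoc, <- (comp_assoc b'), E2.
      now rewrite comp_assoc, B2, comp_id_l.
    + rewrite <- (comp_id_r (a' ∘ i)), <- B1, !comp_assoc, <- (comp_assoc a'), E1.
      now rewrite comp_assoc, A2, comp_id_l.
  - exact (@id_epi A).
  - exact (@id_mono A).
  - intros x y z i j Hi Hj. exact (epi_comp Hj Hi).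
  - intros x y z i j Hi Hj. exact (mono_comp Hj Hi).
  - intros a b a' f k Hf. destruct (epi_pullback (f := f : @hom A b a) k Hf)
      as (b' & k' & f' & H & H').
    exists b', f', k'. exact (conj H H').
  - intros a b a' f k Hf. destruct (mono_pushout (f := f : @hom A b a) k Hf)
      as (b' & k' & f' & H & H').
    exists b', f', k'. exact (conj H H').
Defined.

Section ExactBasics.
Context (A : ExactCat).
Local Notation P := (epre A).
Local Notation "0" := (hzero P _ _).
Local Infix "+" := (hadd P).
Local Notation "- f" := (hopp P f).

Lemma sub_zero (x y : A) (f g : hom x y) : f + - g ≈ 0 <-> f ≈ g.
Proof.
  split; [|intros ->; apply hadd_opp].
  intros H. apply (hadd_cancel (P := P) (h := - g)). now rewrite H, hadd_opp.
Qed.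

Lemma conf_zero (x y z : A) (i : hom x y) (p : hom y z) : conf i p -> p ∘ i ≈ 0.
Proof. intros H. apply (conf_kernel H). Qed.

Lemma conf_monic (x y z t : A) (i : hom x y) (p : hom y z) (f g : hom t x) :
  conf i p -> i ∘ f ≈ i ∘ g -> f ≈ g.
Proof.
  intros H E. destruct (conf_kernel H) as [_ U].
  destruct (U t (i ∘ g)) as (u & _ & Hu).
  { rewrite comp_assoc, (conf_zero H). apply comp_zero_l. }
  now rewrite (Hu f E), (Hu g).
Qed.

Lemma conf_epic (x y z t : A) (i : hom x y) (p : hom y z) (f g : hom z t) :
  conf i p -> f ∘ p ≈ g ∘ p -> f ≈ g.
Proof.
  intros H E. destruct (conf_cokernel H) as [_ U].
  destruct (U t (g ∘ p)) as (u & _ & Hu).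
  { rewrite <- comp_assoc, (conf_zero H). apply comp_zero_r. }
  now rewrite (Hu f E), (Hu g).
Qed.

Lemma conf_ker (x y z t : A) (i : hom x y) (p : hom y z) (f : hom t y) :
  conf i p -> p ∘ f ≈ 0 -> exists u, i ∘ u ≈ f.
Proof.
  intros H E. destruct (conf_kernel H) as [_ U].
  destruct (U t f E) as (u & Hu & _). now exists u.
Qed.

Lemma conf_coker (x y z t : A) (i : hom x y) (p : hom y z) (f : hom y t) :
  conf i p -> f ∘ i ≈ 0 -> exists u, u ∘ p ≈ f.
Proof.
  intros H E. destruct (conf_cokernel H) as [_ U].
  destruct (U t f E) as (u & Hu & _). now exists u.
Qed.

Lemma conf_of_cokernel (x y z z' : A) (i : hom x y) (p : hom y z) (p' : hom y z') :
  conf i p -> is_cokernel P i p' -> conf i p'.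
Proof.
  intros H [E U].
  destruct (conf_coker H E) as (a & Ha).
  destruct (U z p (conf_zero H)) as (b & Hb & _).
  refine (conf_iso (a := idm x) (b := idm y) (c := a) _ _ _ _ _ H).
  - apply iso_id.
  - apply iso_id.
  - exists b. split.
    + apply (conf_epic H). now rewrite <- comp_assoc, Ha, Hb, comp_id_l.
    + destruct (U z' p' E) as (u & _ & Hu).
      rewrite (Hu (a ∘ b)), (Hu (idm z')); [reflexivity| |].
      * apply comp_id_l.
      * now rewrite <- comp_assoc, Hb.
  - now rewrite comp_id_l, comp_id_r.
  - now rewrite comp_id_r.
Qed.

Lemma zero_ob : exists z : A, is_zero_object z.
Proof. exact (proj1 (eadditive A)). Qed.

Lemma biproduct_exists (x y : A) :
  exists s (i : hom x s) (j : hom y s) p q, is_biproduct P i j p q.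
Proof. exact (proj2 (eadditive A) x y). Qed.

Lemma biproduct_swap (x y s : A) (i : hom x s) (j : hom y s) p q :
  is_biproduct P i j p q -> is_biproduct P j i q p.
Proof.
  intros (E1 & E2 & E3 & E4 & E5). repeat split; trivial. now rewrite hadd_comm.
Qed.

Lemma conf_iso_zero (x y z : A) (f : hom x y) :
  is_iso f -> is_zero_object z -> conf f (hzero P y z).
Proof.
  intros Hf Hz. destruct (id_mono x) as (c & p & H).
  assert (K : conf (idm x) (hzero P x z)).
  { apply (conf_of_cokernel H). split; [now rewrite comp_zero_l|].
    intros t g Hg. exists 0. split.
    - now rewrite comp_zero_l, <- Hg, comp_id_r.
    - intros v _. now apply zero_object_maps. }
  refine (conf_iso (a := idm x) (b := f) (c := idm z) _ Hf _ _ _ K).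
  - apply iso_id.
  - apply iso_id.
  - reflexivity.
  - now rewrite comp_zero_l, comp_zero_r.
Qed.

Lemma zero_conf_iso (x y z : A) (f : hom x y) :
  is_iso f -> is_zero_object z -> conf (hzero P z x) f.
Proof.
  intros Hf Hz.
  assert (K : conf (hzero P z x) (idm x)).
  { apply (biproduct_conf (i := hzero P z x) (j := idm x)
             (p := hzero P x z) (q := idm x)).
    repeat split; rewrite ?comp_id_l, ?comp_id_r, ?comp_zero_l; try reflexivity.
    - now apply zero_object_maps.
    - apply hadd_zero_l. }
  refine (conf_iso (a := idm z) (b := idm x) (c := f) _ _ Hf _ _ K).
  - apply iso_id.
  - apply iso_id.
  - now rewrite comp_zero_r, comp_zero_l.
  - reflexivity.
Qed.

(** Pushouts preserve cokernels, so the cokernel of the admissible monomorphism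
    [i'] is that of [i]. *)
Lemma pushout_conf (x y z x' : A) (i : hom x y) (p : hom y z) (k : hom x x') :
  conf i p -> exists y' (i' : hom x' y') (k' : hom y y') (p' : hom y' z),
    is_pushout i k i' k' /\ conf i' p' /\ p' ∘ k' ≈ p.
Proof.
  intros H. destruct (mono_pushout (f := i) k) as (y' & i' & k' & PO & c & r & Hr).
  { now exists z, p. }
  exists y', i', k'. pose proof PO as [E U].
  destruct (U z p (hzero P x' z)) as (p' & (H1 & H2) & _).
  { rewrite (conf_zero H). now rewrite comp_zero_l. }
  exists p'. split; [exact PO|]. split; [|exact H1].
  apply (conf_of_cokernel Hr). split; [exact H2|].
  intros t f Hf. destruct (conf_coker (f := f ∘ k') H) as (u & Hu).
  { rewrite <- comp_assoc, E, comp_assoc, Hf. apply comp_zero_l. }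
  exists u. split.
  - destruct (U t (f ∘ k') 0) as (w & _ & Hw).
    { rewrite <- comp_assoc, E, comp_assoc, Hf. now rewrite !comp_zero_l. }
    rewrite (Hw f), (Hw (u ∘ p')); [reflexivity| |].
    + rewrite <- !comp_assoc, H1, H2. split; [exact Hu|apply comp_zero_r].
    + split; [reflexivity|exact Hf].
  - intros v Hv. apply (conf_epic H). now rewrite Hu, <- Hv, <- comp_assoc, H1.
Qed.

End ExactBasics.

Lemma pullback_conf (A : ExactCat) (x y z z' : A) (i : hom x y) (p : hom y z)
  (c : hom z' z) :
  conf i p -> exists y' (p' : hom y' z') (c' : hom y' y) (i' : hom x y'),
    is_pullback p c' p' c /\ conf i' p' /\ c' ∘ i' ≈ i.
Proof. exact (@pushout_conf (op_exact A) z y x z' p i c). Qed.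

Lemma conf_of_kernel (A : ExactCat) (x x' y z : A) (i : hom x y) (p : hom y z)
  (i' : hom x' y) : conf i p -> is_kernel (epre A) i' p -> conf i' p.
Proof. exact (@conf_of_cokernel (op_exact A) z y x x' p i i'). Qed.

Section ExactLemmas.
Context (A : ExactCat).
Local Notation P := (epre A).
Local Notation "0" := (hzero P _ _).
Local Infix "+" := (hadd P).
Local Notation "- f" := (hopp P f).

(** On the pullback of [p] and [p'], the difference between the two maps to
    [y'] comes from [x]. Correcting the projection to [y] by it gives a map
    that descends to the inverse of [m]. *)
Lemma short_five (x y y' z : A) (i : hom x y) (p : hom y z)
    (i' : hom x y') (p' : hom y' z) (m : hom y y') :
  conf i p -> conf i' p' -> m ∘ i ≈ i' -> p' ∘ m ≈ p -> is_iso m.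
Proof.
  intros H H' E1 E2.
  destruct (pullback_conf p' H) as (e & b & a & e1 & [PE U] & K & K1).
  destruct (U y (idm y) m) as (s & (S1 & S2) & _); [now rewrite comp_id_r|].
  destruct (conf_ker (f := b + - (m ∘ a)) H') as (d & Hd).
  { expand. crw E2. rewrite PE. apply hadd_opp. }
  assert (D1 : d ∘ e1 ≈ - idm x).
  { apply (conf_monic H'). rewrite comp_assoc, Hd. expand.
    rewrite (conf_zero K), K1, E1. abel. }
  destruct (conf_coker (f := a + i ∘ d) K) as (n & Hn).
  { expand. rewrite K1, D1. expand. apply hadd_opp. }
  exists n. split.
  - rewrite <- S2, comp_assoc, Hn. expand. rewrite S1.
    assert (D2 : d ∘ s ≈ 0).
    { apply (conf_monic H'). rewrite comp_assoc, Hd. expand.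
      rewrite S1, S2. expand. apply hadd_opp. }
    rewrite D2. expand. apply hadd_zero.
  - apply (conf_epic K). rewrite <- comp_assoc, Hn. expand.
    crw E1. rewrite Hd. expand. abel.
Qed.

(** A map of conflations that is the identity on the kernels is a bicartesian
    square, and such a square is itself a conflation. *)
Lemma bicartesian_conf (x b s b' s' t : A) (i : hom x b) (p : hom b s)
    (i' : hom x b') (p' : hom b' s') (φ : hom b b') (g : hom s s')
    (j1 : hom s t) (j2 : hom b' t) (q1 : hom t s) (q2 : hom t b') :
  conf i p -> conf i' p' -> φ ∘ i ≈ i' -> g ∘ p ≈ p' ∘ φ ->
  is_biproduct P j1 j2 q1 q2 ->
  conf (j1 ∘ p + j2 ∘ φ) (g ∘ q1 + - (p' ∘ q2)).
Proof.
  intros H H' E1 E2 B. pose proof B as (B1 & B2 & B3 & B4 & B5).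
  (* by [short_five], [b] is the pullback of [p'] along [g] *)
  assert (PB : forall r (u : hom r b') (v : hom r s), p' ∘ u ≈ g ∘ v ->
             exists w, φ ∘ w ≈ u /\ p ∘ w ≈ v).
  { destruct (pullback_conf g H') as (e & p1 & c & i1 & [PE U] & K & K1).
    destruct (U b φ p) as (m & (M1 & M2) & _); [now symmetry|].
    destruct (short_five (m := m) H K) as (n & N1 & N2).
    - destruct (U x i' 0) as (w & _ & Hw).
      { rewrite (conf_zero H'). now rewrite comp_zero_r. }
      rewrite (Hw (m ∘ i)), (Hw i1); [reflexivity| |].
      + split; [exact K1|exact (conf_zero K)].
      + rewrite !comp_assoc, M1, M2. split; [exact E1|exact (conf_zero H)].
    - exact M2.
    - intros r u v E. destruct (U r u v E) as (w & (W1 & W2) & _).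
      exists (n ∘ w). rewrite <- M1, <- M2, <- !comp_assoc.
      rewrite (comp_assoc m n w), N2, comp_id_l. now split. }
  destruct (biproduct_exists s s') as (u & k1 & k2 & r1 & r2 & D).
  pose proof D as (D1 & D2 & D3 & D4 & D5).
  (* the map [s + b' -> s'] is the epimorphism [f : s + b' ->> s + s'], the sum of
     an identity and [p'], followed by a split epimorphism, hence admissible *)
  set (f := k1 ∘ q1 + k2 ∘ p' ∘ q2).
  assert (R1 : r1 ∘ f ≈ q1).
  { unfold f. expand. crw D1. crw D3. expand. apply hadd_zero. }
  assert (R2 : r2 ∘ f ≈ p' ∘ q2).
  { unfold f. expand. crw D2. crw D4. expand. apply hadd_zero_l. }
  assert (Hf : exists c (l : hom c t), conf l f).
  { destruct (pullback_conf r2 H') as (e & p1 & c & i1 & [PE U] & K & K1).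
    exists x, (j2 ∘ i').
    destruct (U t q2 f) as (m & (M1 & M2) & _); [now symmetry|].
    set (n := j1 ∘ r1 ∘ p1 + j2 ∘ c).
    assert (NM : n ∘ m ≈ idm t).
    { unfold n. expand. rewrite M1, M2, R1. exact B5. }
    assert (MN : m ∘ n ≈ idm e).
    { destruct (U e c p1 PE) as (w & _ & Hw).
      rewrite (Hw (m ∘ n)), (Hw (idm e)); [reflexivity| |].
      - rewrite !comp_id_r. now split.
      - rewrite !comp_assoc, M1, M2. split.
        + unfold n. expand. crw B4. crw B2. expand. apply hadd_zero_l.
        + unfold n, f. expand. crw B1. crw B2. crw B3. crw B4. expand.
          rewrite PE, hadd_zero, hadd_zero_l.
          rewrite <- (comp_id_l p1) at 3. rewrite <- D5. now expand. }
    refine (conf_iso (a := idm x) (b := n) (c := idm u) _ _ _ _ _ K).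
    - apply iso_id.
    - now exists m.
    - apply iso_id.
    - unfold n. expand. rewrite (conf_zero K), K1. expand. apply hadd_zero_l.
    - rewrite <- M2. expand. rewrite MN. now expand. }
  assert (Hg : conf (k1 + k2 ∘ g) (g ∘ r1 + - r2)).
  { apply (biproduct_conf (j := - k2) (p := r1)).
    repeat split; expand.
    - crw D1. crw D3. expand. apply hadd_zero.
    - rewrite D2, D3. expand. abel.
    - rewrite D3. abel.
    - crw D1. crw D3. crw D4. crw D2. expand. abel.
    - rewrite <- D5. expand. abel. }
  destruct (epi_comp (p := f) (q := g ∘ r1 + - r2) Hf) as (c & l & Hl).
  { now exists s, (k1 + k2 ∘ g). }
  assert (Eq : (g ∘ r1 + - r2) ∘ f ≈ g ∘ q1 + - (p' ∘ q2)).
  { expand. now rewrite R1, R2. }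
  assert (Hl' : conf l (g ∘ q1 + - (p' ∘ q2))).
  { refine (conf_iso (a := idm c) (b := idm t) (c := idm s') _ _ _ _ _ Hl);
      try apply iso_id; rewrite ?comp_id_l, ?comp_id_r; [reflexivity|exact Eq]. }
  apply (conf_of_kernel Hl'). split.
  - expand. crw B1. crw B2. crw B3. crw B4. expand. rewrite E2. abel.
  - intros r h Hh.
    destruct (PB r (q2 ∘ h) (q1 ∘ h)) as (w & W1 & W2).
    { symmetry. apply sub_zero. rewrite <- Hh. now expand. }
    exists w. split.
    + expand. rewrite W1, W2, !comp_assoc, <- comp_add_l, B5. apply comp_id_l.
    + intros v Hv.
      assert (V1 : p ∘ v ≈ p ∘ w).
      { rewrite W2, <- Hv. expand. crw B1. crw B3. expand. symmetry. apply hadd_zero. }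
      assert (V2 : φ ∘ v ≈ φ ∘ w).
      { rewrite W1, <- Hv. expand. crw B2. crw B4. expand. symmetry. apply hadd_zero_l. }
      destruct (conf_ker (f := v + - w) H) as (d & Hd).
      { expand. rewrite V1. apply hadd_opp. }
      assert (d ≈ 0).
      { apply (conf_monic H'). rewrite <- E1, <- comp_assoc, Hd. expand.
        rewrite V2. abel. }
      apply sub_zero. rewrite <- Hd, H0. apply comp_zero_r.
Qed.

(** Noether's isomorphism [(z/x)/(y/x) = z/y]: the pushout of [j] along [p] is
    a cokernel of [j ∘ i]. *)
Lemma noether (x y z c d : A) (i : hom x y) (p : hom y c) (j : hom y z) (q : hom z d) :
  conf i p -> conf j q ->
  exists e (r : hom z e) (a : hom c e) (b : hom e d),
    conf (j ∘ i) r /\ conf a b /\ a ∘ p ≈ r ∘ j /\ b ∘ r ≈ q.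
Proof.
  intros H K.
  destruct (pushout_conf p K) as (e & a & r & b & [E U] & L & L1).
  exists e, r, a, b. split; [|split; [exact L|split; [now symmetry|exact L1]]].
  destruct (mono_comp (i := i) (j := j)) as (e' & r' & Hr').
  { now exists c, p. }
  { now exists d, q. }
  apply (conf_of_cokernel Hr'). split.
  - rewrite comp_assoc, E, <- comp_assoc, (conf_zero H). apply comp_zero_r.
  - intros t f Hf.
    destruct (conf_coker (f := f ∘ j) H) as (u & Hu).
    { now rewrite <- comp_assoc. }
    destruct (U t f u) as (w & (W1 & W2) & Hw); [now symmetry|].
    exists w. split; [exact W1|]. intros v Hv. apply Hw. split; [exact Hv|].
    apply (conf_epic H). now rewrite Hu, <- comp_assoc, <- E, comp_assoc, Hv.
Qed.

Lemma conf_split (x y z : A) (i : hom x y) (p : hom y z) (r : hom y x) :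
  conf i p -> r ∘ i ≈ idm x -> exists s, is_biproduct P i s r p.
Proof.
  intros H R. destruct (conf_coker (f := idm y + - (i ∘ r)) H) as (s & Hs).
  { expand. rewrite R. expand. apply hadd_opp. }
  exists s. split; [exact R|]. split; [|split; [|split]].
  - apply (conf_epic H). rewrite <- comp_assoc, Hs. expand.
    crw (conf_zero H). expand. abel.
  - apply (conf_epic H). rewrite <- comp_assoc, Hs. expand. crw R. expand. abel.
  - exact (conf_zero H).
  - rewrite Hs. abel.
Qed.

End ExactLemmas.

Lemma noether_kernels (A : ExactCat) (x y z c d : A) (i : hom x y) (p : hom y z)
    (j : hom c z) (q : hom z d) :
  conf i p -> conf j q ->
  exists e (r : hom e y) (a : hom x e) (b : hom e c),
    conf r (q ∘ p) /\ conf a b /\ r ∘ a ≈ i /\ p ∘ r ≈ j ∘ b.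
Proof.
  intros H K.
  destruct (@noether (op_exact A) d z y c x q j p i K H)
    as (e & r & b & a & H1 & H2 & H3 & H4).
  exists e, r, a, b. repeat split; trivial. simpl in H3. now symmetry.
Qed.

(** The pullback can be formed from either side, and the two results are
    isomorphic; each side shows that one of the projections is admissible. *)
Lemma pullback_epis (A : ExactCat) (x y z k z' : A) (i : hom x y) (p : hom y z)
    (l : hom k z') (c : hom z' z) :
  conf i p -> conf l c ->
  exists y' (p' : hom y' z') (c' : hom y' y) (i' : hom x y') (l' : hom k y'),
    conf i' p' /\ conf l' c' /\ c' ∘ i' ≈ i /\ p ∘ c' ≈ c ∘ p'.
Proof.
  intros H K.
  destruct (pullback_conf c H) as (y1 & p1 & c1 & i1 & [E1 U1] & H1 & I1).
  destruct (pullback_conf p K) as (y2 & c2 & p2 & l2 & [E2 U2] & K2 & L2).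
  destruct (U1 y2 c2 p2 (symmetry E2)) as (m & (M1 & M2) & _).
  destruct (U2 y1 p1 c1 (symmetry E1)) as (n & (N1 & N2) & _).
  exists y1, p1, c1, i1, (m ∘ l2). split; [exact H1|]. split; [|now split].
  refine (conf_iso (a := idm k) (b := m) (c := idm y) (iso_id _) _ (iso_id _) _ _ K2).
  - exists n. split.
    + destruct (U2 y2 p2 c2 E2) as (w & _ & Hw).
      rewrite (Hw (n ∘ m)), (Hw (idm y2)); [reflexivity| |].
      * rewrite !comp_id_r. now split.
      * now rewrite !comp_assoc, N1, N2.
    + destruct (U1 y1 c1 p1 E1) as (w & _ & Hw).
      rewrite (Hw (m ∘ n)), (Hw (idm y1)); [reflexivity| |].
      * rewrite !comp_id_r. now split.
      * now rewrite !comp_assoc, M1, M2.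
  - now rewrite comp_id_r.
  - now rewrite comp_id_l.
Qed.

Lemma pushout_monos (A : ExactCat) (x y z r q : A) (i : hom x y) (p : hom y z)
    (l : hom x r) (c : hom r q) :
  conf i p -> conf l c ->
  exists y' (i' : hom r y') (p' : hom y' z) (l' : hom y y') (c' : hom y' q),
    conf i' p' /\ conf l' c' /\ p' ∘ l' ≈ p.
Proof.
  intros H K.
  destruct (@pullback_epis (op_exact A) z y x q r p i c l H K)
    as (y' & i' & l' & p' & c' & H1 & H2 & H3 & _).
  exists y', i', p', l', c'. now repeat split.
Qed.

Lemma conf_split_epi (A : ExactCat) (x y z : A) (i : hom x y) (p : hom y z)
  (s : hom z y) :
  conf i p -> p ∘ s ≈ idm z -> exists r, is_biproduct (epre A) i s r p.
Proof.
  intros H S. destruct (@conf_split (op_exact A) z y x p i s H S) as (r & Hr).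
  exists r. destruct Hr as (E1 & E2 & E3 & E4 & E5). simpl in *.
  repeat split; trivial. now rewrite hadd_comm.
Qed.

(** Dual to [bicartesian_conf]. *)
Lemma cobicartesian_conf (A : ExactCat) (x b s x' b' t : A)
    (i : hom x b) (p : hom b s) (i' : hom x' b') (p' : hom b' s)
    (φ : hom b b') (g : hom x x')
    (j1 : hom x' t) (j2 : hom b t) (q1 : hom t x') (q2 : hom t b) :
  conf i p -> conf i' p' -> p' ∘ φ ≈ p -> i' ∘ g ≈ φ ∘ i ->
  is_biproduct (epre A) j1 j2 q1 q2 ->
  conf (hadd (epre A) (j1 ∘ g) (hopp (epre A) (j2 ∘ i)))
       (hadd (epre A) (i' ∘ q1) (φ ∘ q2)).
Proof.
  intros H H' E1 E2 B.
  exact (@bicartesian_conf (op_exact A) s b' x' b x t p' i' p i φ g q1 q2 j1 j2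
           H' H E1 E2 (op_biproduct B)).
Qed.

(** * Stable equality *)

Notation "f ~ g" := (stable_eq f g) (at level 70, no associativity) : cat_scope.
#[export] Existing Instance stable_eq_equiv.

#[export] Instance stable_subrel (A : ExactCat) (x y : A) :
  subrelation (@heq A x y) (@stable_eq A x y).
Proof. intros f g H. now apply stable_eq_of_heq. Qed.

#[export] Instance stable_comp_proper (A : ExactCat) (x y z : A) :
  Proper (@stable_eq A y z ==> @stable_eq A x y ==> @stable_eq A x z) (@comp A x y z).
Proof. intros g g' Hg f f' Hf. now apply stable_eq_comp. Qed.

Section Stable.
Context (A : ExactCat).
Local Notation P := (epre A).
Local Notation "0" := (hzero P _ _).
Local Infix "+" := (hadd P).
Local Notation "- f" := (hopp P f).

Lemma stable_sub (x y : A) (f g : hom x y) : f ~ g <-> f + - g ~ 0.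
Proof.
  split; intros (Q & a & b & HQ & E).
  - exists Q, a, b. split; [exact HQ|]. rewrite <- E. abel.
  - exists Q, a, b. split; [exact HQ|]. rewrite <- E. abel.
Qed.

Lemma stable_zero (x y : A) (f : hom x y) :
  f ~ 0 <-> exists Q (a : hom x Q) (b : hom Q y), is_projective Q /\ f ≈ b ∘ a.
Proof.
  split.
  - intros H. symmetry in H. destruct H as (Q & a & b & HQ & E).
    exists Q, a, b. split; [exact HQ|]. rewrite <- E. abel.
  - intros (Q & a & b & HQ & E). symmetry.
    exists Q, a, b. split; [exact HQ|]. rewrite <- E. abel.
Qed.

Lemma stable_through (x y q : A) (a : hom x q) (b : hom q y) :
  is_projective q -> b ∘ a ~ 0.
Proof. intros H. apply (proj2 (stable_zero _)). now exists q, a, b. Qed.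

#[export] Instance stable_add_proper (x y : A) :
  Proper (@stable_eq A x y ==> @stable_eq A x y ==> @stable_eq A x y) (@hadd A P x y).
Proof.
  assert (K : forall f f' g : hom x y, f ~ f' -> f + g ~ f' + g).
  { intros f f' g (Q & a & b & HQ & E). exists Q, a, b. split; [exact HQ|].
    rewrite <- E. abel. }
  intros f f' Hf g g' Hg. rewrite (K f f' g Hf).
  rewrite (hadd_comm P f' g), (hadd_comm P f' g'). now apply K.
Qed.

#[export] Instance stable_opp_proper (x y : A) :
  Proper (@stable_eq A x y ==> @stable_eq A x y) (@hopp A P x y).
Proof.
  intros f f' (Q & a & b & HQ & E). exists Q, a, (- b). split; [exact HQ|].
  rewrite comp_opp_l, <- E. abel.
Qed.

Lemma stable_id_projective (x : A) : idm x ~ 0 -> is_projective x.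
Proof.
  intros H. apply (proj1 (stable_zero _)) in H. destruct H as (Q & a & b & HQ & E).
  intros u v w i p K f. destruct (HQ _ _ _ _ _ K (f ∘ b)) as (g & Hg).
  exists (g ∘ a). rewrite comp_assoc, Hg, <- comp_assoc. rewrite <- E. apply comp_id_r.
Qed.

Lemma biproduct_retract (x y s : A) (i : hom x s) (j : hom y s) p q :
  is_biproduct P i j p q -> is_retract x s /\ is_retract y s.
Proof. intros (E1 & E2 & _). split; [now exists i, p|now exists j, q]. Qed.

(** The difference of [g ∘ f] and the identity factors through a projective
    [Q]; adding [Q] to [c] makes room for a strict retraction. *)
Lemma stable_retract (x c : A) (f : hom x c) (g : hom c x) :
  g ∘ f ~ idm x -> exists Q s (i : hom c s) (j : hom Q s) p q,
    is_projective Q /\ is_biproduct P i j p q /\ is_retract x s.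
Proof.
  intros (Q & a & b & HQ & E).
  destruct (biproduct_exists c Q) as (s & i & j & p & q & B).
  exists Q, s, i, j, p, q. split; [exact HQ|]. split; [exact B|].
  exists (i ∘ f + j ∘ a), (g ∘ p + b ∘ q).
  destruct B as (B1 & B2 & B3 & B4 & _). expand.
  crw B1. crw B2. crw B3. crw B4. expand. rewrite <- E. abel.
Qed.

(** * Cotorsion pairs *)

Lemma ext_retraction (a b e : A) (i : hom b e) (p : hom e a) :
  ext1_zero a b -> conf i p -> exists r, r ∘ i ≈ idm b.
Proof.
  intros H K. destruct (H e i p K) as (s & i1 & i2 & p1 & p2 & B & f & F1 & F2).
  exists (p1 ∘ f). rewrite <- comp_assoc, F1. apply B.
Qed.

Lemma ext_of_retractions (a b : A) :
  (forall e (i : hom b e) (p : hom e a), conf i p -> exists r, r ∘ i ≈ idm b) ->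
  ext1_zero a b.
Proof.
  intros H e i p K. destruct (H e i p K) as (r & R).
  destruct (conf_split K R) as (s & B).
  exists e, i, s, r, p. split; [exact B|]. exists (idm e).
  rewrite comp_id_l, comp_id_r. split; reflexivity.
Qed.

Lemma ext_section (a b e : A) (i : hom b e) (p : hom e a) :
  ext1_zero a b -> conf i p -> exists s, p ∘ s ≈ idm a.
Proof.
  intros H K. destruct (ext_retraction H K) as (r & R).
  destruct (conf_split K R) as (s & B). exists s. apply B.
Qed.

(** The pushout of the conflation along [f] splits. *)
Lemma ext_extend (x y z d : A) (i : hom x y) (p : hom y z) (f : hom x d) :
  ext1_zero z d -> conf i p -> exists g, g ∘ i ≈ f.
Proof.
  intros H K. destruct (pushout_conf f K) as (y' & i' & k' & p' & [E _] & K' & _).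
  destruct (ext_retraction H K') as (r & R).
  exists (r ∘ k'). now rewrite <- comp_assoc, E, comp_assoc, R, comp_id_l.
Qed.

Lemma ext_lift (x y z c : A) (i : hom x y) (p : hom y z) (f : hom c z) :
  ext1_zero c x -> conf i p -> exists g, p ∘ g ≈ f.
Proof.
  intros H K. destruct (pullback_conf f K) as (y' & p' & c' & i' & [E _] & K' & _).
  destruct (ext_section H K') as (s & S).
  exists (c' ∘ s). now rewrite comp_assoc, E, <- comp_assoc, S, comp_id_r.
Qed.

(** An approximation comes with its conflation, so that a single choice
    provides both. *)
Record Cover (X Y : A -> Prop) (a : A) : Type := {
  cov : A; cov_ker : A; cov_i : hom cov_ker cov; cov_p : hom cov a;
  cov_conf : conf cov_i cov_p; cov_in : X cov; cov_ker_in : Y cov_ker }.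

Record Hull (X Y : A -> Prop) (a : A) : Type := {
  hull : A; hull_cok : A; hull_i : hom a hull; hull_p : hom hull hull_cok;
  hull_conf : conf hull_i hull_p; hull_in : Y hull; hull_cok_in : X hull_cok }.

Definition cover (X Y : A -> Prop) (h : complete_cotorsion_pair X Y) (a : A) :
  Cover X Y a.
Proof.
  apply (fun H : exists _ : Cover X Y a, True => proj1_sig (chosen H)).
  destruct h as (_ & H & _). destruct (H a) as (y & x & i & p & K & Hy & Hx).
  now exists {| cov_conf := K; cov_in := Hx; cov_ker_in := Hy |}.
Qed.

Definition the_hull (X Y : A -> Prop) (h : complete_cotorsion_pair X Y) (a : A) :
  Hull X Y a.
Proof.
  apply (fun H : exists _ : Hull X Y a, True => proj1_sig (chosen H)).
  destruct h as (_ & _ & H). destruct (H a) as (y & x & i & p & K & Hy & Hx).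
  now exists {| hull_conf := K; hull_in := Hy; hull_cok_in := Hx |}.
Qed.

Section CotorsionPair.
Context (X Y : A -> Prop) (h : cotorsion_pair X Y).

Lemma cotorsion_ext (x y : A) : X x -> Y y -> ext1_zero x y.
Proof. intros Hx Hy. now apply (proj1 h x). Qed.

Lemma left_class_retract (x y : A) : is_retract x y -> X y -> X x.
Proof.
  intros (i & r & R) Hy. apply (proj1 h x). intros w Hw.
  apply ext_of_retractions. intros e k q K.
  destruct (ext_lift r (cotorsion_ext Hy Hw) K) as (g & Hg).
  destruct (conf_split_epi (s := g ∘ i) K) as (m & B).
  - now rewrite comp_assoc, Hg.
  - exists m. apply B.
Qed.

Lemma left_class_extension (x y z : A) (u : hom x y) (v : hom y z) :
  conf u v -> X x -> X z -> X y.
Proof.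
  intros H Hx Hz. apply (proj1 h y). intros w Hw.
  apply ext_of_retractions. intros e k q K.
  destruct (noether_kernels K H) as (e' & r & a & b & H1 & H2 & H3 & H4).
  destruct (ext_retraction (cotorsion_ext Hx Hw) H2) as (r0 & R).
  destruct (ext_extend r0 (cotorsion_ext Hz Hw) H1) as (g & Hg).
  exists g. now rewrite <- H3, comp_assoc, Hg.
Qed.

Lemma left_class_biproduct (x y s : A) (i : hom x s) (j : hom y s) p q :
  is_biproduct P i j p q -> X x -> X y -> X s.
Proof. intros B. exact (left_class_extension (biproduct_conf B)). Qed.

End CotorsionPair.

Section ProjectivePair.
Context (C W : A -> Prop) (h : projective_cotorsion_pair C W).

Definition pair_complete : complete_cotorsion_pair C W := proj1 h.
Definition pair_cotorsion : cotorsion_pair C W := proj1 (proj1 h).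

Lemma W_retract (x y : A) : is_retract x y -> W y -> W x.
Proof. exact (proj1 (proj1 (proj2 h)) x y). Qed.

Lemma W_cok (x y z : A) (i : hom x y) (p : hom y z) :
  conf i p -> W x -> W y -> W z.
Proof. intros H. apply (proj2 (proj1 (proj2 h)) _ _ _ _ _ H). Qed.

Lemma W_mid (x y z : A) (i : hom x y) (p : hom y z) :
  conf i p -> W x -> W z -> W y.
Proof. intros H. apply (proj2 (proj1 (proj2 h)) _ _ _ _ _ H). Qed.

Lemma W_ker (x y z : A) (i : hom x y) (p : hom y z) :
  conf i p -> W y -> W z -> W x.
Proof. intros H. apply (proj2 (proj1 (proj2 h)) _ _ _ _ _ H). Qed.

Lemma CW_projective (x : A) : C x -> W x -> is_projective x.
Proof. intros H1 H2. exact (proj1 (proj2 (proj2 h) x) (conj H1 H2)). Qed.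

Lemma projective_C (x : A) : is_projective x -> C x.
Proof. intros H. exact (proj1 (proj2 (proj2 (proj2 h) x) H)). Qed.

Lemma projective_W (x : A) : is_projective x -> W x.
Proof. intros H. exact (proj2 (proj2 (proj2 (proj2 h) x) H)). Qed.

Lemma zero_C (z : A) : is_zero_object z -> C z.
Proof. intros H. now apply projective_C, zero_object_projective. Qed.

Lemma zero_W (z : A) : is_zero_object z -> W z.
Proof. intros H. now apply projective_W, zero_object_projective. Qed.

Lemma C_retract (x y : A) : is_retract x y -> C y -> C x.
Proof. exact (left_class_retract pair_cotorsion (x := x) (y := y)). Qed.

Lemma C_mid (x y z : A) (i : hom x y) (p : hom y z) :
  conf i p -> C x -> C z -> C y.
Proof. exact (left_class_extension pair_cotorsion (u := i) (v := p)). Qed.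

Lemma C_biproduct (x y s : A) (i : hom x s) (j : hom y s) p q :
  is_biproduct P i j p q -> C x -> C y -> C s.
Proof. exact (left_class_biproduct pair_cotorsion (i := i) (j := j) (p := p) (q := q)). Qed.

Lemma C_stable_retract (x c : A) (f : hom x c) (g : hom c x) :
  g ∘ f ~ idm x -> C c -> C x.
Proof.
  intros E Hc. destruct (stable_retract E) as (Q & s & i & j & p & q & HQ & B & R).
  apply (C_retract R). apply (C_biproduct B Hc). now apply projective_C.
Qed.

Lemma extend (x y z w : A) (u : hom x y) (v : hom y z) (f : hom x w) :
  conf u v -> C z -> W w -> exists g, g ∘ u ≈ f.
Proof.
  intros H Hz Hw. exact (ext_extend f (cotorsion_ext pair_cotorsion Hz Hw) H).
Qed.

Lemma lift_epi (x y z c : A) (u : hom x y) (v : hom y z) (f : hom c z) :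
  conf u v -> C c -> W x -> exists g, v ∘ g ≈ f.
Proof.
  intros H Hc Hx. exact (ext_lift f (cotorsion_ext pair_cotorsion Hc Hx) H).
Qed.

(** The cover of an object of [W] is projective, so maps from [C] to [W]
    factor through projectives. *)
Lemma C_to_W_null (c w : A) (f : hom c w) : C c -> W w -> f ~ 0.
Proof.
  intros Hc Hw. destruct (cover pair_complete w) as [q k i p K Hq Hk].
  destruct (lift_epi f K Hc Hk) as (g & Hg).
  apply (proj2 (stable_zero _)). exists q, g, p. split; [|now symmetry].
  apply (CW_projective Hq). exact (W_mid K Hk Hw).
Qed.

(** Modulo a map that extends the factorization of [f ∘ u - g ∘ u] through a
    projective, [f - g] comes from a map [z -> w], which is null. *)
Lemma extend_unique (x y z w : A) (u : hom x y) (v : hom y z) (f g : hom y w) :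
  conf u v -> C z -> W w -> f ∘ u ~ g ∘ u -> f ~ g.
Proof.
  intros H Hz Hw E. apply (proj1 (stable_sub _ _)) in E. apply (proj1 (stable_zero _)) in E.
  destruct E as (Q & a & b & HQ & E).
  destruct (extend a H Hz (projective_W HQ)) as (a' & Ha).
  destruct (conf_coker (f := f + - g + - (b ∘ a')) H) as (m & Hm).
  { expand. rewrite Ha, <- E. abel. }
  apply (proj2 (stable_sub _ _)).
  assert (E' : f + - g ≈ m ∘ v + b ∘ a') by (rewrite Hm; abel).
  rewrite E', (C_to_W_null m Hz Hw), comp_zero_l, hadd_zero_l.
  now apply stable_through.
Qed.

(** Modulo a map through a projective, [f - g] comes from a map [c -> x], which
    is null. *)
Lemma lift_unique (x y z c : A) (u : hom x y) (v : hom y z) (f g : hom c y) :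
  conf u v -> C c -> W x -> v ∘ f ~ v ∘ g -> f ~ g.
Proof.
  intros H Hc Hx E. apply (proj1 (stable_sub _ _)) in E. apply (proj1 (stable_zero _)) in E.
  destruct E as (Q & a & b & HQ & E).
  destruct (HQ _ _ _ _ _ H b) as (b' & Hb).
  destruct (conf_ker (f := f + - g + - (b' ∘ a)) H) as (m & Hm).
  { expand. crw Hb. rewrite <- E. abel. }
  apply (proj2 (stable_sub _ _)).
  assert (E' : f + - g ≈ u ∘ m + b' ∘ a) by (rewrite Hm; abel).
  rewrite E', (C_to_W_null m Hc Hx), comp_zero_r, hadd_zero_l.
  now apply stable_through.
Qed.

(** Such a kernel [x] is a syzygy [x >-> t ->> s] with [t] projective and [s]
    in [C]: extending [x >-> t] to [y], one obtains a conflation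
    [y >-> z + t ->> s], so [t] is in [C] as well as in [W]. If [q] is the cover
    of [x], with kernel [k], and [t'] is the hull of [q], the same argument for
    [x >-> t'/k] shows that [t'/k] is projective. So [k] is a summand of [t'],
    hence of [q], and [x] is a retract of [q]. *)
Lemma C_ker (x y z : A) (u : hom x y) (v : hom y z) :
  conf u v -> C y -> C z -> C x.
Proof.
  intros H Hy Hz.
  destruct (the_hull pair_complete x) as [t s i p K Ht Hs].
  assert (Pt : is_projective t).
  { apply CW_projective; [|exact Ht].
    destruct (extend i H Hz Ht) as (φ & Hφ).
    destruct (conf_coker (f := p ∘ φ) H) as (g & Hg).
    { rewrite <- comp_assoc, Hφ. exact (conf_zero K). }
    destruct (biproduct_exists z t) as (b & j1 & j2 & q1 & q2 & B).
    pose proof (bicartesian_conf H K Hφ Hg B) as L.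
    apply (C_retract (proj2 (biproduct_retract B))). exact (C_mid L Hy Hs). }
  destruct (cover pair_complete x) as [q k ki qp L Hq Hk].
  destruct (the_hull pair_complete q) as [t' s' i' p' K' Ht' Hs'].
  destruct (noether L K') as (k' & r & a & b & N1 & N2 & N3 & N4).
  pose proof (W_cok N1 Hk Ht') as Hk'.
  destruct (extend a K Hs Hk') as (φ & Hφ).
  destruct (conf_coker (f := b ∘ φ) K) as (g & Hg).
  { rewrite <- comp_assoc, Hφ. exact (conf_zero N2). }
  destruct (biproduct_exists s k') as (e & j1 & j2 & q1 & q2 & B).
  pose proof (bicartesian_conf K N2 Hφ Hg B) as M.
  assert (Pk' : is_projective k').
  { apply CW_projective; [|exact Hk'].
    apply (C_retract (proj2 (biproduct_retract B))).
    apply (C_mid M); [now apply projective_C|exact Hs']. }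
  destruct (Pk' _ _ _ _ _ N1 (idm k')) as (σ & Hσ).
  destruct (conf_split_epi N1 Hσ) as (ρ & R & _).
  destruct (conf_split (r := ρ ∘ i') L) as (τ & T).
  { now rewrite <- comp_assoc. }
  apply (C_retract (y := q)); [|exact Hq]. exists τ, qp. apply T.
Qed.

Lemma syzygy_hull_projective (x t s : A) (i : hom x t) (p : hom t s) :
  conf i p -> C x -> W t -> C s -> is_projective t.
Proof. intros K Hx Ht Hs. apply CW_projective; [exact (C_mid K Hx Hs)|exact Ht]. Qed.

(** Conflations [x >-> b ->> s] with [s] in [C] and [b] in [W] compute the
    shift [s] of [x]. *)
Lemma row_map (x b s x' b' s' : A) (i : hom x b) (p : hom b s)
    (i' : hom x' b') (p' : hom b' s') (f : hom x x') :
  conf i p -> conf i' p' -> C s -> W b' ->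
  exists φ g, φ ∘ i ≈ i' ∘ f /\ g ∘ p ≈ p' ∘ φ.
Proof.
  intros H H' Hs Hb. destruct (extend (i' ∘ f) H Hs Hb) as (φ & Hφ).
  destruct (conf_coker (f := p' ∘ φ) H) as (g & Hg).
  { rewrite <- comp_assoc, Hφ, comp_assoc, (conf_zero H'). apply comp_zero_l. }
  now exists φ, g.
Qed.

(** The difference of the two maps of conflations comes, up to projectives,
    from a map [s -> b'], which is null. All the identities between shifts and
    connecting maps below are instances. *)
Lemma row_map_unique (x b s x' b' s' : A) (i : hom x b) (p : hom b s)
    (i' : hom x' b') (p' : hom b' s') (f1 f2 : hom x x') (φ1 φ2 : hom b b')
    (g1 g2 : hom s s') :
  conf i p -> conf i' p' -> C s -> W b' -> f1 ~ f2 ->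
  φ1 ∘ i ≈ i' ∘ f1 -> g1 ∘ p ≈ p' ∘ φ1 ->
  φ2 ∘ i ≈ i' ∘ f2 -> g2 ∘ p ≈ p' ∘ φ2 -> g1 ~ g2.
Proof.
  intros H H' Hs Hb E F1 G1 F2 G2.
  apply (proj1 (stable_sub _ _)) in E. apply (proj1 (stable_zero _)) in E. destruct E as (Q & a & c & HQ & E).
  destruct (extend a H Hs (projective_W HQ)) as (a' & Ha).
  destruct (conf_coker (f := φ1 + - φ2 + - (i' ∘ c ∘ a')) H) as (ψ & Hψ).
  { expand. rewrite Ha, F1, F2, <- E. expand. abel. }
  apply (proj2 (stable_sub _ _)).
  assert (G : g1 + - g2 ≈ p' ∘ ψ).
  { apply (conf_epic H). rewrite <- comp_assoc, Hψ. expand.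
    rewrite G1, G2. crw (conf_zero H'). expand. abel. }
  rewrite G, (C_to_W_null ψ Hs Hb). now rewrite comp_zero_r.
Qed.

End ProjectivePair.
End Stable.

(** * Triangles *)

Section Triangles.
Context (C : Cat) (P : Preadditive C) (S : Functor C C).
Context (D : forall x y z : C, hom x y -> hom y z -> hom z (S x) -> Prop).

Lemma triangle_iso_refl (x y z : C) (f : hom x y) (g : hom y z) (h : hom z (S x)) :
  triangle_iso f g h f g h.
Proof.
  exists (idm x), (idm y), (idm z). repeat split; try apply iso_id.
  - now rewrite comp_id_l, comp_id_r.
  - now rewrite comp_id_l, comp_id_r.
  - now rewrite fmap_id, comp_id_l, comp_id_r.
Qed.

Lemma triangle_iso_trans (x y z x' y' z' x'' y'' z'' : C)
   (f : hom x y) (g : hom y z) (h : hom z (S x))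
   (f' : hom x' y') (g' : hom y' z') (h' : hom z' (S x'))
   (f'' : hom x'' y'') (g'' : hom y'' z'') (h'' : hom z'' (S x'')) :
  triangle_iso f g h f' g' h' -> triangle_iso f' g' h' f'' g'' h'' ->
  triangle_iso f g h f'' g'' h''.
Proof.
  intros (a & b & c & Ha & Hb & Hc & E1 & E2 & E3)
    (a' & b' & c' & Ha' & Hb' & Hc' & E1' & E2' & E3').
  exists (a' ∘ a), (b' ∘ b), (c' ∘ c).
  split; [|split; [|split; [|split; [|split]]]]; try (apply iso_comp; assumption).
  - now rewrite <- comp_assoc, E1, !comp_assoc, E1'.
  - now rewrite <- comp_assoc, E2, !comp_assoc, E2'.
  - now rewrite fmap_comp, <- comp_assoc, E3, !comp_assoc, E3'.
Qed.

Lemma triangle_iso_sym (x y z x' y' z' : C)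
   (f : hom x y) (g : hom y z) (h : hom z (S x))
   (f' : hom x' y') (g' : hom y' z') (h' : hom z' (S x')) :
  triangle_iso f g h f' g' h' -> triangle_iso f' g' h' f g h.
Proof.
  intros (a & b & c & Ha & Hb & Hc & E1 & E2 & E3).
  exists (inv_of Ha), (inv_of Hb), (inv_of Hc).
  split; [|split; [|split; [|split; [|split]]]].
  - exact (iso_inv (inv_of_l Ha) (inv_of_r Ha)).
  - exact (iso_inv (inv_of_l Hb) (inv_of_r Hb)).
  - exact (iso_inv (inv_of_l Hc) (inv_of_r Hc)).
  - apply (iso_mono Hb). apply (iso_epi Ha).
    rewrite !comp_assoc, inv_of_r, comp_id_l, E1.
    now rewrite <- !comp_assoc, inv_of_l, comp_id_r.
  - apply (iso_mono Hc). apply (iso_epi Hb).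
    rewrite !comp_assoc, inv_of_r, comp_id_l, E2.
    now rewrite <- !comp_assoc, inv_of_l, comp_id_r.
  - apply (iso_mono (fmap_iso S Ha)). apply (iso_epi Hc).
    rewrite !comp_assoc, <- fmap_comp, inv_of_r, fmap_id, comp_id_l, E3.
    now rewrite <- !comp_assoc, inv_of_l, comp_id_r.
Qed.

Lemma triangle_iso_rotate (x y z x' y' z' : C)
   (f : hom x y) (g : hom y z) (h : hom z (S x))
   (f' : hom x' y') (g' : hom y' z') (h' : hom z' (S x')) :
  triangle_iso f g h f' g' h' ->
  triangle_iso g h (hopp P (fmap S f)) g' h' (hopp P (fmap S f')).
Proof.
  intros (a & b & c & Ha & Hb & Hc & E1 & E2 & E3).
  exists b, c, (fmap S a). repeat (split; [assumption || now apply fmap_iso|]).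
  rewrite comp_opp_l, comp_opp_r. now rewrite <- !fmap_comp, E1.
Qed.

Definition fillable (x y z x' y' z' : C)
   (f : hom x y) (g : hom y z) (h : hom z (S x))
   (f' : hom x' y') (g' : hom y' z') (h' : hom z' (S x')) : Prop :=
  forall a b, b ∘ f ≈ f' ∘ a ->
  exists c, c ∘ g ≈ g' ∘ b /\ fmap S a ∘ h ≈ h' ∘ c.

Lemma fillable_iso (x y z x' y' z' x1 y1 z1 x1' y1' z1' : C)
   (f : hom x y) (g : hom y z) (h : hom z (S x))
   (f' : hom x' y') (g' : hom y' z') (h' : hom z' (S x'))
   (f1 : hom x1 y1) (g1 : hom y1 z1) (h1 : hom z1 (S x1))
   (f1' : hom x1' y1') (g1' : hom y1' z1') (h1' : hom z1' (S x1')) :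
  triangle_iso f1 g1 h1 f g h -> triangle_iso f' g' h' f1' g1' h1' ->
  fillable f g h f' g' h' -> fillable f1 g1 h1 f1' g1' h1'.
Proof.
  intros (a & b & c & Ha & Hb & Hc & E1 & E2 & E3)
    (a' & b' & c' & Ha' & Hb' & Hc' & E1' & E2' & E3') H u v Huv.
  destruct (H (inv_of Ha' ∘ u ∘ inv_of Ha) (inv_of Hb' ∘ v ∘ inv_of Hb))
    as (w & W1 & W2).
  { apply (iso_mono Hb'). apply (iso_epi Ha).
    rewrite !comp_assoc, inv_of_r, comp_id_l, E1', <- !comp_assoc, <- E1.
    rewrite inv_of_l, comp_id_r, (comp_assoc (inv_of Hb)), inv_of_l, comp_id_l, Huv.
    now rewrite (comp_assoc a'), inv_of_r, comp_id_l. }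
  exists (c' ∘ w ∘ c). split.
  - rewrite <- !comp_assoc, E2, (comp_assoc w), W1, !comp_assoc, E2'.
    rewrite <- !comp_assoc, inv_of_l, comp_id_r.
    now rewrite (comp_assoc b'), inv_of_r, comp_id_l.
  - rewrite !comp_assoc, <- E3', <- (comp_assoc (fmap S a')), <- W2.
    rewrite <- !comp_assoc, <- E3, !comp_assoc, <- !fmap_comp.
    rewrite <- !comp_assoc, inv_of_l, comp_id_r.
    now rewrite (comp_assoc a'), inv_of_r, comp_id_l.
Qed.

Hypothesis D_iso : forall (x y z x' y' z' : C)
   (f : hom x y) (g : hom y z) (h : hom z (S x))
   (f' : hom x' y') (g' : hom y' z') (h' : hom z' (S x')),
  triangle_iso f g h f' g' h' -> D f g h -> D f' g' h'.
Hypothesis D_fill : forall (x y z x' y' z' : C)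
   (f : hom x y) (g : hom y z) (h : hom z (S x))
   (f' : hom x' y') (g' : hom y' z') (h' : hom z' (S x')),
  D f g h -> D f' g' h' -> fillable f g h f' g' h'.
Hypothesis D_weak_cokernel : forall (x y z t : C)
   (f : hom x y) (g : hom y z) (h : hom z (S x)) (k : hom z t),
  D f g h -> k ∘ g ≈ hzero P y t -> exists m, k ≈ m ∘ h.

(** An endomorphism of a triangle that is the identity on the first two
    vertices differs from the identity by a square-zero map. *)
Lemma cone_endo_iso (x y z : C) (f : hom x y) (g : hom y z) (h : hom z (S x))
  (e : hom z z) : D f g h -> e ∘ g ≈ g -> h ∘ e ≈ h -> is_iso e.
Proof.
  intros H E1 E2.
  destruct (@D_weak_cokernel _ _ _ _ _ _ _ (hadd P e (hopp P (idm z))) H) as (m & Hm).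
  { expand. rewrite E1. abel. }
  assert (N : hadd P e (hopp P (idm z)) ∘ hadd P e (hopp P (idm z)) ≈ hzero P z z).
  { rewrite Hm at 1. expand. rewrite E2. abel. }
  revert N. expand. intros N.
  exists (hadd P (hadd P (idm z) (idm z)) (hopp P e)).
  assert (N' : e ∘ e ≈ hadd P (hadd P e e) (hopp P (idm z))).
  { rewrite <- (hadd_zero P (hadd P _ _)), <- N. abel. }
  split; expand; rewrite N'; abel.
Qed.

(** Fillers for [a], [b] and for their inverses compose to endomorphisms as in
    [cone_endo_iso]. *)
Lemma cone_unique (x y z x' y' z' : C)
   (f : hom x y) (g : hom y z) (h : hom z (S x))
   (f' : hom x' y') (g' : hom y' z') (h' : hom z' (S x')) a b :
  D f g h -> D f' g' h' -> is_iso a -> is_iso b -> b ∘ f ≈ f' ∘ a ->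
  exists c, is_iso c /\ c ∘ g ≈ g' ∘ b /\ fmap S a ∘ h ≈ h' ∘ c.
Proof.
  intros H H' Ha Hb E.
  destruct (D_fill H H' E) as (c & C1 & C2).
  assert (E' : inv_of Hb ∘ f' ≈ f ∘ inv_of Ha).
  { apply (iso_mono Hb). apply (iso_epi Ha).
    rewrite !comp_assoc, inv_of_r, comp_id_l, E.
    now rewrite <- !comp_assoc, inv_of_l, comp_id_r. }
  destruct (D_fill H' H E') as (d & D1 & D2).
  assert (K1 : is_iso (d ∘ c)).
  { apply (cone_endo_iso H).
    - rewrite <- comp_assoc, C1, comp_assoc, D1, <- comp_assoc, inv_of_l. apply comp_id_r.
    - rewrite comp_assoc, <- D2, <- comp_assoc, <- C2, comp_assoc, <- fmap_comp.
      rewrite inv_of_l, fmap_id. apply comp_id_l. }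
  assert (K2 : is_iso (c ∘ d)).
  { apply (cone_endo_iso H').
    - rewrite <- comp_assoc, D1, comp_assoc, C1, <- comp_assoc, inv_of_r. apply comp_id_r.
    - rewrite comp_assoc, <- C2, <- comp_assoc, <- D2, comp_assoc, <- fmap_comp.
      rewrite inv_of_r, fmap_id. apply comp_id_l. }
  exists c. split; [|now split].
  exists (inv_of K1 ∘ d). split.
  - rewrite <- comp_assoc. apply inv_of_l.
  - apply (iso_epi K2). rewrite comp_id_l.
    rewrite <- !comp_assoc. rewrite (comp_assoc d c d), (comp_assoc (inv_of K1)).
    rewrite inv_of_l. now rewrite comp_id_l.
Qed.

Hypothesis D_rotate : forall (x y z : C)
   (f : hom x y) (g : hom y z) (h : hom z (S x)),
  D f g h -> D g h (hopp P (fmap S f)).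
Hypothesis D_cone : forall (x y : C) (f : hom x y),
  exists z (g : hom y z) (h : hom z (S x)), D f g h.
Hypothesis S_ff : fully_faithful S.

(** Three rotations shift a triangle, up to signs, and [S] reflects
    isomorphisms. So the triangle is isomorphic to one completing [f]. *)
Lemma rotate_back (x y z : C) (f : hom x y) (g : hom y z) (h : hom z (S x)) :
  D g h (hopp P (fmap S f)) -> D f g h.
Proof.
  intros H. destruct (D_cone f) as (z' & g' & h' & H').
  pose proof (D_rotate (D_rotate H)) as K.
  pose proof (D_rotate (D_rotate (D_rotate H'))) as K'.
  destruct (cone_unique (a := idm _) (b := idm _) K K') as (c & Hc & C1 & C2).
  - apply iso_id.
  - apply iso_id.
  - now rewrite comp_id_l, comp_id_r.
  - destruct S_ff as [Fa Fu]. destruct (Fu _ _ c) as (c0 & Hc0).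
    assert (Ic : is_iso c0).
    { apply (ff_reflects_iso S_ff). now apply (iso_heq (symmetry Hc0)). }
    assert (G : c0 ∘ g ≈ g').
    { apply Fa. rewrite fmap_comp, Hc0.
      rewrite <- (hopp_opp P (c ∘ _)), <- comp_opp_r, C1, comp_id_r. apply hopp_opp. }
    assert (G' : h ≈ h' ∘ c0).
    { apply Fa. rewrite fmap_comp, Hc0.
      rewrite <- (hopp_opp P (_ ∘ c)), <- comp_opp_l, <- C2, fmap_id, comp_id_l.
      symmetry. apply hopp_opp. }
    apply (D_iso (f := f) (g := g') (h := h')); [|exact H'].
    apply triangle_iso_sym. exists (idm x), (idm y), c0.
    repeat (split; [assumption || apply iso_id|]).
    rewrite fmap_id, !comp_id_l, !comp_id_r. now repeat split.
Qed.

Definition octahedron (x y z x' y' z' : C)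
    (f : hom x y) (f' : hom y z') (f'' : hom z' (S x))
    (g : hom y z) (g' : hom z x') (g'' : hom x' (S y))
    (h' : hom z y') (h'' : hom y' (S x)) : Prop :=
  exists (u : hom z' y') (v : hom y' x'),
    D u v (fmap S f' ∘ g'') /\ u ∘ f' ≈ h' ∘ g /\ h'' ∘ u ≈ f'' /\
    v ∘ h' ≈ g' /\ g'' ∘ v ≈ fmap S f ∘ h''.

(** By uniqueness of cones, the octahedral axiom may be checked for one
    choice of cones and up to isomorphism of composable pairs. *)
Lemma octahedron_iso (x y z x' y' z' x1 y1 z1 x1' y1' z1' : C)
    (f : hom x y) (f' : hom y z') (f'' : hom z' (S x))
    (g : hom y z) (g' : hom z x') (g'' : hom x' (S y))
    (h' : hom z y') (h'' : hom y' (S x))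
    (f1 : hom x1 y1) (f1' : hom y1 z1') (f1'' : hom z1' (S x1))
    (g1 : hom y1 z1) (g1' : hom z1 x1') (g1'' : hom x1' (S y1))
    (h1' : hom z1 y1') (h1'' : hom y1' (S x1)) a b c :
  is_iso a -> is_iso b -> is_iso c -> b ∘ f ≈ f1 ∘ a -> c ∘ g ≈ g1 ∘ b ->
  D f f' f'' -> D g g' g'' -> D (g ∘ f) h' h'' ->
  D f1 f1' f1'' -> D g1 g1' g1'' -> D (g1 ∘ f1) h1' h1'' ->
  octahedron f1 f1' f1'' g1 g1' g1'' h1' h1'' ->
  octahedron f f' f'' g g' g'' h' h''.
Proof.
  intros Ha Hb Hc Ef Eg Hf Hg Hh Hf1 Hg1 Hh1 (u & v & O1 & O2 & O3 & O4 & O5).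
  destruct (cone_unique Hf Hf1 Ha Hb Ef) as (α & Iα & A1 & A2).
  destruct (cone_unique Hg Hg1 Hb Hc Eg) as (β & Iβ & B1 & B2).
  assert (E : c ∘ (g ∘ f) ≈ g1 ∘ f1 ∘ a).
  { now rewrite comp_assoc, Eg, <- comp_assoc, Ef, comp_assoc. }
  destruct (cone_unique Hh Hh1 Ha Hc E) as (κ & Iκ & K1 & K2).
  exists (inv_of Iκ ∘ u ∘ α), (inv_of Iβ ∘ v ∘ κ).
  split; [|split; [|split; [|split]]].
  - apply (fun K => D_iso K O1). apply triangle_iso_sym.
    exists α, κ, β. repeat (split; [assumption|]). split; [|split].
    + now rewrite !comp_assoc, inv_of_r, comp_id_l.
    + now rewrite !comp_assoc, inv_of_r, comp_id_l.
    + rewrite comp_assoc, <- fmap_comp, A1, fmap_comp.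
      now rewrite <- !comp_assoc, B2.
  - apply (iso_mono Iκ). rewrite !comp_assoc, inv_of_r, comp_id_l, K1.
    rewrite <- !comp_assoc, A1, Eg, (comp_assoc u), O2. now rewrite comp_assoc.
  - apply (iso_mono (fmap_iso S Ha)). rewrite A2, !comp_assoc, K2.
    rewrite <- (comp_assoc h1''), inv_of_r, comp_id_r. now rewrite O3.
  - apply (iso_mono Iβ). rewrite !comp_assoc, inv_of_r, comp_id_l, B1.
    now rewrite <- comp_assoc, K1, comp_assoc, O4.
  - apply (iso_mono (fmap_iso S Hb)). rewrite !comp_assoc, B2.
    rewrite <- (comp_assoc g1''), inv_of_r, comp_id_r, O5, <- fmap_comp, Ef.
    now rewrite fmap_comp, <- !comp_assoc, K2.
Qed.

End Triangles.

(** * The stable category of a projective cotorsion pair *)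

Definition stab_pre (A : ExactCat) (S : A -> Prop) : Preadditive (stab S).
Proof.
  refine {| hzero := fun x y : stab S => hzero (epre A) (proj1_sig x) (proj1_sig y)
                       : @hom (stab S) x y;
            hadd := fun (x y : stab S) (f g : @hom (stab S) x y) => hadd (epre A) f g;
            hopp := fun (x y : stab S) (f : @hom (stab S) x y) => hopp (epre A) f |}.
  - intros x y f g k. apply stable_eq_of_heq, hadd_assoc.
  - intros x y f g. apply stable_eq_of_heq, hadd_comm.
  - intros x y f. apply stable_eq_of_heq, hadd_zero.
  - intros x y f. apply stable_eq_of_heq, hadd_opp.
  - intros x y z g g' f. apply stable_eq_of_heq.
    exact (@comp_add_l _ (epre A) (proj1_sig x) (proj1_sig y) (proj1_sig z) g g' f).
  - intros x y z g f f'. apply stable_eq_of_heq.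
    exact (@comp_add_r _ (epre A) (proj1_sig x) (proj1_sig y) (proj1_sig z) g f f').
Defined.

Section Frobenius.
Context (A : ExactCat) (C W : A -> Prop) (h : projective_cotorsion_pair C W).
Local Notation P := (epre A).
Local Notation "0" := (hzero P _ _).
Local Infix "+" := (hadd P).
Local Notation "- f" := (hopp P f).

Lemma stab_additive : additive (stab_pre C).
Proof.
  split.
  - destruct (zero_ob A) as (z & Hz). exists (exist _ z (zero_C h Hz)).
    apply (proj2 (zero_object_id (stab_pre C) _)).
    apply stable_eq_of_heq. now apply zero_object_maps.
  - intros [x Hx] [y Hy]. destruct (biproduct_exists x y) as (s & i & j & p & q & B).
    exists (exist _ s (C_biproduct h B Hx Hy)), i, j, p, q.
    destruct B as (B1 & B2 & B3 & B4 & B5).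
    repeat split; now apply stable_eq_of_heq.
Qed.

(** ** The shift *)

Local Notation row x := (the_hull (pair_complete h) x).

Lemma row_shift (x y : A) (f : hom x y) :
  exists g : hom (hull_cok (row x)) (hull_cok (row y)),
  exists φ, φ ∘ hull_i (row x) ≈ hull_i (row y) ∘ f /\
            g ∘ hull_p (row x) ≈ hull_p (row y) ∘ φ.
Proof.
  destruct (row_map h f (hull_conf (row x)) (hull_conf (row y))
              (hull_cok_in (row x)) (hull_in (row y))) as (φ & g & H).
  now exists g, φ.
Qed.

Definition shift_map (x y : A) (f : hom x y) :
  hom (hull_cok (row x)) (hull_cok (row y)) := proj1_sig (chosen (row_shift f)).

Lemma shift_map_spec (x y : A) (f : hom x y) :
  exists φ, φ ∘ hull_i (row x) ≈ hull_i (row y) ∘ f /\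
            shift_map f ∘ hull_p (row x) ≈ hull_p (row y) ∘ φ.
Proof. exact (proj2_sig (chosen (row_shift f))). Qed.

Lemma shift_map_unique (x y : A) (f : hom x y)
  (g : hom (hull_cok (row x)) (hull_cok (row y))) φ :
  φ ∘ hull_i (row x) ≈ hull_i (row y) ∘ f ->
  g ∘ hull_p (row x) ≈ hull_p (row y) ∘ φ -> shift_map f ~ g.
Proof.
  intros H1 H2. destruct (shift_map_spec f) as (ψ & K1 & K2).
  exact (row_map_unique h (hull_conf (row x)) (hull_conf (row y))
           (hull_cok_in (row x)) (hull_in (row y)) (reflexivity f) K1 K2 H1 H2).
Qed.

Definition stab_shift : Functor (stab C) (stab C).
Proof.
  refine {| fob := fun x : stab C => exist _ (hull_cok (row (proj1_sig x)))
                     (hull_cok_in (row (proj1_sig x))) : stab C;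
            fmap := fun (x y : stab C) (f : @hom (stab C) x y) =>
               @shift_map (proj1_sig x) (proj1_sig y) f |}.
  - intros x y f g E. destruct (shift_map_spec f) as (φ & F1 & F2),
      (shift_map_spec g) as (ψ & G1 & G2).
    exact (row_map_unique h (hull_conf _) (hull_conf _) (hull_cok_in _) (hull_in _)
             E F1 F2 G1 G2).
  - intros x. apply (shift_map_unique (φ := idm _)).
    + simpl. now rewrite comp_id_l, comp_id_r.
    + simpl. now rewrite comp_id_l, comp_id_r.
  - intros x y z g f. destruct (shift_map_spec f) as (φ & F1 & F2),
      (shift_map_spec g) as (ψ & G1 & G2).
    apply (shift_map_unique (φ := ψ ∘ φ)); simpl.
    + now rewrite <- comp_assoc, F1, comp_assoc, G1, <- comp_assoc.
    + now rewrite <- comp_assoc, F2, comp_assoc, G2, <- comp_assoc.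
Defined.

Lemma row_projective (x : A) : C x -> is_projective (hull (row x)).
Proof.
  intros Hx. exact (syzygy_hull_projective h (hull_conf _) Hx (hull_in _) (hull_cok_in _)).
Qed.

(** The shift does not depend on the chosen row. *)
Lemma rows_cokernel_iso (x b s b' s' : A) (i : hom x b) (p : hom b s)
    (i' : hom x b') (p' : hom b' s') :
  conf i p -> conf i' p' -> C s -> W b -> C s' -> W b' ->
  exists (φ : hom b b') (g : hom s s') (g' : hom s' s),
    φ ∘ i ≈ i' /\ g ∘ p ≈ p' ∘ φ /\ g' ∘ g ~ idm s /\ g ∘ g' ~ idm s'.
Proof.
  intros H H' Hs Hb Hs' Hb'.
  destruct (row_map h (idm x) H H' Hs Hb') as (φ & g & F1 & F2).
  destruct (row_map h (idm x) H' H Hs' Hb) as (ψ & k & G1 & G2).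
  exists φ, g, k. split; [now rewrite F1, comp_id_r|]. split; [exact F2|].
  rewrite comp_id_r in F1, G1.
  split.
  - apply (row_map_unique h (f1 := idm x) (f2 := idm x) (φ1 := ψ ∘ φ) (φ2 := idm b) H H);
      try assumption; try reflexivity.
    + now rewrite <- comp_assoc, F1, comp_id_r.
    + now rewrite <- comp_assoc, F2, comp_assoc, G2, <- comp_assoc.
    + now rewrite comp_id_l, comp_id_r.
    + now rewrite comp_id_l, comp_id_r.
  - apply (row_map_unique h (f1 := idm x) (f2 := idm x) (φ1 := φ ∘ ψ) (φ2 := idm b') H' H');
      try assumption; try reflexivity.
    + now rewrite <- comp_assoc, G1, comp_id_r.
    + now rewrite <- comp_assoc, G2, comp_assoc, F2, <- comp_assoc.
    + now rewrite comp_id_l, comp_id_r.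
    + now rewrite comp_id_l, comp_id_r.
Qed.

(** Maps between the cokernels lift to the projective middle terms. *)
Lemma stab_shift_ff : fully_faithful stab_shift.
Proof.
  split.
  - intros x y f g E. simpl in *.
    pose proof (row_projective (proj2_sig x)) as Px.
    pose proof (row_projective (proj2_sig y)) as Py.
    destruct (shift_map_spec f) as (φ & F1 & F2).
    destruct (shift_map_spec g) as (ψ & G1 & G2).
    apply (proj1 (stable_sub _ _)) in E. apply (proj1 (stable_zero _)) in E.
    destruct E as (Q & a & b & HQ & E).
    destruct (HQ _ _ _ _ _ (hull_conf (row (proj1_sig y))) b) as (b' & Hb).
    destruct (conf_ker (f := φ + - ψ + - (b' ∘ a ∘ hull_p (row (proj1_sig x))))
                (hull_conf (row (proj1_sig y)))) as (m & Hm).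
    { expand. rewrite <- F2, <- G2, (comp_assoc_pre Hb), (comp_assoc_pre (symmetry E)).
      expand. abel. }
    apply (proj2 (stable_sub _ _)).
    assert (K : f + - g ≈ m ∘ hull_i (row (proj1_sig x))).
    { apply (conf_monic (hull_conf (row (proj1_sig y)))).
      rewrite comp_assoc, Hm. expand. rewrite F1, G1.
      crw (conf_zero (hull_conf (row (proj1_sig x)))). expand. abel. }
    rewrite K. now apply stable_through.
  - intros x y g. simpl in *.
    pose proof (row_projective (proj2_sig x)) as Px.
    destruct (Px _ _ _ _ _ (hull_conf (row (proj1_sig y)))
                (g ∘ hull_p (row (proj1_sig x)))) as (φ & Hφ).
    destruct (conf_ker (f := φ ∘ hull_i (row (proj1_sig x)))
                (hull_conf (row (proj1_sig y)))) as (f & Hf).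
    { rewrite comp_assoc, Hφ, <- comp_assoc, (conf_zero (hull_conf _)).
      apply comp_zero_r. }
    exists f. apply (shift_map_unique (φ := φ)); now symmetry.
Qed.

(** An object [z] is the shift of its syzygy. *)
Lemma stab_shift_equivalence : enough_projectives A -> is_equivalence stab_shift.
Proof.
  intros EP. apply equivalence_of_ff; [exact stab_shift_ff|].
  intros [z Hz]. destruct (EP z) as (k & Q & i & p & HQ & K).
  pose proof (C_ker h K (projective_C h HQ) Hz) as Hk.
  exists (exist _ k Hk).
  destruct (rows_cokernel_iso (hull_conf (row k)) K (hull_cok_in _) (hull_in _) Hz
              (projective_W h HQ)) as (φ & g & g' & _ & _ & G1 & G2).
  exists g, g'. split; assumption.
Qed.

(** ** Triangles *)

Lemma stab_iso (x y : stab C) (f : hom (proj1_sig x) (proj1_sig y))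
  (g : hom (proj1_sig y) (proj1_sig x)) :
  g ∘ f ~ idm _ -> f ∘ g ~ idm _ -> is_iso (f : hom x y).
Proof. intros H1 H2. exists g. split; assumption. Qed.

(** Up to isomorphism, [u] and [v] form a conflation and [w] is its connecting
    map: an extension [φ] to [y'] of the inclusion of [x'] in its row induces
    [w] on the cokernels. *)
Definition stab_dist (x y z : stab C) (f : hom x y) (g : hom y z)
    (k : hom z (stab_shift x)) : Prop :=
  exists (x' y' z' : stab C) (u : hom (proj1_sig x') (proj1_sig y'))
         (v : hom (proj1_sig y') (proj1_sig z'))
         (w : hom (proj1_sig z') (proj1_sig (stab_shift x')))
         (φ : hom (proj1_sig y') (hull (row (proj1_sig x')))),
    conf u v /\ C (proj1_sig z') /\ φ ∘ u ≈ hull_i (row (proj1_sig x')) /\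
    w ∘ v ≈ hull_p (row (proj1_sig x')) ∘ φ /\
    triangle_iso (S := stab_shift) (u : hom x' y') (v : hom y' z') w f g k.

Lemma stab_dist_iso (x y z x' y' z' : stab C)
   (f : hom x y) (g : hom y z) (k : hom z (stab_shift x))
   (f' : hom x' y') (g' : hom y' z') (k' : hom z' (stab_shift x')) :
  triangle_iso f g k f' g' k' -> stab_dist f g k -> stab_dist f' g' k'.
Proof.
  intros T (x1 & y1 & z1 & u & v & w & φ & H1 & H2 & H3 & H4 & T').
  exists x1, y1, z1, u, v, w, φ. repeat (split; [assumption|]).
  exact (triangle_iso_trans T' T).
Qed.

Lemma stab_dist_conf (x y z : stab C) (u : hom (proj1_sig x) (proj1_sig y))
    (v : hom (proj1_sig y) (proj1_sig z))
    (w : hom (proj1_sig z) (hull_cok (row (proj1_sig x))))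
    (φ : hom (proj1_sig y) (hull (row (proj1_sig x)))) :
  conf u v -> φ ∘ u ≈ hull_i (row (proj1_sig x)) ->
  w ∘ v ≈ hull_p (row (proj1_sig x)) ∘ φ ->
  stab_dist (u : hom x y) (v : hom y z) (w : hom z (stab_shift x)).
Proof.
  intros H1 H2 H3. exists x, y, z, u, v, w, φ.
  split; [exact H1|]. split; [exact (proj2_sig z)|]. split; [exact H2|].
  split; [exact H3|]. apply triangle_iso_refl.
Qed.

(** Extend [i] to the middle term and pass to the cokernels. *)
Lemma connecting (x y z b s : A) (u : hom x y) (v : hom y z) (i : hom x b) (p : hom b s) :
  conf u v -> conf i p -> C z -> W b ->
  exists (φ : hom y b) (w : hom z s), φ ∘ u ≈ i /\ w ∘ v ≈ p ∘ φ.
Proof.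
  intros H K Hz Hb. destruct (row_map h (idm x) H K Hz Hb) as (φ & w & H1 & H2).
  exists φ, w. split; [now rewrite H1, comp_id_r|exact H2].
Qed.

(** If [k ∘ v] factors through the projective [Q] by [a], then [a ∘ u] extends
    to [d] on [b]. So [a - d ∘ φ] descends to [z] and contributes only a null
    map to [k], while the part through [d] descends to [s]. *)
Lemma conf_weak_cokernel (x y z b s t : A) (u : hom x y) (v : hom y z)
    (i : hom x b) (p : hom b s) (φ : hom y b) (w : hom z s) (k : hom z t) :
  conf u v -> conf i p -> C z -> C s -> φ ∘ u ≈ i -> w ∘ v ≈ p ∘ φ ->
  k ∘ v ~ 0 -> exists m, k ~ m ∘ w.
Proof.
  intros H K Hz Hs E1 E2 E. apply (proj1 (stable_zero _)) in E.
  destruct E as (Q & a & c & HQ & E).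
  destruct (extend h (a ∘ u) K Hs (projective_W h HQ)) as (d & Hd).
  destruct (conf_coker (f := a + - (d ∘ φ)) H) as (r & Hr).
  { expand. rewrite E1, Hd. abel. }
  destruct (conf_coker (f := c ∘ d) K) as (m & Hm).
  { rewrite <- comp_assoc, Hd, comp_assoc, <- E, <- comp_assoc, (conf_zero H).
    apply comp_zero_r. }
  exists m. apply (proj2 (stable_sub _ _)).
  assert (F : k + - (m ∘ w) ≈ c ∘ r).
  { apply (conf_epic H). expand. rewrite E2, E, Hr, (comp_assoc_pre Hm). expand. abel. }
  rewrite F. now apply stable_through.
Qed.

(** Once the square commutes strictly, it induces a map on the cokernels;
    [row_map_unique] compares the connecting maps. *)
Lemma stab_dist_fill (x y z x' y' z' : stab C)
   (f : hom x y) (g : hom y z) (k : hom z (stab_shift x))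
   (f' : hom x' y') (g' : hom y' z') (k' : hom z' (stab_shift x')) :
  stab_dist f g k -> stab_dist f' g' k' ->
  fillable (S := stab_shift) f g k f' g' k'.
Proof.
  intros (x1 & y1 & z1 & u & v & w & φ & H1 & H2 & H3 & H4 & T)
    (x1' & y1' & z1' & u' & v' & w' & φ' & H1' & H2' & H3' & H4' & T').
  apply (fillable_iso (triangle_iso_sym T) T').
  intros a b E. simpl in *.
  symmetry in E. apply (proj1 (stable_sub _ _)) in E.
  apply (proj1 (stable_zero _)) in E. destruct E as (Q & c & d & HQ & E).
  destruct (extend h c H1 H2 (projective_W h HQ)) as (c' & Hc).
  (* [b] replaced by a stably equal map making the square commute strictly *)
  set (b1 := b + d ∘ c').
  assert (B1 : b1 ∘ u ≈ u' ∘ a).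
  { unfold b1. expand. rewrite Hc, <- E. abel. }
  destruct (conf_coker (f := v' ∘ b1) H1) as (e & He).
  { rewrite <- comp_assoc, B1, comp_assoc, (conf_zero H1'). apply comp_zero_l. }
  exists e. split.
  - rewrite He. unfold b1. rewrite (stable_through c' d HQ).
    apply stable_comp_proper; [reflexivity|]. apply stable_eq_of_heq, hadd_zero.
  - destruct (shift_map_spec a) as (ψ & S1 & S2).
    apply (row_map_unique h (f1 := a) (f2 := a) (φ1 := ψ ∘ φ) (φ2 := φ' ∘ b1)
             H1 (hull_conf _) H2 (hull_in _)).
    + reflexivity.
    + now rewrite <- comp_assoc, H3.
    + now rewrite <- comp_assoc, H4, comp_assoc, S2, comp_assoc.
    + now rewrite <- comp_assoc, B1, comp_assoc, H3'.
    + now rewrite <- comp_assoc, He, comp_assoc, H4', comp_assoc.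
Qed.

Lemma stab_dist_weak_cokernel (x y z t : stab C)
   (f : hom x y) (g : hom y z) (k : hom z (stab_shift x)) (e : hom z t) :
  stab_dist f g k -> e ∘ g ≈ hzero (stab_pre C) y t -> exists m, e ≈ m ∘ k.
Proof.
  intros (x1 & y1 & z1 & u & v & w & φ & H1 & H2 & H3 & H4 & T) E.
  destruct T as (a & b & c & Ha & Hb & Hc & E1 & E2 & E3).
  destruct (@conf_weak_cokernel _ _ _ _ _ _ u v _ _ φ w (e ∘ c) H1 (hull_conf _) H2
              (hull_cok_in _) H3 H4) as (m & Hm).
  { change ((e ∘ c) ∘ (v : @hom (stab C) y1 z1) ≈ hzero (stab_pre C) y1 t).
    rewrite <- comp_assoc, E2, comp_assoc, E. apply comp_zero_l. }
  exists ((m : @hom (stab C) (stab_shift x1) t) ∘ inv_of (fmap_iso stab_shift Ha)).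
  apply (iso_epi Hc).
  rewrite <- (comp_assoc _ _ c), <- E3, <- comp_assoc.
  rewrite (comp_assoc (inv_of _)), inv_of_l, comp_id_l. exact Hm.
Qed.

(** By [bicartesian_conf] the conflation [x >-> y ->> z] and the row
    [x >-> b ->> s] give a conflation [y >-> z + b ->> s]; as [b] is projective,
    it represents the rotated triangle. *)
Lemma stab_dist_rotate (x y z : stab C)
   (f : hom x y) (g : hom y z) (k : hom z (stab_shift x)) :
  stab_dist f g k ->
  stab_dist g k (hopp (stab_pre C) (fmap stab_shift f)).
Proof.
  intros (x1 & y1 & z1 & u & v & w & φ & H1 & H2 & H3 & H4 & T).
  apply (stab_dist_iso (triangle_iso_rotate (stab_pre C) T)). clear T x y z f g k.
  destruct x1 as [x Hx], y1 as [y Hy], z1 as [z Hz]. simpl in *.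
  destruct (biproduct_exists z (hull (row x))) as (e & j1 & j2 & q1 & q2 & B).
  pose proof (row_projective Hx) as Px.
  pose proof (C_biproduct h B Hz (projective_C h Px)) as He.
  pose proof (bicartesian_conf H1 (hull_conf (row x)) H3 H4 B) as K.
  destruct (shift_map_spec u) as (ψ & S1 & S2).
  destruct (conf_coker (f := ψ ∘ φ + - hull_i (row y)) H1) as (ρ & Hρ).
  { expand. rewrite H3, S1. abel. }
  pose proof B as (B1 & B2 & B3 & B4 & B5).
  assert (R : shift_map u ∘ w ≈ hull_p (row y) ∘ ρ).
  { apply (conf_epic H1). rewrite <- !comp_assoc, Hρ, H4. expand.
    rewrite (comp_assoc_pre S2), (conf_zero (hull_conf (row y))). expand. abel. }
  assert (Std : stab_dist (x := exist _ y Hy) (y := exist _ e He)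
                  (z := exist _ _ (hull_cok_in (row x)))
                  (j1 ∘ v + j2 ∘ φ) (w ∘ q1 + - (hull_p (row x) ∘ q2))
                  (- shift_map u)).
  { apply (@stab_dist_conf (exist _ y Hy) (exist _ e He) (exist _ _ (hull_cok_in (row x)))
             _ _ _ (- (ρ ∘ q1) + ψ ∘ q2) K); simpl; expand.
    - crw B1. crw B2. crw B3. crw B4. expand. rewrite Hρ. abel.
    - rewrite (comp_assoc_pre R), (comp_assoc_pre S2). expand. abel. }
  apply (fun T => stab_dist_iso T Std).
  exists (idm (exist _ y Hy : stab C)), q1,
    (idm (exist _ _ (hull_cok_in (row x)) : stab C)).
  assert (Z : j2 ∘ q2 ~ 0) by now apply stable_through.
  split; [apply iso_id|]. split.
  { apply (@stab_iso (exist _ e He) (exist _ z Hz) q1 j1); simpl.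
    - rewrite <- B5, Z, hadd_zero. reflexivity.
    - now rewrite B1. }
  split; [apply iso_id|]. split; [|split]; [apply stable_eq_of_heq| |]; simpl.
  - simpl. expand. crw B1. crw B3. expand. apply hadd_zero.
  - rewrite comp_id_l. rewrite (stable_through q2 (hull_p (row x)) Px).
    rewrite hopp_zero. apply stable_eq_of_heq, hadd_zero.
  - rewrite comp_id_r.
    assert (I : shift_map (idm y) ~ idm (hull_cok (row y)))
      by exact (fmap_id stab_shift (exist _ y Hy)).
    rewrite I. now rewrite comp_id_l.
Qed.

Lemma stab_dist_id (x z : stab C) :
  is_zero_object z -> stab_dist (idm x) (hzero (stab_pre C) x z)
                        (hzero (stab_pre C) z (stab_shift x)).
Proof.
  intros Hz. destruct (zero_ob A) as (o & Ho). pose proof (zero_C h Ho) as HC.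
  assert (K : conf (idm (proj1_sig x)) (hzero P (proj1_sig x) o))
    by now apply conf_iso_zero; [apply iso_id|].
  assert (Std : stab_dist (x := x) (y := x) (z := exist _ o HC)
            (idm (proj1_sig x)) (hzero P (proj1_sig x) o)
            (hzero P o (proj1_sig (stab_shift x)))).
  { apply (@stab_dist_conf x x (exist _ o HC) _ _ _ (hull_i _) K).
    - apply comp_id_r.
    - rewrite comp_zero_l. symmetry. apply (conf_zero (hull_conf _)). }
  apply (fun T => stab_dist_iso T Std).
  exists (idm x), (idm x), (hzero (stab_pre C) (exist _ o HC) z).
  split; [apply iso_id|]. split; [apply iso_id|]. split.
  { exists (hzero (stab_pre C) z (exist _ o HC)). split.
    - apply stable_eq_of_heq. now apply zero_object_maps.
    - now apply zero_object_maps. }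
  split; [|split].
  - reflexivity.
  - rewrite !comp_zero_l. reflexivity.
  - change (shift_map (idm (proj1_sig x)) ∘ hzero P o _
            ~ hzero P (proj1_sig z) _ ∘ hzero P o (proj1_sig z)).
    now rewrite comp_zero_r, comp_zero_l.
Qed.

(** Every map of [C] is stably an admissible monomorphism, into the sum of its
    target with a projective. *)
Lemma mono_replacement (x y : A) (f : hom x y) :
  C x -> C y -> exists (y1 e : A) (u : hom x y1) (v : hom y1 e)
    (r : hom y1 y) (s : hom y y1),
  conf u v /\ C y1 /\ C e /\ r ∘ s ≈ idm y /\ s ∘ r ~ idm y1 /\ r ∘ u ≈ f.
Proof.
  intros Hx Hy.
  pose proof (row_projective Hx) as Px.
  destruct (pushout_conf f (hull_conf (row x))) as (e & i' & k' & p' & [E _] & K & E').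
  destruct (biproduct_exists y (hull (row x))) as (y1 & j1 & j2 & q1 & q2 & B).
  pose proof (cobicartesian_conf (hull_conf (row x)) K E' (symmetry E) B) as L.
  exists y1, e, (j1 ∘ f + - (j2 ∘ hull_i (row x))), (i' ∘ q1 + k' ∘ q2), q1, j1.
  split; [exact L|]. split.
  { exact (C_biproduct h B Hy (projective_C h Px)). }
  split; [exact (C_mid h K Hy (hull_cok_in _))|].
  destruct B as (B1 & B2 & B3 & B4 & B5). split; [exact B1|]. split.
  - rewrite <- B5. rewrite (stable_through q2 j2 Px), hadd_zero. reflexivity.
  - expand. crw B1. crw B3. expand. abel.
Qed.

Lemma stab_dist_cone (x y : stab C) (f : hom x y) :
  exists z (g : hom y z) (k : hom z (stab_shift x)), stab_dist f g k.
Proof.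
  destruct (mono_replacement f (proj2_sig x) (proj2_sig y))
    as (y1 & e & u & v & r & s & K & Hy1 & He & R1 & R2 & R3).
  destruct (connecting K (hull_conf (row (proj1_sig x))) He (hull_in _)) as (φ & w & E1 & E2).
  exists (exist _ e He), (v ∘ s), w.
  apply (fun T => stab_dist_iso T
    (@stab_dist_conf x (exist _ y1 Hy1) (exist _ e He) u v w φ K E1 E2)).
  exists (idm _), r, (idm _).
  split; [apply iso_id|]. split.
  { apply (@stab_iso (exist _ y1 Hy1) y r s); [exact R2|]. now rewrite R1. }
  split; [apply iso_id|]. split; [|split].
  - apply stable_eq_of_heq. simpl. now rewrite comp_id_r.
  - simpl. rewrite comp_id_l, <- comp_assoc, R2. now rewrite comp_id_r.
  - rewrite fmap_id, comp_id_l, comp_id_r. reflexivity.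
Qed.

(** For composable admissible monomorphisms the octahedron is Noether's
    isomorphism; [row_map_unique] identifies the connecting maps. *)
Lemma stab_octahedron_conf (x y z z' x' : stab C)
    (u1 : hom (proj1_sig x) (proj1_sig y)) (v1 : hom (proj1_sig y) (proj1_sig z'))
    (u2 : hom (proj1_sig y) (proj1_sig z)) (v2 : hom (proj1_sig z) (proj1_sig x')) :
  conf u1 v1 -> conf u2 v2 ->
  exists (y' : stab C) (w1 : @hom (stab C) z' (stab_shift x))
    (w2 : @hom (stab C) x' (stab_shift y)) (v3 : @hom (stab C) z y')
    (w3 : @hom (stab C) y' (stab_shift x)),
    stab_dist (u1 : hom x y) (v1 : hom y z') w1 /\
    stab_dist (u2 : hom y z) (v2 : hom z x') w2 /\
    stab_dist (u2 ∘ u1 : @hom (stab C) x z) v3 w3 /\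
    octahedron (@stab_dist) (u1 : hom x y) (v1 : hom y z') w1
      (u2 : hom y z) (v2 : hom z x') w2 v3 w3.
Proof.
  destruct x as [x Hx], y as [y Hy], z as [z Hz], z' as [z' Hz'], x' as [x' Hx'].
  simpl. intros K1 K2.
  destruct (noether K1 K2) as (y' & v3 & a & b & K3 & K4 & E1 & E2).
  pose proof (C_mid h K4 Hz' Hx') as Hy'.
  destruct (connecting K3 (hull_conf (row x)) Hy' (hull_in _)) as (φ3 & w3 & F3 & G3).
  destruct (connecting K2 (hull_conf (row y)) Hx' (hull_in _)) as (φ2 & w2 & F2 & G2).
  destruct (connecting K4 (hull_conf (row z')) Hx' (hull_in _)) as (φ4 & w4 & F4 & G4).
  assert (F1 : φ3 ∘ u2 ∘ u1 ≈ hull_i (row x)) by now rewrite <- comp_assoc.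
  assert (G1 : w3 ∘ a ∘ v1 ≈ hull_p (row x) ∘ (φ3 ∘ u2)).
  { now rewrite <- comp_assoc, E1, (comp_assoc w3 v3 u2), G3, comp_assoc. }
  exists (exist _ y' Hy'), (w3 ∘ a), w2, v3, w3.
  split; [exact (@stab_dist_conf (exist _ x Hx) (exist _ y Hy) (exist _ z' Hz')
                   u1 v1 _ _ K1 F1 G1)|].
  split; [exact (@stab_dist_conf (exist _ y Hy) (exist _ z Hz) (exist _ x' Hx')
                   u2 v2 _ _ K2 F2 G2)|].
  split; [exact (@stab_dist_conf (exist _ x Hx) (exist _ z Hz) (exist _ y' Hy')
                   _ v3 _ _ K3 F3 G3)|].
  exists a, b. split; [|split; [|split; [|split]]].
  - assert (E : w4 ~ shift_map v1 ∘ w2).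
    { destruct (shift_map_spec v1) as (ψ & S1 & S2).
      apply (row_map_unique h (f1 := v1) (f2 := v1) (φ1 := φ4 ∘ v3) (φ2 := ψ ∘ φ2)
               K2 (hull_conf _) Hx' (hull_in _)).
      - reflexivity.
      - now rewrite <- comp_assoc, <- E1, comp_assoc, F4.
      - now rewrite <- E2, comp_assoc, G4, comp_assoc.
      - now rewrite <- comp_assoc, F2.
      - now rewrite <- comp_assoc, G2, comp_assoc, S2, comp_assoc. }
    apply (fun T => stab_dist_iso T
       (@stab_dist_conf (exist _ z' Hz') (exist _ y' Hy') (exist _ x' Hx')
           a b w4 φ4 K4 F4 G4)).
    exists (idm _), (idm _), (idm _). repeat (split; [apply iso_id|]).
    rewrite fmap_id, !comp_id_l, !comp_id_r. split; [reflexivity|].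
    split; [reflexivity|exact E].
  - apply stable_eq_of_heq. exact E1.
  - reflexivity.
  - apply stable_eq_of_heq. exact E2.
  - destruct (shift_map_spec u1) as (ψ & S1 & S2).
    apply (row_map_unique h (f1 := u1) (f2 := u1) (φ1 := φ2) (φ2 := ψ ∘ φ3)
               (g1 := w2 ∘ b) (g2 := shift_map u1 ∘ w3) K3 (hull_conf _) Hy' (hull_in _)).
    + reflexivity.
    + now rewrite comp_assoc, F2.
    + now rewrite <- comp_assoc, E2, G2.
    + now rewrite <- comp_assoc, F3.
    + now rewrite <- comp_assoc, G3, comp_assoc, S2, comp_assoc.
Qed.

Lemma stab_dist_octahedron (x y z x' y' z' : stab C)
    (f : hom x y) (f' : hom y z') (f'' : hom z' (stab_shift x))
    (g : hom y z) (g' : hom z x') (g'' : hom x' (stab_shift y))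
    (k' : hom z y') (k'' : hom y' (stab_shift x)) :
  stab_dist f f' f'' -> stab_dist g g' g'' -> stab_dist (g ∘ f) k' k'' ->
  octahedron (@stab_dist) f f' f'' g g' g'' k' k''.
Proof.
  intros D1 D2 D3.
  destruct (mono_replacement f (proj2_sig x) (proj2_sig y))
    as (y1 & e1 & u1 & v1 & r1 & s1 & K1 & Hy1 & He1 & R1 & R1' & Q1).
  destruct (mono_replacement ((g : @hom A (proj1_sig y) (proj1_sig z)) ∘ r1) Hy1 (proj2_sig z))
    as (z1 & e2 & u2 & v2 & r2 & s2 & K2 & Hz1 & He2 & R2 & R2' & Q2).
  destruct (@stab_octahedron_conf x (exist _ y1 Hy1) (exist _ z1 Hz1)
              (exist _ e1 He1) (exist _ e2 He2) u1 v1 u2 v2 K1 K2)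
    as (y3 & w1 & w2 & v3 & w3 & O1 & O2 & O3 & O).
  refine (octahedron_iso stab_dist_iso stab_dist_fill stab_dist_weak_cokernel
            (a := idm x) (b := s1 : @hom (stab C) y (exist _ y1 Hy1))
            (c := s2 : @hom (stab C) z (exist _ z1 Hz1)) _ _ _ _ _ D1 D2 D3 O1 O2 O3 O).
  - apply iso_id.
  - apply (@stab_iso y (exist _ y1 Hy1) s1 r1); [now rewrite R1|exact R1'].
  - apply (@stab_iso z (exist _ z1 Hz1) s2 r2); [now rewrite R2|exact R2'].
  - change (s1 ∘ (f : @hom A (proj1_sig x) (proj1_sig y)) ~ u1 ∘ idm _).
    rewrite <- Q1, comp_assoc, R1', comp_id_l. now rewrite comp_id_r.
  - change (s2 ∘ (g : @hom A (proj1_sig y) (proj1_sig z)) ~ u2 ∘ s1).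
    assert (G : (g : @hom A (proj1_sig y) (proj1_sig z)) ≈ r2 ∘ u2 ∘ s1).
    { rewrite Q2, <- comp_assoc, R1. now rewrite comp_id_r. }
    rewrite G, !comp_assoc, R2'. now rewrite comp_id_l.
Qed.

Definition stab_triangulation (EP : enough_projectives A) : Triangulation (stab C).
Proof.
  refine {| tpre := stab_pre C; tadditive := stab_additive; shift := stab_shift;
            shift_equivalence := stab_shift_equivalence EP; dist := @stab_dist |}.
  - exact stab_dist_iso.
  - exact stab_dist_id.
  - exact stab_dist_cone.
  - intros x y z f g k. split; [apply stab_dist_rotate|].
    apply (rotate_back stab_dist_iso stab_dist_fill stab_dist_weak_cokernel
             stab_dist_rotate stab_dist_cone stab_shift_ff).
  - intros x y z x' y' z' f g k f' g' k' a b D D'. exact (stab_dist_fill D D' (a := a) (b := b)).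
  - exact stab_dist_octahedron.
Defined.

Lemma stab_triangulation_stable (EP : enough_projectives A) :
  stable_triangulation (stab_triangulation EP).
Proof.
  exists (fun x => hull (row (proj1_sig x))), (fun x => hull_i (row (proj1_sig x))),
    (fun x => hull_p (row (proj1_sig x))).
  split; [|split].
  - intros x. split; [apply hull_conf|]. split; [exact (row_projective (proj2_sig x))|].
    exact (hull_cok_in (row (proj1_sig x))).
  - intros x y f. destruct (shift_map_spec f) as (φ & H1 & H2).
    exists φ, (shift_map f). split; [exact H1|]. split; [exact H2|]. reflexivity.
  - reflexivity.
Qed.

End Frobenius.

(** * Approximation functors *)

Section Approximations.
Context (A : ExactCat) (C W : A -> Prop) (h : projective_cotorsion_pair C W).
Local Notation P := (epre A).
Local Notation "0" := (hzero P _ _).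
Local Infix "+" := (hadd P).
Local Notation "- f" := (hopp P f).
Local Notation cov_of x := (cover (pair_complete h) x).
Local Notation hull_of x := (the_hull (pair_complete h) x).

Section CoverFunctor.
Context (S S' : A -> Prop) (inc : subclass S' S)
  (into : forall x, S x -> S' (cov (cov_of x))) (inC : subclass S' C).

Definition cover_ob (x : stab S) : stab S' :=
  exist _ (cov (cov_of (proj1_sig x))) (into (proj2_sig x)).

Definition cover_eps (x : stab S) : hom (stab_incl inc (cover_ob x)) x :=
  cov_p (cov_of (proj1_sig x)).

(** Covers are coreflections: lifts along them exist, and are stably unique by
    [lift_unique]. *)
Lemma cover_universal (d : stab S') (x : stab S) (f : hom (stab_incl inc d) x) :
  exists_unique_hom (fun g : hom d (cover_ob x) =>
    cover_eps x ∘ fmap (stab_incl inc) g ≈ f).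
Proof.
  destruct (lift_epi h (f : @hom A (proj1_sig d) (proj1_sig x))
    (cov_conf (cov_of (proj1_sig x))) (inC (proj2_sig d)) (cov_ker_in _)) as (g & Hg).
  exists g. split; [now apply stable_eq_of_heq|].
  intros v Hv. apply (lift_unique h (cov_conf (cov_of (proj1_sig x)))
                        (inC (proj2_sig d)) (cov_ker_in _)).
  rewrite Hg. exact Hv.
Qed.

Definition cover_functor : Functor (stab S) (stab S') := right_functor cover_universal.

Lemma cover_functor_adjoint : adjoint (stab_incl inc) cover_functor.
Proof. apply right_functor_adjoint. Qed.

Lemma cover_functor_spec (x y : stab S) (f : hom x y) :
  cover_eps y ∘ fmap (stab_incl inc) (fmap cover_functor f) ≈ f ∘ cover_eps x.
Proof. exact (right_functor_spec cover_universal f). Qed.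

Lemma cover_functor_strict (x y : stab S) (f : @hom A (proj1_sig x) (proj1_sig y)) :
  exists g : hom (cov (cov_of (proj1_sig x))) (cov (cov_of (proj1_sig y))),
    stable_eq (fmap cover_functor (f : hom x y)) g /\
    cov_p (cov_of (proj1_sig y)) ∘ g ≈ f ∘ cov_p (cov_of (proj1_sig x)).
Proof.
  destruct (lift_epi h (f ∘ cov_p (cov_of (proj1_sig x)))
    (cov_conf (cov_of (proj1_sig y))) (cov_in _) (cov_ker_in _)) as (g & Hg).
  exists g. split; [|exact Hg].
  apply (lift_unique h (cov_conf (cov_of (proj1_sig y))) (cov_in _) (cov_ker_in _)).
  rewrite Hg. exact (cover_functor_spec (f : hom x y)).
Qed.
End CoverFunctor.

Lemma hull_of_W (x : A) : W x ->
  exists g, g ∘ hull_i (hull_of x) ~ idm x /\ hull_i (hull_of x) ∘ g ~ idm _.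
Proof.
  intros Hx. destruct (extend h (idm x) (hull_conf (hull_of x)) (hull_cok_in _) Hx)
    as (g & Hg).
  exists g. split; [now rewrite Hg|].
  apply (extend_unique h (hull_conf (hull_of x)) (hull_cok_in _) (hull_in _)).
  now rewrite <- comp_assoc, Hg, comp_id_l, comp_id_r.
Qed.

Section HullFunctor.
Context (S S' : A -> Prop) (inc : subclass S' S)
  (into : forall x, S x -> S' (hull (hull_of x))) (inW : subclass S' W).

Definition hull_ob (x : stab S) : stab S' :=
  exist _ (hull (hull_of (proj1_sig x))) (into (proj2_sig x)).

Definition hull_eta (x : stab S) : hom x (stab_incl inc (hull_ob x)) :=
  hull_i (hull_of (proj1_sig x)).

Lemma hull_universal (x : stab S) (d : stab S') (f : hom x (stab_incl inc d)) :
  exists_unique_hom (fun g : hom (hull_ob x) d =>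
    fmap (stab_incl inc) g ∘ hull_eta x ≈ f).
Proof.
  destruct (extend h (f : @hom A (proj1_sig x) (proj1_sig d))
    (hull_conf (hull_of (proj1_sig x))) (hull_cok_in _) (inW (proj2_sig d))) as (g & Hg).
  exists g. split; [now apply stable_eq_of_heq|].
  intros v Hv. apply (extend_unique h (hull_conf (hull_of (proj1_sig x)))
                        (hull_cok_in _) (inW (proj2_sig d))).
  rewrite Hg. exact Hv.
Qed.

Definition hull_functor : Functor (stab S) (stab S') := left_functor hull_universal.

Lemma hull_functor_adjoint : adjoint hull_functor (stab_incl inc).
Proof. apply left_functor_adjoint. Qed.

Lemma hull_functor_spec (x y : stab S) (f : hom x y) :
  fmap (stab_incl inc) (fmap hull_functor f) ∘ hull_eta x ≈ hull_eta y ∘ f.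
Proof. exact (left_functor_spec hull_universal f). Qed.

Lemma hull_functor_strict (x y : stab S) (f : @hom A (proj1_sig x) (proj1_sig y)) :
  exists g : hom (hull (hull_of (proj1_sig x))) (hull (hull_of (proj1_sig y))),
    stable_eq (fmap hull_functor (f : hom x y)) g /\
    g ∘ hull_i (hull_of (proj1_sig x)) ≈ hull_i (hull_of (proj1_sig y)) ∘ f.
Proof.
  destruct (extend h (hull_i (hull_of (proj1_sig y)) ∘ f)
    (hull_conf (hull_of (proj1_sig x))) (hull_cok_in _) (hull_in _)) as (g & Hg).
  exists g. split; [|exact Hg].
  apply (extend_unique h (hull_conf (hull_of (proj1_sig x))) (hull_cok_in _) (hull_in _)).
  rewrite Hg. exact (hull_functor_spec (f : hom x y)).
Qed.

(** Maps into [W] extend along [r], in a stably unique way. *)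
Lemma hull_functor_inverts (x y : stab S) (r : @hom A (proj1_sig x) (proj1_sig y))
  (c : A) (q : hom (proj1_sig y) c) :
  conf r q -> C c -> is_iso (fmap hull_functor (r : hom x y)).
Proof.
  intros K Hc. destruct (hull_functor_strict (x := x) (y := y) r) as (e & He & E).
  apply (iso_heq (f := e : @hom (stab S') (hull_ob x) (hull_ob y))); [now symmetry|].
  set (hx := hull_of (proj1_sig x)) in *. set (hy := hull_of (proj1_sig y)) in *.
  destruct (extend h (hull_i hx) K Hc (hull_in hx)) as (g0 & Hg0).
  destruct (extend h g0 (hull_conf hy) (hull_cok_in hy) (hull_in hx)) as (g & Hg).
  apply (@stab_iso A S' (hull_ob x) (hull_ob y) e g).
  - change (g ∘ e ~ idm (hull hx)).
    apply (extend_unique h (hull_conf hx) (hull_cok_in hx) (hull_in hx)).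
    rewrite <- comp_assoc, E, comp_assoc, Hg, Hg0. now rewrite comp_id_l.
  - change (e ∘ g ~ idm (hull hy)).
    apply (extend_unique h (hull_conf hy) (hull_cok_in hy) (hull_in hy)).
    apply (extend_unique h K Hc (hull_in hy)).
    rewrite comp_id_l, <- (comp_assoc e g), Hg, <- comp_assoc, Hg0. now rewrite E.
Qed.

Lemma hull_functor_is_E :
  is_E_functor C W (full_sub_incl S) (hull_functor ⊚ stab_quot S).
Proof.
  exists (fun x : full_sub S => hull_i (hull_of (proj1_sig x))). split.
  - intros x. split; [exact (hull_in (hull_of (proj1_sig x)))|].
    eexists _, _. split; [apply hull_conf|apply hull_cok_in].
  - intros x y f. apply (hull_functor_strict (x := x) (y := y)).
Qed.
End HullFunctor.

(** * The homotopy category of a projective cotorsion pair *)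

Local Notation M := (projective_triple C W).
Local Notation γ := (gamma M).

Definition to_stab : Functor A (stab (@allc A)).
Proof.
  refine {| fob := fun x : A => exist _ x I : stab (@allc A);
            fmap := fun x y f => f : @hom (stab (@allc A)) (exist _ x I) (exist _ y I) |};
    try reflexivity.
  intros x y f g H. now apply stable_eq_of_heq.
Defined.

Lemma into_all (S : A -> Prop) : subclass S (@allc A).
Proof. intros x _. exact I. Qed.

Definition cofibrant_functor : Functor (stab (@allc A)) (stab C) :=
  cover_functor (into_all (S := C)) (fun x _ => cov_in (cov_of x)) (fun x Hx => Hx).

Definition replacement : Functor A (stab C) := cofibrant_functor ⊚ to_stab.

Lemma replacement_strict (x y : A) (f : hom x y) :
  exists g : hom (cov (cov_of x)) (cov (cov_of y)),
    stable_eq (fmap replacement f) g /\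
    cov_p (cov_of y) ∘ g ≈ f ∘ cov_p (cov_of x).
Proof. exact (cover_functor_strict _ _ _ (x := exist _ x I) (y := exist _ y I) f). Qed.

Lemma replacement_spec (x y : A) (f : hom x y) :
  cov_p (cov_of y) ∘ fmap replacement f ~ f ∘ cov_p (cov_of x).
Proof.
  destruct (replacement_strict f) as (g & H1 & H2). rewrite <- H2.
  apply stable_comp_proper; [reflexivity|exact H1].
Qed.

Lemma trivial_fibration_we (x y z : A) (k : hom x y) (p : hom y z) :
  conf k p -> W x -> weak_equivalence M p.
Proof.
  intros H Hx. exists y, (idm y), p. split; [|split].
  - destruct (zero_ob A) as (o & Ho). exists o, 0. split.
    + apply conf_iso_zero; [apply iso_id|exact Ho].
    + split; [exact (zero_C h Ho)|exact (zero_W h Ho)].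
  - exists x, k. split; [exact H|]. split; [exact I|exact Hx].
  - now rewrite comp_id_r.
Qed.

(** The cokernel [z] lies in [W] but perhaps not in [C]. Its cover [Q] is
    projective, and [i] factors through the sum of [x] and [Q]. *)
Lemma mono_we (x y z : A) (i : hom x y) (q : hom y z) :
  conf i q -> W z -> weak_equivalence M i.
Proof.
  intros H Hz. destruct (cov_of z) as [Q k ki kp K HQ Hk].
  destruct (CW_projective h HQ (W_mid h K Hk Hz) H kp) as (g & Hg).
  destruct (conf_ker (f := g ∘ ki) H) as (m & Hm).
  { rewrite comp_assoc, Hg. exact (conf_zero K). }
  destruct (biproduct_exists x Q) as (s & j1 & j2 & q1 & q2 & B).
  pose proof (cobicartesian_conf K H Hg Hm B) as L.
  exists s, j1, (i ∘ q1 + g ∘ q2). split; [|split].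
  - exists Q, q2. split; [exact (biproduct_conf B)|]. split; [exact HQ|].
    exact (W_mid h K Hk Hz).
  - exists k, (j1 ∘ m + - (j2 ∘ ki)). split; [exact L|]. split; [exact I|exact Hk].
  - destruct B as (B1 & B2 & B3 & B4 & _). expand. crw B1. crw B4. expand.
    symmetry. apply hadd_zero.
Qed.

Lemma gamma_iso (x y : A) (f : hom x y) : weak_equivalence M f -> is_iso (fmap γ f).
Proof. apply loc_functor_inverts. Qed.

Lemma gamma_proper (x y : A) (f g : hom x y) : f ~ g -> fmap γ f ≈ fmap γ g.
Proof. exact (gamma_stable (proj2 (proj2 h)) (f := f) (g := g)). Qed.

(** The trivial cofibrations of [M] are split, with projective cokernel, and so
    are sections of trivial fibrations. *)
Lemma inverts_of_epis (D : Cat) (F : Functor A D) :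
  (forall x y z (k : hom x y) (p : hom y z), conf k p -> W x -> is_iso (fmap F p)) ->
  inverts (weak_equivalence M) F.
Proof.
  intros HF x y f (t & i & p & (q & r & K & Hq1 & Hq2) & (k & l & L & _ & Hk) & E).
  apply (iso_heq (f := fmap F p ∘ fmap F i)); [now rewrite <- fmap_comp, E|].
  apply iso_comp; [exact (HF _ _ _ _ _ L Hk)|].
  destruct (CW_projective h Hq1 Hq2 K (idm q)) as (s & Hs).
  destruct (conf_split_epi K Hs) as (m & B).
  apply (iso_cancel_l (g := fmap F m)).
  - exact (HF _ _ _ _ _ (biproduct_conf (biproduct_swap B)) Hq2).
  - apply (iso_heq (f := idm _)); [|apply iso_id].
    rewrite <- fmap_comp. destruct B as (B1 & _). now rewrite B1, fmap_id.
Qed.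

(** A cover of [x] followed by a trivial fibration [x ->> y] has the lifting
    properties of a cover of [y]. *)
Lemma replacement_inverts : inverts (weak_equivalence M) replacement.
Proof.
  apply inverts_of_epis. intros k x y i p H Hk.
  destruct (lift_epi h (cov_p (cov_of y)) H (cov_in _) Hk) as (g0 & Hg0).
  destruct (lift_epi h g0 (cov_conf (cov_of x)) (cov_in (cov_of y)) (cov_ker_in _))
    as (g & Hg).
  destruct (replacement_strict p) as (c & Hc & E).
  apply (iso_heq (f := c : @hom (stab C) (replacement x) (replacement y))); [now symmetry|].
  apply (@stab_iso _ _ (replacement x) (replacement y) c g); simpl.
  - apply (lift_unique h (cov_conf (cov_of x)) (cov_in _) (cov_ker_in _)).
    apply (lift_unique h H (cov_in _) Hk).
    rewrite comp_id_r, (comp_assoc (cov_p _) g c), Hg, comp_assoc, Hg0. now rewrite E.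
  - apply (lift_unique h (cov_conf (cov_of y)) (cov_in _) (cov_ker_in _)).
    rewrite comp_assoc, E, <- comp_assoc, Hg, Hg0. now rewrite comp_id_r.
Qed.

Definition Ho_to_stab : Functor (Ho M) (stab C) := lift replacement_inverts.

Lemma Ho_to_stab_gamma (x y : A) (f : hom x y) :
  fmap Ho_to_stab (fmap γ f) ≈ fmap replacement f.
Proof. exact (lift_gamma replacement_inverts f). Qed.

Lemma stab_to_Ho_map (S : A -> Prop) (x y : stab S) (f : hom x y) :
  fmap (stab_to_Ho S h) f ≈ fmap γ (f : @hom A (proj1_sig x) (proj1_sig y)).
Proof. reflexivity. Qed.

Local Notation F := Ho_to_stab.
Local Notation G := (stab_to_Ho C h).

Definition Ho_eps (x : Ho M) : hom (gamma M (cov (cov_of x))) x :=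
  fmap γ (cov_p (cov_of x)).

Lemma cover_we (x : A) : weak_equivalence M (cov_p (cov_of x)).
Proof. exact (trivial_fibration_we (cov_conf _) (cov_ker_in _)). Qed.

Lemma Ho_eps_iso (x : Ho M) : is_iso (Ho_eps x).
Proof. apply gamma_iso, cover_we. Qed.

Lemma Ho_eps_natural (x y : Ho M) (f : hom x y) :
  Ho_eps y ∘ fmap G (fmap F f) ≈ f ∘ Ho_eps x.
Proof.
  apply (loc_natural (K := G ⊚ F) (L := functor_id _) (t := Ho_eps)).
  intros a b g. change (fmap γ (cov_p (cov_of b)) ∘ fmap γ (fmap replacement g : @hom A _ _)
                         ≈ fmap γ g ∘ fmap γ (cov_p (cov_of a))).
  rewrite <- !fmap_comp. apply gamma_proper. apply replacement_spec.
Qed.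

Lemma cover_iso_in_C (x : stab C) :
  is_iso (cov_p (cov_of (proj1_sig x)) : @hom (stab C) (exist _ _ (cov_in _)) x).
Proof.
  destruct (lift_epi h (idm (proj1_sig x)) (cov_conf (cov_of (proj1_sig x)))
              (proj2_sig x) (cov_ker_in _)) as (g & Hg).
  apply (@stab_iso A C (exist _ _ (cov_in (cov_of (proj1_sig x)))) x _ g).
  - apply (lift_unique h (cov_conf (cov_of (proj1_sig x))) (cov_in _) (cov_ker_in _)).
    rewrite comp_assoc, Hg, comp_id_l. now rewrite comp_id_r.
  - now apply stable_eq_of_heq.
Qed.

Lemma Ho_stab_Ho : naturally_isomorphic (G ⊚ F) (functor_id (Ho M)).
Proof.
  apply (nat_iso_intro (F := G ⊚ F) (G := functor_id _) (t := Ho_eps)).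
  - exact Ho_eps_iso.
  - exact Ho_eps_natural.
Qed.

Lemma stab_eps_natural (x y : stab C) (f : hom x y) :
  (cov_p (cov_of (proj1_sig y)) : @hom (stab C) (F (G y)) y) ∘ fmap F (fmap G f)
  ≈ f ∘ (cov_p (cov_of (proj1_sig x)) : @hom (stab C) (F (G x)) x).
Proof. exact (replacement_spec (f : @hom A (proj1_sig x) (proj1_sig y))). Qed.

Lemma stab_Ho_stab : naturally_isomorphic (F ⊚ G) (functor_id (stab C)).
Proof.
  apply (nat_iso_intro (F := F ⊚ G) (G := functor_id (stab C))
    (t := fun x => cov_p (cov_of (proj1_sig x)) : @hom (stab C) (F (G x)) x)).
  - exact cover_iso_in_C.
  - exact stab_eps_natural.
Qed.

Lemma stab_to_Ho_equivalence : is_equivalence G.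
Proof. exists F. split; [exact stab_Ho_stab|exact Ho_stab_Ho]. Qed.

Lemma Ho_to_stab_equivalence : is_equivalence F.
Proof. exists G. split; [exact Ho_stab_Ho|exact stab_Ho_stab]. Qed.

Lemma Ho_to_stab_ff : fully_faithful F.
Proof. exact (equivalence_ff Ho_stab_Ho stab_Ho_stab). Qed.

(** Source and cover of the target both lie in [C], where the homotopy category
    is the stable one. *)
Lemma Ho_faithful (c y : A) (f g : hom c y) :
  C c -> fmap γ f ≈ fmap γ g -> f ~ g.
Proof.
  intros Hc E.
  destruct (lift_epi h f (cov_conf (cov_of y)) Hc (cov_ker_in _)) as (f' & Hf).
  destruct (lift_epi h g (cov_conf (cov_of y)) Hc (cov_ker_in _)) as (g' & Hg).
  rewrite <- Hf, <- Hg. apply stable_comp_proper; [reflexivity|].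
  destruct (equivalence_ff stab_Ho_stab Ho_stab_Ho) as [Fa _].
  apply (Fa (exist _ c Hc) (exist _ _ (cov_in (cov_of y))) f' g').
  apply (iso_mono (Ho_eps_iso y)).
  change (fmap γ (cov_p (cov_of y)) ∘ fmap γ f' ≈ fmap γ (cov_p (cov_of y)) ∘ fmap γ g').
  now rewrite <- !fmap_comp, Hf, Hg.
Qed.

Lemma Ho_full (c y : A) (f : hom (γ c) (γ y)) :
  C c -> exists g : hom c y, fmap γ g ≈ f.
Proof.
  intros Hc. destruct (equivalence_ff stab_Ho_stab Ho_stab_Ho) as [_ Fu].
  destruct (Fu (exist _ c Hc) (exist _ _ (cov_in (cov_of y)))
               (inv_of (Ho_eps_iso y) ∘ f)) as (g & Hg).
  exists (cov_p (cov_of y) ∘ g). rewrite fmap_comp.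
  change (Ho_eps y ∘ fmap G (g : @hom (stab C) (exist _ c Hc) (exist _ _ (cov_in (cov_of y)))) ≈ f).
  rewrite Hg, comp_assoc, inv_of_r. apply comp_id_l.
Qed.

Lemma Ho_zero (x : stab C) : is_zero_object (G x) -> is_projective (proj1_sig x).
Proof.
  intros [H _]. destruct (H (G x)) as (z & Hz).
  apply stable_id_projective. apply (Ho_faithful (proj2_sig x)).
  now rewrite (Hz (fmap γ _)), (Hz (fmap γ (hzero _ _ _))).
Qed.

Lemma gamma_zero (o : A) : is_zero_object o -> is_zero_object (γ o).
Proof.
  intros Hz.
  assert (E : forall (z : A) (g : hom (γ o) (γ z)), g ≈ fmap γ 0).
  { intros z g. destruct (Ho_full g (zero_C h Hz)) as (f & Hf).
    rewrite <- Hf. apply gamma_proper, stable_eq_of_heq. now apply zero_object_maps. }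
  split; intros z; exists (fmap γ 0); intros g; [apply E|].
  apply (iso_epi (Ho_eps_iso z)).
  destruct (Ho_full (g ∘ Ho_eps z) (cov_in (cov_of z))) as (f & Hf).
  rewrite <- Hf. change (fmap γ f ≈ fmap γ 0 ∘ fmap γ (cov_p (cov_of z))).
  rewrite <- fmap_comp. apply gamma_proper, stable_eq_of_heq.
  now apply zero_object_comaps.
Qed.

End Approximations.

(** * Three projective cotorsion pairs *)

Lemma left_class_antitone (A : ExactCat) (C W C' W' : A -> Prop) :
  cotorsion_pair C W -> cotorsion_pair C' W' -> subclass C' C -> subclass W W'.
Proof.
  intros h h' H w Hw. apply (proj2 h' w). intros c Hc. apply (proj2 h w); auto.
Qed.

Lemma W_stable_retract (A : ExactCat) (C W : A -> Prop)
  (h : projective_cotorsion_pair C W) (x c : A) (f : hom x c) (g : hom c x) :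
  g ∘ f ~ idm x -> W c -> W x.
Proof.
  intros E Hc. destruct (stable_retract E) as (Q & s & i & j & p & q & HQ & B & R).
  apply (W_retract h R). apply (W_mid h (biproduct_conf B) Hc).
  now apply (projective_W h).
Qed.

(** An object of [W2] and [W3] has its [C1]-cover in [W3] and [C1], so in [C2],
    so projective. Conversely the [C2]-cover of an object of [W3] and [C1] has
    its kernel in [W2] and [W3], so in [W1], and splits. *)
Lemma orthogonality_conditions (A : ExactCat) (C1 W1 C2 W2 C3 W3 : A -> Prop)
  (h1 : projective_cotorsion_pair C1 W1) (h2 : projective_cotorsion_pair C2 W2)
  (h3 : projective_cotorsion_pair C3 W3) (h21 : subclass C2 C1) (h31 : subclass C3 C1) :
  same_class (capc W3 C1) C2 <-> same_class (capc W2 W3) W1 /\ subclass C2 W3.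
Proof.
  pose proof (left_class_antitone (pair_cotorsion h1) (pair_cotorsion h2) h21) as W12.
  pose proof (left_class_antitone (pair_cotorsion h1) (pair_cotorsion h3) h31) as W13.
  split.
  - intros H. assert (C23 : subclass C2 W3) by (intros x Hx; now apply (proj2 (H x))).
    split; [|exact C23]. intros x. split; [|intros Hx; split; auto].
    intros [Hx2 Hx3]. destruct (cover (pair_complete h1) x) as [q k i p K Hq Hk].
    apply (W_cok h1 K Hk). apply (projective_W h1).
    apply (CW_projective h2).
    + apply H. split; [|exact Hq]. exact (W_mid h3 K (W13 _ Hk) Hx3).
    + exact (W_mid h2 K (W12 _ Hk) Hx2).
  - intros [H C23] x. split; [|intros Hx; split; auto].
    intros [Hx3 Hx1]. destruct (cover (pair_complete h2) x) as [q k i p K Hq Hk].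
    assert (Hk1 : W1 k).
    { apply H. split; [exact Hk|]. exact (W_ker h3 K (C23 _ Hq) Hx3). }
    destruct (lift_epi h1 (idm x) K Hx1 Hk1) as (s & Hs).
    apply (C_retract h2 (y := q)); [|exact Hq]. now exists s, p.
Qed.

Section Recollement.
Context (A : ExactCat) (C1 W1 C2 W2 C3 W3 : A -> Prop)
  (h1 : projective_cotorsion_pair C1 W1) (h2 : projective_cotorsion_pair C2 W2)
  (h3 : projective_cotorsion_pair C3 W3) (h21 : subclass C2 C1) (h31 : subclass C3 C1)
  (H : same_class (capc W3 C1) C2).
Local Notation P := (epre A).
Local Notation "0" := (hzero P _ _).
Local Infix "+" := (hadd P).
Local Notation "- f" := (hopp P f).
Local Notation M3 := (projective_triple C3 W3).
Local Notation γ3 := (gamma M3).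

Local Notation cov1 x := (cover (pair_complete h1) x).
Local Notation cov2 x := (cover (pair_complete h2) x).
Local Notation cov3 x := (cover (pair_complete h3) x).
Local Notation hull2 x := (the_hull (pair_complete h2) x).
Local Notation hull3 x := (the_hull (pair_complete h3) x).

Lemma W1_W2 : subclass W1 W2.
Proof. exact (left_class_antitone (pair_cotorsion h1) (pair_cotorsion h2) h21). Qed.
Lemma W1_W3 : subclass W1 W3.
Proof. exact (left_class_antitone (pair_cotorsion h1) (pair_cotorsion h3) h31). Qed.
Lemma C2_W3 : subclass C2 W3.
Proof. intros x Hx. now apply (proj2 (H x)). Qed.

Lemma hull3_C2 (x : A) : C1 x -> C2 (hull (hull3 x)).
Proof.
  intros Hx. apply H. split; [apply hull_in|].
  exact (C_mid h1 (hull_conf _) Hx (h31 (hull_cok_in _))).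
Qed.

Lemma hull2_C1 (x : A) :
  C1 x -> capc W2 C1 (hull (hull2 x)).
Proof.
  intros Hx. split; [apply hull_in|].
  exact (C_mid h1 (hull_conf _) Hx (h21 (hull_cok_in _))).
Qed.

Lemma W2_part (x : A) : capc W2 C1 x -> W2 x.
Proof. now intros [Hx _]. Qed.

Definition EM3 : Functor (stab C1) (stab C2) := hull_functor h21 hull3_C2 C2_W3.
Definition CM2 : Functor (stab C1) (stab C2) :=
  cover_functor h21 (fun x _ => cov_in (cov2 x)) (fun x Hx => Hx).
Definition EM2 : Functor (stab C1) (stab (capc W2 C1)) :=
  hull_functor (@capc_r A W2 C1) hull2_C1 W2_part.
Definition CM1 : Functor A (stab C1) := replacement h1.

Local Notation I := (stab_incl h21).
Local Notation Q := (stab_to_Ho C1 h3).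
Local Notation j3 := (stab_incl h31).
Local Notation j21 := (stab_incl (@capc_r A W2 C1)).
Local Notation F3 := (Ho_to_stab h3).

Definition lambda : Functor (Ho M3) (stab C1) := j3 ⊚ F3.
Definition rho : Functor (Ho M3) (stab C1) := j21 ⊚ (EM2 ⊚ lambda).

Lemma EM3_natural (x y : stab C1) (f : hom x y) :
  (fmap EM3 f : hom (hull (hull3 (proj1_sig x)))
                    (hull (hull3 (proj1_sig y))))
    ∘ hull_i (hull3 (proj1_sig x))
  ~ hull_i (hull3 (proj1_sig y)) ∘ f.
Proof. exact (hull_functor_spec h21 hull3_C2 C2_W3 f). Qed.

Lemma CM2_is_C : is_C_functor C2 W2 (full_sub_incl C1) (CM2 ⊚ stab_quot C1).
Proof.
  exists (fun x : full_sub C1 => cov_p (cov2 (proj1_sig x))). split.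
  - intros x. split; [exact (cov_in (cov2 (proj1_sig x)))|].
    eexists _, _. split; [apply cov_conf|apply cov_ker_in].
  - intros x y f.
    destruct (cover_functor_strict h21 (fun x _ => cov_in (cov2 x))
                (fun x Hx => Hx) f) as (g & G1 & G2).
    exists g. split; [exact G1|exact G2].
Qed.

Lemma lambda_is_C : is_C_functor C3 W3 (functor_id A) (lambda ⊚ γ3).
Proof.
  exists (fun x : A => cov_p (cov3 x)). split.
  - intros x. split; [exact (cov_in (cov3 x))|].
    eexists _, _. split; [apply cov_conf|apply cov_ker_in].
  - intros x y f. destruct (replacement_strict h3 f) as (g & G1 & G2).
    exists g. split; [exact G1|exact G2].
Qed.

Lemma CM1_is_C : is_C_functor C1 W1 (functor_id A) CM1.
Proof.
  exists (fun x : A => cov_p (cov1 x)). split.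
  - intros x. split; [exact (cov_in (cov1 x))|].
    eexists _, _. split; [apply cov_conf|apply cov_ker_in].
  - intros x y f. destruct (replacement_strict h1 f) as (g & G1 & G2).
    exists g. split; [exact G1|exact G2].
Qed.

(** A map [b -> e] is null on [k], so a stably equal one descends to [z]; the
    ambiguity is a map from the shift of [k], which is in [C2], to [e], hence
    null. *)
Section QuotientByC2.
Context (k b z e : A) (u : hom k b) (v : hom b z) (K : conf u v)
  (Hk : C2 k) (Hz : C1 z) (He : W2 e).

Lemma descend_along_C2 (f : hom b e) : exists g, g ∘ v ~ f.
Proof.
  pose proof (C_to_W_null h2 (f ∘ u) Hk He) as E.
  apply (proj1 (stable_zero _)) in E. destruct E as (R & a & c & HR & E).
  destruct (extend h1 a K Hz (projective_W h1 HR)) as (a' & Ha).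
  destruct (conf_coker (f := f + - (c ∘ a')) K) as (g & Hg).
  { expand. rewrite E, Ha. apply hadd_opp. }
  exists g. rewrite Hg. rewrite (stable_through a' c HR), hopp_zero, hadd_zero.
  reflexivity.
Qed.

Lemma descend_along_C2_unique (f g : hom z e) : f ∘ v ~ g ∘ v -> f ~ g.
Proof.
  intros E. apply (proj2 (stable_sub _ _)).
  destruct (hull2 k) as [t s i p L Ht Hs].
  pose proof (syzygy_hull_projective h2 L Hk Ht Hs) as Pt.
  destruct (connecting h1 K L Hz (projective_W h1 Pt)) as (φ & w & F1 & F2).
  destruct (conf_weak_cokernel h1 (k := f + - g) K L Hz (h21 Hs) F1 F2) as (m & Hm).
  { expand. rewrite E. apply stable_eq_of_heq, hadd_opp. }
  rewrite Hm, (C_to_W_null h2 m Hs He), comp_zero_l. reflexivity.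
Qed.
End QuotientByC2.

Lemma cover3_kernel (x : A) : C1 x -> C2 (cov_ker (cov3 x)).
Proof.
  intros Hx. apply H. split; [apply cov_ker_in|].
  exact (C_ker h1 (cov_conf _) (h31 (cov_in _)) Hx).
Qed.

(** Maps in the homotopy category out of [y] are stable maps out of its
    [C3]-cover, and these descend to [y] because the kernel of the cover is in
    [C2]. *)
Lemma Q_faithful_into (y e : A) (f g : hom y e) :
  C1 y -> W2 e -> fmap γ3 f ≈ fmap γ3 g -> f ~ g.
Proof.
  intros Hy He E.
  apply (descend_along_C2_unique (cov_conf (cov3 y))
           (cover3_kernel Hy) Hy He).
  apply (Ho_faithful h3 (cov_in _)). now rewrite !fmap_comp, E.
Qed.

Lemma Q_full_into (y e : A) (f : hom (γ3 y) (γ3 e)) :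
  C1 y -> W2 e -> exists g : hom y e, fmap γ3 g ≈ f.
Proof.
  intros Hy He.
  destruct (Ho_full h3 (f ∘ Ho_eps h3 y) (cov_in (cov3 y)))
    as (g0 & Hg0).
  destruct (descend_along_C2 (cov_conf (cov3 y))
           (cover3_kernel Hy) Hy He g0) as (g & Hg).
  exists g. apply (iso_epi (Ho_eps_iso h3 y)). rewrite <- Hg0.
  change (fmap γ3 g ∘ fmap γ3 (cov_p (cov3 y)) ≈ fmap γ3 g0).
  rewrite <- fmap_comp. now apply (gamma_proper h3).
Qed.

Lemma QJ_ff : fully_faithful (Q ⊚ j21).
Proof.
  split.
  - intros [x [Hx2 Hx1]] [y [Hy2 Hy1]] f g E. exact (Q_faithful_into Hx1 Hy2 E).
  - intros [x [Hx2 Hx1]] [y [Hy2 Hy1]] f. exact (Q_full_into f Hx1 Hy2).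
Qed.

Lemma Q_after_j3 (D : Cat) (K : Functor D (stab C3)) (x y : D) (f : hom x y) :
  fmap Q (fmap (j3 ⊚ K) f) ≈ fmap (stab_to_Ho C3 h3) (fmap K f).
Proof. reflexivity. Qed.

Lemma Q_lambda_natural (x y : Ho M3) (f : hom x y) :
  Ho_eps h3 y ∘ fmap Q (fmap lambda f) ≈ f ∘ Ho_eps h3 x.
Proof.
  etransitivity; [|exact (Ho_eps_natural h3 f)].
  apply comp_proper; [reflexivity|]. exact (Q_after_j3 F3 f).
Qed.

Lemma lambda_adjoint : adjoint lambda Q.
Proof.
  apply (left_adjoint_of_section (Q := Q) (L := lambda) (Ho_eps_iso h3) Q_lambda_natural).
  - intros x y f g E. exact (Ho_faithful h3 (cov_in (cov3 x)) E).
  - intros x y g. exact (Ho_full h3 g (cov_in (cov3 x))).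
Qed.

Lemma lambda_ff : fully_faithful lambda.
Proof.
  apply (section_ff (Q := Q) (L := lambda) (Ho_eps_iso h3) Q_lambda_natural).
  intros x y f g E. exact (Ho_faithful h3 (cov_in (cov3 x)) E).
Qed.

Definition EM2_unit (x : stab C1) : hom x (j21 (EM2 x)) :=
  hull_i (hull2 (proj1_sig x)).

(** The cokernel is in [C2], hence in [W3]. *)
Lemma EM2_unit_iso (x : stab C1) : is_iso (fmap Q (EM2_unit x)).
Proof.
  apply (gamma_iso (C := C3) (W := W3)). apply (mono_we h3 (hull_conf _)).
  apply C2_W3, hull_cok_in.
Qed.

Lemma EM2_unit_natural (x y : stab C1) (f : hom x y) :
  fmap j21 (fmap EM2 f) ∘ EM2_unit x ≈ EM2_unit y ∘ f.
Proof. apply hull_functor_spec. Qed.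

(** [Q] does not distinguish an object from its hull in [W2], and it is fully
    faithful between such hulls. *)
Lemma EM2_inverts (x y : stab C1) (f : hom x y) :
  is_iso (fmap Q f) -> is_iso (fmap EM2 f).
Proof.
  intros Hf. apply (ff_reflects_iso QJ_ff).
  change (is_iso (fmap Q (fmap j21 (fmap EM2 f)))).
  apply (iso_cancel_r (f := fmap Q (EM2_unit x))); [apply EM2_unit_iso|].
  apply (iso_heq (f := fmap Q (EM2_unit y) ∘ fmap Q f)).
  - rewrite <- !fmap_comp. now rewrite EM2_unit_natural.
  - apply iso_comp; [apply EM2_unit_iso|exact Hf].
Qed.

Definition rho_counit (x : Ho M3) : hom (Q (rho x)) x :=
  Ho_eps h3 x ∘ inv_of (EM2_unit_iso (lambda x)).

Lemma rho_counit_iso (x : Ho M3) : is_iso (rho_counit x).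
Proof.
  apply iso_comp; [apply Ho_eps_iso|]. exact (iso_inv (inv_of_l _) (inv_of_r _)).
Qed.

Lemma rho_counit_natural (x y : Ho M3) (f : hom x y) :
  rho_counit y ∘ fmap Q (fmap rho f) ≈ f ∘ rho_counit x.
Proof.
  unfold rho_counit. apply (iso_epi (EM2_unit_iso (lambda x))).
  pose proof (Q_lambda_natural f) as N1.
  assert (N2 : fmap Q (fmap rho f) ∘ fmap Q (EM2_unit (lambda x))
               ≈ fmap Q (EM2_unit (lambda y)) ∘ fmap Q (fmap lambda f)).
  { rewrite <- !fmap_comp. apply fmap_proper. exact (EM2_unit_natural (fmap lambda f)). }
  rewrite <- !comp_assoc, N2, inv_of_l, comp_id_r.
  rewrite (comp_assoc (inv_of _)), inv_of_l, comp_id_l. exact N1.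
Qed.

Lemma rho_adjoint : adjoint Q rho.
Proof.
  apply (right_adjoint_of_section (Q := Q) (L := rho) rho_counit_iso rho_counit_natural).
  - intros x y f g E. exact (Q_faithful_into (proj2_sig y) (hull_in _) E).
  - intros x y g. exact (Q_full_into g (proj2_sig y) (hull_in _)).
Qed.

Lemma rho_ff : fully_faithful rho.
Proof.
  apply (section_ff (Q := Q) (L := rho) rho_counit_iso rho_counit_natural).
  intros x y f g E. exact (Q_faithful_into (proj2_sig (rho x)) (hull_in _) E).
Qed.

Lemma compare_covers (x : A) :
  exists m : hom (cov (cov3 x)) (cov (cov1 x)),
    cov_p (cov1 x) ∘ m ≈ cov_p (cov3 x).
Proof.
  exact (lift_epi h1 _ (cov_conf _) (h31 (cov_in (cov3 x)))
           (cov_ker_in _)).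
Qed.

(** The covers of [x] for the first and the third pair are compared by a map
    that [Q] inverts. *)
Lemma rho_gamma : naturally_isomorphic (rho ⊚ γ3) (j21 ⊚ (EM2 ⊚ CM1)).
Proof.
  set (m := fun x => proj1_sig (chosen (compare_covers x))
             : @hom (stab C1) (lambda (γ3 x)) (CM1 x)).
  assert (Hm : forall x, cov_p (cov1 x) ∘ (m x : @hom A _ _)
                         ≈ cov_p (cov3 x))
    by (intros x; exact (proj2_sig (chosen (compare_covers x)))).
  assert (Nm : forall x y (f : hom x y),
             m y ∘ fmap lambda (fmap γ3 f) ≈ fmap CM1 f ∘ m x).
  { intros x y f.
    apply (lift_unique h1 (cov_conf (cov1 y))
             (h31 (cov_in (cov3 x))) (cov_ker_in _)).
    change (cov_p (cov1 y) ∘ ((m y : @hom A _ _) ∘ fmap (replacement h3) f)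
          ~ cov_p (cov1 y) ∘
             ((fmap (replacement h1) f : @hom A _ _) ∘ (m x : @hom A _ _))).
    rewrite !comp_assoc, Hm.
    rewrite (replacement_spec h1 f), (replacement_spec h3 f).
    now rewrite <- comp_assoc, Hm. }
  apply (nat_iso_intro (F := rho ⊚ γ3) (G := j21 ⊚ (EM2 ⊚ CM1))
           (t := fun x => fmap j21 (fmap EM2 (m x)))).
  - intros x. apply (fmap_iso j21). apply EM2_inverts.
    apply (iso_cancel_l (g := fmap γ3 (cov_p (cov1 x)))).
    + apply (gamma_iso (C := C3) (W := W3)). apply (trivial_fibration_we h3 (cov_conf _)).
      apply W1_W3, cov_ker_in.
    + change (is_iso (fmap γ3 (cov_p (cov1 x)) ∘ fmap γ3 (m x : @hom A _ _))).
      apply (iso_heq (f := Ho_eps h3 x)); [|apply Ho_eps_iso].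
      now rewrite <- fmap_comp, Hm.
  - intros x y f.
    change (fmap j21 (fmap EM2 (m y)) ∘ fmap j21 (fmap EM2 (fmap lambda (fmap γ3 f)))
            ≈ fmap j21 (fmap EM2 (fmap CM1 f)) ∘ fmap j21 (fmap EM2 (m x))).
    rewrite <- !fmap_comp. now rewrite Nm.
Qed.

Lemma lambda_image (x : stab C1) : in_essential_image lambda x <-> C3 (proj1_sig x).
Proof.
  split.
  - intros (y & f & g & H1 & H2).
    exact (C_stable_retract h3 H2 (cov_in (cov3 y))).
  - intros Hx. exists (proj1_sig x).
    exists (cov_p (cov3 (proj1_sig x))).
    destruct (cover_iso_in_C h3 (exist _ _ Hx)) as (g & Hg). exists g. exact Hg.
Qed.

(** An object [x] of [W2] and [ρ (Q x)] have isomorphic images under [Q], which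
    is fully faithful on such objects. *)
Lemma rho_image (x : stab C1) : in_essential_image rho x <-> W2 (proj1_sig x).
Proof.
  split.
  - intros (y & f & g & H1 & H2).
    exact (W_stable_retract h2 H2 (hull_in (hull2 _))).
  - intros Hx. exists (Q x).
    set (x' := exist _ (proj1_sig x) (conj Hx (proj2_sig x)) : stab (capc W2 C1)).
    destruct QJ_ff as [_ Fu].
    destruct (Fu (EM2 (lambda (Q x))) x' (rho_counit (Q x))) as (f & Hf).
    assert (Hi : is_iso f).
    { apply (ff_reflects_iso QJ_ff). apply (iso_heq (symmetry Hf)), rho_counit_iso. }
    destruct Hi as (g & Hg). exists f, g. exact Hg.
Qed.

(** If [Q] kills [x], then the [C3]-cover of [x] is projective, so [x] is in
    [W3]. *)
Lemma Q_zero (x : stab C1) : in_essential_image I x <-> is_zero_object (Q x).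
Proof.
  split.
  - intros (y & Hy). apply (zero_object_iso (x := Q (I y))).
    { destruct Hy as (f & Hf). exists (fmap Q f). now apply fmap_iso. }
    destruct (zero_ob A) as (o & Ozero).
    apply (zero_object_iso (x := γ3 o)).
    + exists (fmap γ3 (hzero P o (proj1_sig y))). apply (gamma_iso (C := C3) (W := W3)).
      apply (mono_we h3 (zero_conf_iso (iso_id _) Ozero)). apply C2_W3. exact (proj2_sig y).
    + exact (gamma_zero h3 Ozero).
  - intros Hx.
    assert (Hw : W3 (proj1_sig x)).
    { apply (W_cok h3 (cov_conf (cov3 (proj1_sig x))) (cov_ker_in _)).
      apply (projective_W h3).
      apply (Ho_zero (h := h3) (x := exist _ _ (cov_in (cov3 (proj1_sig x))))).
      apply (fun K => zero_object_iso K Hx). apply isomorphic_sym.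
      exists (Ho_eps h3 (proj1_sig x)). apply Ho_eps_iso. }
    exists (exist _ _ (proj1 (H _) (conj Hw (proj2_sig x)))).
    exists (idm (proj1_sig x)), (idm (proj1_sig x)).
    split; apply stable_eq_of_heq; exact (comp_id_l (idm (proj1_sig x))).
Qed.

Lemma I_ff : fully_faithful I.
Proof.
  split; [intros x y f g E; exact E|].
  intros x y g. exists g. apply stable_eq_of_heq. reflexivity.
Qed.

Definition lambda' : Functor (stab (capc W2 C1)) (stab C3) := F3 ⊚ (Q ⊚ j21).
Definition rho' : Functor (stab C3) (stab (capc W2 C1)) := EM2 ⊚ j3.

Lemma lambda'_lambda : naturally_isomorphic (j3 ⊚ lambda') (lambda ⊚ Q ⊚ j21).
Proof.
  apply (nat_iso_intro (F := j3 ⊚ lambda') (G := lambda ⊚ Q ⊚ j21)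
           (t := fun x => idm (lambda (Q (j21 x))))).
  - intros x. apply iso_id.
  - intros x y f.
    change (idm _ ∘ fmap lambda (fmap Q (fmap j21 f)) ≈ fmap lambda (fmap Q (fmap j21 f)) ∘ idm _).
    now rewrite comp_id_l, comp_id_r.
Qed.

(** The counit [λQ -> 1], inverted by [Q]. *)
Definition cover3 (x : stab C1) : hom (lambda (Q x)) x :=
  cov_p (cov3 (proj1_sig x)).

Lemma cover3_natural (x y : stab C1) (f : hom x y) :
  cover3 y ∘ fmap lambda (fmap Q f) ≈ f ∘ cover3 x.
Proof. exact (replacement_spec h3 (f : @hom A (proj1_sig x) (proj1_sig y))). Qed.

Lemma cover3_Q_iso (x : stab C1) : is_iso (fmap Q (cover3 x)).
Proof. exact (Ho_eps_iso h3 (proj1_sig x)). Qed.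

Lemma rho'_rho : naturally_isomorphic (j21 ⊚ rho') (rho ⊚ Q ⊚ j3).
Proof.
  apply nat_iso_sym.
  apply (nat_iso_intro (F := rho ⊚ Q ⊚ j3) (G := j21 ⊚ rho')
           (t := fun x => fmap j21 (fmap EM2 (cover3 (j3 x))))).
  - intros x. apply (fmap_iso j21). apply EM2_inverts, cover3_Q_iso.
  - intros x y f.
    change (fmap j21 (fmap EM2 (cover3 (j3 y))) ∘
              fmap j21 (fmap EM2 (fmap lambda (fmap Q (fmap j3 f))))
            ≈ fmap j21 (fmap EM2 (fmap j3 f)) ∘ fmap j21 (fmap EM2 (cover3 (j3 x)))).
    rewrite <- !fmap_comp. now rewrite cover3_natural.
Qed.

Lemma EM2_unit_iso_on (x : stab (capc W2 C1)) :
  is_iso (EM2_unit (j21 x) : hom x (EM2 (j21 x))).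
Proof. apply (ff_reflects_iso QJ_ff). exact (EM2_unit_iso (j21 x)). Qed.

Lemma rho'_lambda' : naturally_isomorphic (rho' ⊚ lambda') (functor_id _).
Proof.
  apply nat_iso_trans with (EM2 ⊚ j21).
  - apply (nat_iso_intro (F := rho' ⊚ lambda') (G := EM2 ⊚ j21)
             (t := fun x => fmap EM2 (cover3 (j21 x)))).
    + intros x. apply EM2_inverts, cover3_Q_iso.
    + intros x y f.
      change (fmap EM2 (cover3 (j21 y)) ∘ fmap EM2 (fmap lambda (fmap Q (fmap j21 f)))
              ≈ fmap EM2 (fmap j21 f) ∘ fmap EM2 (cover3 (j21 x))).
      rewrite <- !fmap_comp. now rewrite cover3_natural.
  - apply nat_iso_sym.
    apply (nat_iso_intro (F := functor_id _) (G := EM2 ⊚ j21)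
             (t := fun x => EM2_unit (j21 x) : hom x (EM2 (j21 x)))).
    + exact EM2_unit_iso_on.
    + intros x y f. symmetry. exact (EM2_unit_natural (fmap j21 f)).
Qed.

Lemma Q_j3 : naturally_isomorphic (Q ⊚ j3) (stab_to_Ho C3 h3).
Proof.
  apply (nat_iso_intro (F := Q ⊚ j3) (G := stab_to_Ho C3 h3)
           (t := fun x => idm (Q (j3 x)))).
  - intros x. apply iso_id.
  - intros x y f. change (idm _ ∘ fmap Q (fmap j3 f) ≈ fmap Q (fmap j3 f) ∘ idm _).
    now rewrite comp_id_l, comp_id_r.
Qed.

Lemma lambda'_rho' : naturally_isomorphic (lambda' ⊚ rho') (functor_id _).
Proof.
  apply nat_iso_trans with (F3 ⊚ (Q ⊚ j3)).
  2: { apply nat_iso_trans with (F3 ⊚ stab_to_Ho C3 h3); [|exact (stab_Ho_stab h3)].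
       apply nat_iso_postcomp, Q_j3. }
  apply nat_iso_sym.
  apply (nat_iso_intro (F := F3 ⊚ (Q ⊚ j3)) (G := lambda' ⊚ rho')
           (t := fun x => fmap F3 (fmap Q (EM2_unit (j3 x))))).
  - intros x. apply (fmap_iso F3), EM2_unit_iso.
  - intros x y f.
    change (fmap F3 (fmap Q (EM2_unit (j3 y))) ∘ fmap F3 (fmap Q (fmap j3 f))
      ≈ fmap F3 (fmap Q (fmap j21 (fmap EM2 (fmap j3 f)))) ∘ fmap F3 (fmap Q (EM2_unit (j3 x)))).
    rewrite <- !fmap_comp. now rewrite EM2_unit_natural.
Qed.

End Recollement.

(** * Transport of triangulations along equivalences *)

Lemma triangle_iso_heq (C : Cat) (S : Functor C C) (x y z : C)
    (f f' : hom x y) (g g' : hom y z) (k k' : hom z (S x)) :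
  f ≈ f' -> g ≈ g' -> k ≈ k' -> triangle_iso f g k f' g' k'.
Proof.
  intros E1 E2 E3. exists (idm x), (idm y), (idm z).
  repeat (split; [apply iso_id|]).
  rewrite fmap_id, !comp_id_l, !comp_id_r. now repeat split.
Qed.

Lemma triangle_iso_map (C D : Cat) (S : Functor C C) (T : Functor D D)
    (F : Functor C D) (t : forall x, hom (F (S x)) (T (F x)))
    (x y z x' y' z' : C)
    (f : hom x y) (g : hom y z) (k : hom z (S x))
    (f' : hom x' y') (g' : hom y' z') (k' : hom z' (S x')) :
  (forall x y (f : hom x y), t y ∘ fmap F (fmap S f) ≈ fmap T (fmap F f) ∘ t x) ->
  triangle_iso f g k f' g' k' ->
  triangle_iso (S := T) (fmap F f) (fmap F g) (t x ∘ fmap F k)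
    (fmap F f') (fmap F g') (t x' ∘ fmap F k').
Proof.
  intros N (a & b & c & Ha & Hb & Hc & E1 & E2 & E3).
  exists (fmap F a), (fmap F b), (fmap F c).
  repeat (split; [now apply fmap_iso|]).
  split; [now rewrite <- !fmap_comp, E1|].
  split; [now rewrite <- !fmap_comp, E2|].
  now rewrite comp_assoc, <- N, <- !comp_assoc, <- !fmap_comp, E3.
Qed.

(** The structure is defined through [F]; the counit [e] compares [F] of the
    shift of [x] with the shift of [F x]. *)
Section Transport.
Context (C D : Cat) (T : Triangulation C) (F : Functor D C) (G : Functor C D)
  (HF : fully_faithful F) (EF : is_equivalence F) (EG : is_equivalence G)
  (e : forall x, hom (F (G x)) x) (He : forall x, is_iso (e x))
  (Ne : forall x y (f : hom x y), e y ∘ fmap F (fmap G f) ≈ f ∘ e x).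

Definition preimage (x y : D) (g : hom (F x) (F y)) : hom x y :=
  proj1_sig (chosen (proj2 HF x y g)).

Lemma preimage_spec (x y : D) (g : hom (F x) (F y)) : fmap F (preimage g) ≈ g.
Proof. exact (proj2_sig (chosen (proj2 HF x y g))). Qed.

Local Notation P := (tpre T).

Definition transported_pre : Preadditive D.
Proof.
  refine {| hzero := fun x y => preimage (hzero P (F x) (F y));
            hadd := fun x y f g => preimage (hadd P (fmap F f) (fmap F g));
            hopp := fun x y f => preimage (hopp P (fmap F f)) |}.
  - intros x y f f' E g g' E'. apply (proj1 HF). rewrite !preimage_spec. now rewrite E, E'.
  - intros x y f f' E. apply (proj1 HF). rewrite !preimage_spec. now rewrite E.
  - intros x y f g k. apply (proj1 HF). rewrite !preimage_spec. apply hadd_assoc.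
  - intros x y f g. apply (proj1 HF). rewrite !preimage_spec. apply hadd_comm.
  - intros x y f. apply (proj1 HF). rewrite !preimage_spec. apply hadd_zero.
  - intros x y f. apply (proj1 HF). rewrite !preimage_spec. apply hadd_opp.
  - intros x y z g g' f. apply (proj1 HF).
    rewrite fmap_comp, !preimage_spec, !fmap_comp. apply comp_add_l.
  - intros x y z g f f'. apply (proj1 HF).
    rewrite fmap_comp, !preimage_spec, !fmap_comp. apply comp_add_r.
Defined.

Lemma map_zero (x y : D) : fmap F (hzero transported_pre x y) ≈ hzero P (F x) (F y).
Proof. apply preimage_spec. Qed.

Lemma map_add (x y : D) (f g : hom x y) :
  fmap F (hadd transported_pre f g) ≈ hadd P (fmap F f) (fmap F g).
Proof. apply preimage_spec. Qed.

Lemma map_opp (x y : D) (f : hom x y) :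
  fmap F (hopp transported_pre f) ≈ hopp P (fmap F f).
Proof. apply preimage_spec. Qed.

Lemma transported_additive : additive transported_pre.
Proof.
  destruct (tadditive T) as [(z & Hz) B]. split.
  - exists (G z). apply (proj2 (zero_object_id transported_pre _)). apply (proj1 HF).
    apply zero_object_maps. apply (fun K => zero_object_iso K Hz).
    apply isomorphic_sym. exists (e z). apply He.
  - intros x y. destruct (B (F x) (F y)) as (s & i & j & p & q & B1 & B2 & B3 & B4 & B5).
    exists (G s), (preimage (inv_of (He s) ∘ i)), (preimage (inv_of (He s) ∘ j)),
      (preimage (p ∘ e s)), (preimage (q ∘ e s)).
    assert (K : forall a b (f : hom s a) (g : hom b s),
               f ∘ e s ∘ (inv_of (He s) ∘ g) ≈ f ∘ g).
    { intros a b f g. rewrite <- comp_assoc, (comp_assoc (e s)), inv_of_r.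
      now rewrite comp_id_l. }
    repeat split; apply (proj1 HF);
      rewrite ?map_add, ?map_zero, ?fmap_comp, ?preimage_spec, ?fmap_id, ?K; trivial.
    rewrite <- !comp_assoc, <- comp_add_r, !comp_assoc, <- comp_add_l, B5, comp_id_l.
    apply inv_of_l.
Qed.

Definition transported_shift : Functor D D := G ⊚ (shift T ⊚ F).

Lemma transported_shift_equivalence : is_equivalence transported_shift.
Proof.
  apply equivalence_comp; [|exact EG]. apply equivalence_comp; [exact EF|].
  apply shift_equivalence.
Qed.

Definition shift_comparison (x : D) : hom (F (transported_shift x)) (shift T (F x)) :=
  e (shift T (F x)).
Local Notation θ := shift_comparison.

Lemma shift_comparison_natural (x y : D) (f : hom x y) :
  θ y ∘ fmap F (fmap transported_shift f) ≈ fmap (shift T) (fmap F f) ∘ θ x.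
Proof. exact (Ne (fmap (shift T) (fmap F f))). Qed.

Lemma shift_comparison_iso (x : D) : is_iso (θ x).
Proof. apply He. Qed.

Definition transported_dist (x y z : D) (f : hom x y) (g : hom y z)
  (k : hom z (transported_shift x)) : Prop :=
  dist T (fmap F f) (fmap F g) (θ x ∘ fmap F k).

Lemma transported_dist_iso (x y z x' y' z' : D)
   (f : hom x y) (g : hom y z) (k : hom z (transported_shift x))
   (f' : hom x' y') (g' : hom y' z') (k' : hom z' (transported_shift x')) :
  triangle_iso f g k f' g' k' -> transported_dist f g k -> transported_dist f' g' k'.
Proof.
  intros K. apply (tr1_iso (t := T)).
  exact (triangle_iso_map shift_comparison_natural K).
Qed.

Lemma dist_heq (x y z : C) (f f' : hom x y) (g g' : hom y z)
    (k k' : hom z (shift T x)) :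
  f ≈ f' -> g ≈ g' -> k ≈ k' -> dist T f g k -> dist T f' g' k'.
Proof. intros E1 E2 E3. apply tr1_iso. now apply triangle_iso_heq. Qed.

Lemma transported_dist_fill (x y z x' y' z' : D)
   (f : hom x y) (g : hom y z) (k : hom z (transported_shift x))
   (f' : hom x' y') (g' : hom y' z') (k' : hom z' (transported_shift x')) :
  transported_dist f g k -> transported_dist f' g' k' ->
  fillable (S := transported_shift) f g k f' g' k'.
Proof.
  intros K K' a b E.
  destruct (tr3_fill (a := fmap F a) (b := fmap F b) K K') as (c & H1 & H2).
  { now rewrite <- !fmap_comp, E. }
  exists (preimage c). split; apply (proj1 HF).
  - now rewrite !fmap_comp, preimage_spec.
  - apply (iso_mono (shift_comparison_iso x')).
    rewrite !fmap_comp, preimage_spec, (comp_assoc (θ x') (fmap F k')), <- H2.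
    now rewrite !comp_assoc, shift_comparison_natural.
Qed.

Definition transported_triangulation : Triangulation D.
Proof.
  refine {| tpre := transported_pre; tadditive := transported_additive;
            shift := transported_shift;
            shift_equivalence := transported_shift_equivalence;
            dist := transported_dist |}.
  - exact transported_dist_iso.
  - intros x z Hz. unfold transported_dist.
    assert (Fz : is_zero_object (F z)).
    { apply (proj2 (zero_object_id P _)).
      rewrite <- fmap_id, (proj1 (zero_object_id transported_pre z) Hz). apply map_zero. }
    apply (fun E1 E2 E3 => dist_heq E1 E2 E3 (tr1_id T (F x) Fz)).
    + symmetry. apply fmap_id.
    + symmetry. apply map_zero.
    + now apply zero_object_maps.
  - intros x y f. destruct (tr1_cone T (fmap F f)) as (z & g & k & K).
    exists (G z), (preimage (inv_of (He z) ∘ g)),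
      (preimage (inv_of (shift_comparison_iso x) ∘ k ∘ e z)).
    apply (fun J => tr1_iso J K). exists (idm _), (idm _), (inv_of (He z)).
    split; [apply iso_id|]. split; [apply iso_id|].
    split; [exact (iso_inv (inv_of_l _) (inv_of_r _))|].
    rewrite !preimage_spec, fmap_id, !comp_id_l, !comp_id_r.
    split; [reflexivity|]. split; [reflexivity|].
    rewrite !comp_assoc, inv_of_r, comp_id_l, <- comp_assoc, inv_of_r.
    now rewrite comp_id_r.
  - intros x y z f g k. unfold transported_dist. rewrite (@tr2_rotate _ T _ _ _ (fmap F f)).
    assert (J : triangle_iso (fmap F g) (fmap F k)
                  (θ y ∘ fmap F (hopp transported_pre (fmap transported_shift f)))
                  (fmap F g) (θ x ∘ fmap F k) (hopp P (fmap (shift T) (fmap F f)))).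
    { exists (idm _), (idm _), (θ x).
      split; [apply iso_id|]. split; [apply iso_id|].
      split; [apply shift_comparison_iso|].
      rewrite fmap_id, !comp_id_l, !comp_id_r.
      split; [reflexivity|]. split; [reflexivity|].
      rewrite map_opp, comp_opp_r, comp_opp_l. now rewrite shift_comparison_natural. }
    split; apply tr1_iso; [now apply triangle_iso_sym|exact J].
  - intros x y z x' y' z' f g k f' g' k' a b K K' E.
    exact (transported_dist_fill K K' E).
  - intros x y z x' y' z' f f' f'' g g' g'' k' k'' K1 K2 K3.
    assert (K3' : dist T (fmap F g ∘ fmap F f) (fmap F k') (θ x ∘ fmap F k'')).
    { apply (fun E => dist_heq E (reflexivity _) (reflexivity _) K3). apply fmap_comp. }
    destruct (tr4_octahedral K1 K2 K3') as (u & v & O1 & O2 & O3 & O4 & O5).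
    exists (preimage u), (preimage v). split; [|split; [|split; [|split]]].
    + unfold transported_dist.
      apply (fun E1 E2 E3 => dist_heq E1 E2 E3 O1).
      * symmetry. apply preimage_spec.
      * symmetry. apply preimage_spec.
      * rewrite fmap_comp, !comp_assoc. now rewrite shift_comparison_natural.
    + apply (proj1 HF). now rewrite !fmap_comp, preimage_spec.
    + apply (proj1 HF). apply (iso_mono (shift_comparison_iso x)).
      rewrite fmap_comp, preimage_spec, comp_assoc. exact O3.
    + apply (proj1 HF). now rewrite fmap_comp, preimage_spec.
    + apply (proj1 HF). apply (iso_mono (shift_comparison_iso y)).
      rewrite !fmap_comp, preimage_spec, !comp_assoc, O5.
      now rewrite shift_comparison_natural, comp_assoc.
Defined.

Lemma transported_shift_map (x y : D) (f : hom x y) :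
  fmap (shift transported_triangulation) f ≈ fmap G (fmap (shift T) (fmap F f)).
Proof. reflexivity. Qed.

Lemma transported_dist_intro (x y z : D) (f : hom x y) (g : hom y z)
  (k : hom z (transported_shift x)) :
  dist T (fmap F f) (fmap F g) (θ x ∘ fmap F k) -> dist transported_triangulation f g k.
Proof. exact (fun K => K). Qed.

Lemma transported_weak_cokernel :
  (forall (x y z t : C) (f : hom x y) (g : hom y z) (k : hom z (shift T x)) (m : hom z t),
      dist T f g k -> m ∘ g ≈ hzero P y t -> exists n, m ≈ n ∘ k) ->
  forall (x y z t : D) (f : hom x y) (g : hom y z)
         (k : hom z (transported_shift x)) (m : hom z t),
    transported_dist f g k -> m ∘ g ≈ hzero transported_pre y t -> exists n, m ≈ n ∘ k.
Proof.
  intros Wc x y z t f g k m K E.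
  destruct (Wc _ _ _ _ _ _ _ (fmap F m) K) as (n & Hn).
  { now rewrite <- fmap_comp, E, map_zero. }
  exists (preimage (n ∘ θ x)). apply (proj1 HF).
  now rewrite fmap_comp, preimage_spec, <- comp_assoc.
Qed.

End Transport.

(** * The triangulated homotopy category *)

Section HoTriangulation.
Context (A : ExactCat) (C W : A -> Prop) (h : projective_cotorsion_pair C W)
  (EP : enough_projectives A).
Local Notation P := (epre A).
Local Notation "- f" := (hopp P f).
Local Infix "+" := (hadd P).
Local Notation M := (projective_triple C W).
Local Notation γ := (gamma M).
Local Notation F := (Ho_to_stab h).
Local Notation G := (stab_to_Ho C h).
Local Notation cov_of x := (cover (pair_complete h) x).
Local Notation row x := (the_hull (pair_complete h) x).

Definition Ho_triangulation : Triangulation (Ho M) :=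
  transported_triangulation (stab_triangulation h EP) (Ho_to_stab_ff h)
    (Ho_to_stab_equivalence h) (stab_to_Ho_equivalence h)
    (cover_iso_in_C h) (stab_eps_natural h).

(** The row of [x], with the shift of the cofibrant replacement as cokernel:
    the quotient of the row of [cov x] by the kernel of [cov x ->> x]. *)
Record HoRow (x : A) : Type := {
  hr : A; hr_i : hom x hr; hr_p : hom hr (hull_cok (row (cov (cov_of x))));
  hr_k : hom (hull (row (cov (cov_of x)))) hr;
  hr_conf : conf hr_i hr_p; hr_W : W hr;
  hr_sq : hr_k ∘ hull_i (row (cov (cov_of x))) ≈ hr_i ∘ cov_p (cov_of x);
  hr_tri : hr_p ∘ hr_k ≈ hull_p (row (cov (cov_of x))) }.

Definition Ho_row (x : A) : HoRow x.
Proof.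
  apply (fun K : exists _ : HoRow x, True => proj1_sig (chosen K)).
  destruct (noether (cov_conf (cov_of x)) (hull_conf (row (cov (cov_of x)))))
    as (b & r & i & p & N1 & N2 & N3 & N4).
  unshelve eexists {| hr := b; hr_i := i; hr_p := p; hr_k := r |}; trivial.
  - exact (W_cok h N1 (cov_ker_in _) (hull_in _)).
  - now symmetry.
Defined.

(** Every epimorphic approximation with kernel in [W] is as good as the chosen
    cover. *)
Lemma approximation_iso (k q x : A) (i : hom k q) (p : hom q x)
  (a : hom q (cov (cov_of x))) (Hq : C q) :
  conf i p -> W k -> cov_p (cov_of x) ∘ a ≈ p ->
  is_iso (a : @hom (stab C) (exist _ q Hq) (exist _ _ (cov_in (cov_of x)))).
Proof.
  intros K Hk E.
  destruct (lift_epi h (cov_p (cov_of x)) K (cov_in _) Hk) as (g & Hg).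
  apply (@stab_iso A C (exist _ q Hq) (exist _ _ (cov_in (cov_of x))) a g); simpl.
  - apply (lift_unique h K Hq Hk). rewrite comp_assoc, Hg, E. now rewrite comp_id_r.
  - apply (lift_unique h (cov_conf (cov_of x)) (cov_in _) (cov_ker_in _)).
    rewrite comp_assoc, E, Hg. now rewrite comp_id_r.
Qed.

Lemma Ho_dist_intro (x y z : Ho M) (f : hom x y) (g : hom y z)
  (k : hom z (shift Ho_triangulation x)) :
  dist (stab_triangulation h EP) (fmap F f) (fmap F g)
    (shift_comparison (stab_triangulation h EP) (F := F) (G := G)
       (fun x : stab C => cov_p (cov_of (proj1_sig x))) x ∘ fmap F k) ->
  dist Ho_triangulation f g k.
Proof. intros K. exact (transported_dist_intro (Ho_to_stab_ff h)
  (Ho_to_stab_equivalence h) (stab_to_Ho_equivalence h) (cover_iso_in_C h)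
  (stab_eps_natural h) K). Qed.

(** The kernel [q] of [cov y ->> y ->> z] approximates [x], so the conflation
    [q >-> cov y ->> z] of [C] represents the stable triangle. *)
Lemma Ho_dist_conf (x y z : A) (u : hom x y) (v : hom y z)
  (w : hom z (hull_cok (row (cov (cov_of x))))) (φ : hom y (hr (Ho_row x))) :
  conf u v -> C z -> φ ∘ u ≈ hr_i (Ho_row x) -> w ∘ v ≈ hr_p (Ho_row x) ∘ φ ->
  dist Ho_triangulation (fmap γ u) (fmap γ v)
    (fmap γ w : @hom (Ho M) z (shift Ho_triangulation x)).
Proof.
  intros K Hz E1 E2. apply Ho_dist_intro.
  destruct (noether_kernels (cov_conf (cov_of y)) K) as (q & r & a & b & N1 & N2 & N3 & N4).
  pose proof (C_ker h N1 (cov_in _) Hz) as Hq.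
  destruct (connecting h N1 (hull_conf (row q)) Hz (hull_in _)) as (φ' & w' & F1 & F2).
  destruct (lift_epi h b (cov_conf (cov_of x)) Hq (cov_ker_in _)) as (a0 & Ha0).
  destruct (lift_epi h (idm z) (cov_conf (cov_of z)) Hz (cov_ker_in _)) as (c0 & Hc0).
  apply (fun J => stab_dist_iso J
    (@stab_dist_conf A C W h (exist _ q Hq) (exist _ _ (cov_in (cov_of y))) (exist _ z Hz)
       r (v ∘ cov_p (cov_of y)) w' φ' N1 F1 F2)).
  exists a0, (idm _), c0. split; [|split; [|split; [|split; [|split]]]].
  - exact (approximation_iso Hq N2 (cov_ker_in _) Ha0).
  - apply iso_id.
  - destruct (zero_ob A) as (o & Ho).
    exact (approximation_iso (i := hzero P o z) Hz (zero_conf_iso (iso_id z) Ho) (zero_W h Ho) Hc0).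
  - apply (lift_unique h (cov_conf (cov_of y)) Hq (cov_ker_in _)).
    change (cov_p (cov_of y) ∘ (idm _ ∘ r) ~ cov_p (cov_of y) ∘
              ((fmap (replacement h) u : @hom A _ _) ∘ a0)).
    rewrite comp_id_l, N4, comp_assoc, (replacement_spec h u), <- comp_assoc.
    now rewrite Ha0.
  - apply (lift_unique h (cov_conf (cov_of z)) (cov_in (cov_of y)) (cov_ker_in _)).
    change (cov_p (cov_of z) ∘ (c0 ∘ (v ∘ cov_p (cov_of y))) ~ cov_p (cov_of z) ∘
              ((fmap (replacement h) v : @hom A _ _) ∘ idm _)).
    rewrite comp_id_r, comp_assoc, Hc0, comp_id_l. symmetry. apply replacement_spec.
  - change (shift_map h a0 ∘ w' ~ cov_p (cov_of (hull_cok (row (cov (cov_of x))))) ∘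
              (fmap (replacement h) w : @hom A _ _) ∘ c0).
    rewrite (replacement_spec h w), <- comp_assoc, Hc0, comp_id_r.
    destruct (shift_map_spec h a0) as (ψ & S1 & S2).
    apply (row_map_unique h (f1 := cov_p (cov_of x) ∘ a0) (f2 := b)
             (φ1 := hr_k (Ho_row x) ∘ ψ ∘ φ') (φ2 := φ ∘ cov_p (cov_of y))
             N1 (hr_conf (Ho_row x)) Hz (hr_W _)).
    + now rewrite Ha0.
    + rewrite <- !comp_assoc, F1, S1, !comp_assoc. now rewrite hr_sq.
    + rewrite <- !comp_assoc, F2, (comp_assoc (shift_map h a0)), S2, !comp_assoc.
      now rewrite hr_tri.
    + now rewrite <- comp_assoc, N4, comp_assoc, E1.
    + now rewrite comp_assoc, E2, comp_assoc.
Qed.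

Lemma Ho_weak_cokernel (x y z t : Ho M) (f : hom x y) (g : hom y z)
    (k : hom z (shift Ho_triangulation x)) (m : hom z t) :
  dist Ho_triangulation f g k -> m ∘ g ≈ hzero (tpre Ho_triangulation) y t ->
  exists n, m ≈ n ∘ k.
Proof.
  refine (transported_weak_cokernel (T := stab_triangulation h EP)
            (HF := Ho_to_stab_ff h) (G := G)
            (e := fun x : stab C => cov_p (cov_of (proj1_sig x))) _
            (f := f) (g := g) (k := k) (m := m)).
  exact (@stab_dist_weak_cokernel A C W h).
Qed.

Lemma Ho_cone_unique (x y z x' y' z' : Ho M)
   (f : hom x y) (g : hom y z) (k : hom z (shift Ho_triangulation x))
   (f' : hom x' y') (g' : hom y' z') (k' : hom z' (shift Ho_triangulation x')) a b :
  dist Ho_triangulation f g k -> dist Ho_triangulation f' g' k' ->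
  is_iso a -> is_iso b -> b ∘ f ≈ f' ∘ a ->
  triangle_iso (S := shift Ho_triangulation) f g k f' g' k'.
Proof.
  intros K K' Ha Hb E.
  destruct (cone_unique (P := tpre Ho_triangulation) (D := @dist _ Ho_triangulation)
              (fun x y z x' y' z' f g k f' g' k' J J' a b => tr3_fill J J' (a := a) (b := b))
              Ho_weak_cokernel K K' Ha Hb E) as (c & Hc & E1 & E2).
  exists a, b, c. now repeat split.
Qed.

Lemma Ho_shift_rows (x y : A) (f : hom x y) :
  exists φ g, φ ∘ hr_i (Ho_row x) ≈ hr_i (Ho_row y) ∘ f /\
    g ∘ hr_p (Ho_row x) ≈ hr_p (Ho_row y) ∘ φ /\
    fmap (shift Ho_triangulation) (fmap γ f) ≈ fmap γ g.
Proof.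
  destruct (row_map h f (hr_conf (Ho_row x)) (hr_conf (Ho_row y)) (hull_cok_in _) (hr_W _))
      as (φ & g & E1 & E2).
  exists φ, g. split; [exact E1|]. split; [exact E2|].
  etransitivity.
  { exact (transported_shift_map (stab_triangulation h EP) (Ho_to_stab_ff h)
      (Ho_to_stab_equivalence h) (stab_to_Ho_equivalence h) (cover_iso_in_C h)
      (stab_eps_natural h) (fmap γ f)). }
  change (shift (stab_triangulation h EP)) with (stab_shift h).
  rewrite (Ho_to_stab_gamma h f), stab_to_Ho_map.
  apply (gamma_proper h).
  set (c0 := fmap (replacement h) f : hom (cov (cov_of x)) (cov (cov_of y))).
  change (shift_map h c0 ~ g).
  destruct (shift_map_spec h c0) as (ψ & S1 & S2).
  apply (row_map_unique h (f1 := cov_p (cov_of y) ∘ c0) (f2 := f ∘ cov_p (cov_of x))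
           (φ1 := hr_k (Ho_row y) ∘ ψ) (φ2 := φ ∘ hr_k (Ho_row x))
           (hull_conf (row (cov (cov_of x)))) (hr_conf (Ho_row y))
           (hull_cok_in _) (hr_W _)).
  - apply replacement_spec.
  - now rewrite <- comp_assoc, S1, !comp_assoc, hr_sq.
  - now rewrite S2, comp_assoc, hr_tri.
  - now rewrite <- comp_assoc, hr_sq, comp_assoc, E1, comp_assoc.
  - now rewrite comp_assoc, <- E2, <- comp_assoc, hr_tri.
Qed.

(** A triangle is determined up to isomorphism by its first map, which
    [mono_replacement] turns into an admissible monomorphism of cofibrant
    objects. *)
Lemma Ho_triangulation_homotopy : homotopy_triangulation Ho_triangulation.
Proof.
  exists (fun x => hr (Ho_row x)), (fun x => hr_i (Ho_row x)), (fun x => hr_p (Ho_row x)).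
  split; [|split].
  - intros x. split; [apply hr_conf|]. split; [split; [exact I|apply hr_W]|].
    exact (hull_cok_in (row (cov (cov_of x)))).
  - exact Ho_shift_rows.
  - intros x y z f g k. split.
    + intros K.
      destruct (Ho_full h (fmap G (fmap F f)) (cov_in (cov_of x))) as (f0 & Hf0).
      destruct (mono_replacement h f0 (cov_in (cov_of x)) (cov_in (cov_of y)))
        as (y1 & e & u & v & r & s & N & Hy1 & He & R1 & R2 & R3).
      destruct (connecting h N (hr_conf (Ho_row (cov (cov_of x)))) He (hr_W _))
        as (φ & w & E1 & E2).
      exists (cov (cov_of x)), y1, e, u, v, w, φ.
      split; [exact N|]. split; [exact He|]. split; [exact E1|]. split; [exact E2|].
      apply (fun Ha Hb => Ho_cone_unique (a := Ho_eps h x) (b := Ho_eps h y ∘ fmap γ r)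
                (Ho_dist_conf N He E1 E2) K Ha Hb).
      * apply Ho_eps_iso.
      * apply iso_comp; [apply Ho_eps_iso|].
        exists (fmap γ s). rewrite <- !fmap_comp, R1, <- !fmap_id.
        split; [now apply (gamma_proper h)|reflexivity].
      * rewrite <- comp_assoc, <- fmap_comp, R3, Hf0. apply Ho_eps_natural.
    + intros (x' & y' & z' & u & v & w & φ & K & Hz & E1 & E2 & J).
      exact (tr1_iso J (Ho_dist_conf K Hz E1 E2)).
Qed.

End HoTriangulation.

(** * Exactness *)

Section InclusionExact.
Context (A : ExactCat) (EP : enough_projectives A) (C W C' W' : A -> Prop)
  (h : projective_cotorsion_pair C W) (h' : projective_cotorsion_pair C' W')
  (inc : subclass C' C).
Local Notation row x := (the_hull (pair_complete h) x).
Local Notation row' x := (the_hull (pair_complete h') x).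

Lemma compare_rows (x : stab C') :
  exists (g : hom (hull_cok (row' (proj1_sig x))) (hull_cok (row (proj1_sig x)))) φ,
    φ ∘ hull_i (row' (proj1_sig x)) ≈ hull_i (row (proj1_sig x)) /\
    g ∘ hull_p (row' (proj1_sig x)) ≈ hull_p (row (proj1_sig x)) ∘ φ /\
    exists g', g' ∘ g ~ idm _ /\ g ∘ g' ~ idm _.
Proof.
  destruct (rows_cokernel_iso h (hull_conf (row' (proj1_sig x)))
    (hull_conf (row (proj1_sig x))) (inc (hull_cok_in _))
    (projective_W h (row_projective (h := h') (proj2_sig x))) (hull_cok_in _) (hull_in _))
    as (φ & g & g' & E1 & E2 & E3 & E4).
  exists g, φ. split; [exact E1|]. split; [exact E2|]. now exists g'.
Qed.

Definition compare_shifts (x : stab C') :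
  hom (stab_incl inc (stab_shift h' x)) (stab_shift h (stab_incl inc x)) :=
  proj1_sig (chosen (compare_rows x)).

Lemma compare_shifts_spec (x : stab C') : exists φ,
  φ ∘ hull_i (row' (proj1_sig x)) ≈ hull_i (row (proj1_sig x)) /\
  (compare_shifts x : @hom A _ _) ∘ hull_p (row' (proj1_sig x))
    ≈ hull_p (row (proj1_sig x)) ∘ φ.
Proof.
  destruct (proj2_sig (chosen (compare_rows x))) as (φ & E1 & E2 & _). now exists φ.
Qed.

Lemma compare_shifts_iso (x : stab C') : is_iso (compare_shifts x).
Proof.
  destruct (proj2_sig (chosen (compare_rows x))) as (φ & E1 & E2 & g' & E3 & E4).
  exists g'. split; assumption.
Qed.

Lemma compare_shifts_natural (x y : stab C') (f : hom x y) :
  compare_shifts y ∘ fmap (stab_incl inc) (fmap (stab_shift h') f)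
  ≈ fmap (stab_shift h) (fmap (stab_incl inc) f) ∘ compare_shifts x.
Proof.
  destruct x as [x Hx], y as [y Hy].
  destruct (compare_shifts_spec (exist _ x Hx)) as (φ & X1 & X2).
  destruct (compare_shifts_spec (exist _ y Hy)) as (ψ & Y1 & Y2).
  set (sx := compare_shifts (exist _ x Hx) : hom (hull_cok (row' x)) (hull_cok (row x))) in *.
  set (sy := compare_shifts (exist _ y Hy) : hom (hull_cok (row' y)) (hull_cok (row y))) in *.
  simpl in f, X1, X2, Y1, Y2.
  destruct (shift_map_spec h f) as (α & F1 & F2).
  destruct (shift_map_spec h' f) as (β & G1 & G2).
  apply (row_map_unique h (f1 := f) (f2 := f) (φ1 := ψ ∘ β) (φ2 := α ∘ φ)
           (g1 := sy ∘ shift_map h' f) (g2 := shift_map h f ∘ sx)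
           (hull_conf (row' x)) (hull_conf (row y)) (inc (hull_cok_in _)) (hull_in _)).
  - reflexivity.
  - now rewrite <- comp_assoc, G1, comp_assoc, Y1.
  - now rewrite <- comp_assoc, G2, comp_assoc, Y2, comp_assoc.
  - now rewrite <- comp_assoc, X1.
  - now rewrite <- comp_assoc, X2, comp_assoc, F2, comp_assoc.
Qed.

(** A conflation of [C'] is one of [C]; only the rows that define the shifts
    differ. *)
Lemma stab_incl_exact :
  exact_functor (stab_triangulation h' EP) (stab_triangulation h EP) (stab_incl inc).
Proof.
  exists {| component := compare_shifts
              : forall x, hom ((stab_incl inc ⊚ shift (stab_triangulation h' EP)) x)
                              ((shift (stab_triangulation h EP) ⊚ stab_incl inc) x);
            naturality := compare_shifts_natural |}.
  split; [exact compare_shifts_iso|].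
  intros x y z f g k (x' & y' & z' & u & v & w & φ & K & Hz & E1 & E2 & J).
  destruct (compare_shifts_spec x') as (ψ & X1 & X2).
  refine (stab_dist_iso (triangle_iso_map (F := stab_incl inc) (T := stab_shift h)
            compare_shifts_natural J) _).
  apply (@stab_dist_conf A C W h (stab_incl inc x') (stab_incl inc y') (stab_incl inc z')
           u v ((compare_shifts x' : @hom A _ _) ∘ w) (ψ ∘ φ) K).
  - rewrite <- comp_assoc, E1. exact X1.
  - rewrite <- comp_assoc, E2, comp_assoc, X2. symmetry. apply comp_assoc.
Qed.

End InclusionExact.

Section QuotientExact.
Context (A : ExactCat) (EP : enough_projectives A) (C W C' W' : A -> Prop)
  (h : projective_cotorsion_pair C W) (h' : projective_cotorsion_pair C' W')
  (inW : subclass W W').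
Local Notation P := (epre A).
Local Notation "- f" := (hopp P f).
Local Infix "+" := (hadd P).
Local Notation M' := (projective_triple C' W').
Local Notation γ' := (gamma M').
Local Notation Q := (stab_to_Ho C h').
Local Notation T' := (Ho_triangulation h' EP).
Local Notation row x := (the_hull (pair_complete h) x).
Local Notation row' x :=
  (the_hull (pair_complete h') (cov (cover (pair_complete h') x))).

Lemma compare_Ho_rows (x : A) :
  exists (g : hom (hull_cok (row' x)) (hull_cok (row x))) φ,
    φ ∘ hr_i (Ho_row h' x) ≈ hull_i (row x) /\
    g ∘ hr_p (Ho_row h' x) ≈ hull_p (row x) ∘ φ.
Proof.
  destruct (connecting h' (hr_conf (Ho_row h' x)) (hull_conf (row x))
              (hull_cok_in _) (inW (hull_in _))) as (φ & g & E). now exists g, φ.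
Qed.

Definition Ho_compare (x : A) : hom (hull_cok (row' x)) (hull_cok (row x)) :=
  proj1_sig (chosen (compare_Ho_rows x)).

Lemma Ho_compare_spec (x : A) : exists φ,
  φ ∘ hr_i (Ho_row h' x) ≈ hull_i (row x) /\
  Ho_compare x ∘ hr_p (Ho_row h' x) ≈ hull_p (row x) ∘ φ.
Proof. exact (proj2_sig (chosen (compare_Ho_rows x))). Qed.

(** The comparison of rows with the same kernel is a bicartesian square, so its
    cokernel map is, up to a summand in [W'], a trivial fibration. *)
Lemma Ho_compare_iso (x : A) : is_iso (fmap γ' (Ho_compare x)).
Proof.
  destruct (Ho_compare_spec x) as (φ & E1 & E2).
  destruct (biproduct_exists (hull_cok (row' x)) (hull (row x)))
    as (e & j1 & j2 & q1 & q2 & B).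
  pose proof (bicartesian_conf (hr_conf (Ho_row h' x)) (hull_conf (row x)) E1 E2 B) as K.
  apply (iso_heq (f := fmap γ' (Ho_compare x ∘ q1 + - (hull_p (row x) ∘ q2)) ∘ fmap γ' j1)).
  - rewrite <- fmap_comp. apply (gamma_proper h'), stable_eq_of_heq.
    destruct B as (B1 & B2 & B3 & B4 & _). expand. rewrite B1, B4. expand. abel.
  - apply iso_comp; apply (gamma_iso (C := C') (W := W')).
    + exact (trivial_fibration_we h' K (hr_W (Ho_row h' x))).
    + exact (mono_we h' (biproduct_conf B) (inW (hull_in _))).
Qed.

Lemma Ho_shift_map (x y : A) (f : hom x y) :
  exists φ g, φ ∘ hr_i (Ho_row h' x) ≈ hr_i (Ho_row h' y) ∘ f /\
    g ∘ hr_p (Ho_row h' x) ≈ hr_p (Ho_row h' y) ∘ φ /\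
    fmap (shift T') (fmap γ' f) ≈ fmap γ' g.
Proof. exact (Ho_shift_rows h' EP f). Qed.

Definition Q_shift (x : stab C) : hom (Q (stab_shift h x)) (shift T' (Q x)) :=
  inv_of (Ho_compare_iso (proj1_sig x)).

Lemma Q_shift_natural (x y : stab C) (f : hom x y) :
  Q_shift y ∘ fmap Q (fmap (stab_shift h) f) ≈ fmap (shift T') (fmap Q f) ∘ Q_shift x.
Proof.
  destruct x as [x Hx], y as [y Hy]. simpl in f.
  change (inv_of (Ho_compare_iso y) ∘ fmap γ' (shift_map h f)
          ≈ fmap (shift T') (fmap γ' f) ∘ inv_of (Ho_compare_iso x)).
  apply (iso_mono (Ho_compare_iso y)). apply (iso_epi (Ho_compare_iso x)).
  rewrite comp_assoc, inv_of_r, comp_id_l, <- !comp_assoc, inv_of_l, comp_id_r.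
  destruct (Ho_shift_map f) as (φ & g & E1 & E2 & E3).
  rewrite E3, <- !fmap_comp. apply (gamma_proper h').
  destruct (Ho_compare_spec x) as (α & X1 & X2).
  destruct (Ho_compare_spec y) as (β & Y1 & Y2).
  destruct (shift_map_spec h f) as (ψ & S1 & S2).
  apply (row_map_unique h' (f1 := f) (f2 := f) (φ1 := ψ ∘ α) (φ2 := β ∘ φ)
           (hr_conf (Ho_row h' x)) (hull_conf (row y)) (hull_cok_in _) (inW (hull_in _))).
  - reflexivity.
  - now rewrite <- comp_assoc, X1.
  - now rewrite <- comp_assoc, X2, comp_assoc, S2, comp_assoc.
  - now rewrite <- comp_assoc, E1, comp_assoc, Y1.
  - now rewrite <- comp_assoc, E2, comp_assoc, Y2, comp_assoc.
Qed.

(** Only the [C]-triangles with third vertex in [C'] are cofibre sequences of the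
    target; pulling back along the [C']-cover of that vertex, which [Q] inverts,
    reduces to this case. *)
Lemma stab_to_Ho_exact : exact_functor (stab_triangulation h EP) T' Q.
Proof.
  exists {| component := Q_shift : forall x, hom ((Q ⊚ shift (stab_triangulation h EP)) x)
                                                 ((shift T' ⊚ Q) x);
            naturality := Q_shift_natural |}.
  split; [intros x; exact (iso_inv (inv_of_l _) (inv_of_r _))|].
  intros x y z f g k (x' & y' & z' & u & v & w & φ & K & Hz & E1 & E2 & J).
  refine (tr1_iso (triangle_iso_map (F := Q) (T := shift T') Q_shift_natural J) _).
  clear J x y z f g k. destruct x' as [x Hx], y' as [y Hy], z' as [z Hz'].
  simpl in u, v, w, φ, E1, E2.
  set (c := cover (pair_complete h') z).
  destruct (pullback_epis K (cov_conf c)) as (y' & v' & e & u' & l & N & L & Eu & Ev).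
  destruct (connecting h' N (hr_conf (Ho_row h' x)) (cov_in c) (hr_W _))
    as (φ' & w' & F1 & F2).
  refine (tr1_iso _ (Ho_dist_conf EP N (cov_in c) F1 F2)).
  exists (idm _), (fmap γ' e), (fmap γ' (cov_p c)).
  split; [apply iso_id|]. split; [|split; [|split; [|split]]].
  - apply (gamma_iso (C := C') (W := W')).
    exact (trivial_fibration_we h' L (cov_ker_in c)).
  - apply (gamma_iso (C := C') (W := W')), cover_we.
  - rewrite comp_id_r. change (fmap γ' e ∘ fmap γ' u' ≈ fmap γ' u).
    now rewrite <- fmap_comp, Eu.
  - change (fmap γ' (cov_p c) ∘ fmap γ' v' ≈ fmap γ' v ∘ fmap γ' e).
    now rewrite <- !fmap_comp, Ev.
  - rewrite fmap_id, comp_id_l. apply (iso_mono (Ho_compare_iso x)).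
    destruct (Ho_compare_spec x) as (α & X1 & X2).
    change (fmap γ' (Ho_compare x) ∘ fmap γ' w'
            ≈ fmap γ' (Ho_compare x) ∘
                (inv_of (Ho_compare_iso x) ∘ fmap γ' w ∘ fmap γ' (cov_p c))).
    rewrite !comp_assoc, inv_of_r, comp_id_l, <- !fmap_comp.
    apply (gamma_proper h').
    apply (row_map_unique h' (f1 := idm x) (f2 := idm x) (φ1 := α ∘ φ') (φ2 := φ ∘ e)
             N (hull_conf (row x)) (cov_in c) (inW (hull_in _))).
    + reflexivity.
    + now rewrite <- comp_assoc, F1, X1, comp_id_r.
    + now rewrite <- comp_assoc, F2, comp_assoc, X2, comp_assoc.
    + now rewrite <- comp_assoc, Eu, E1, comp_id_r.
    + now rewrite <- comp_assoc, <- Ev, (comp_assoc w), E2, comp_assoc.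
Qed.

End QuotientExact.

(** * Quillen equivalences *)

Lemma cotorsion_pair_same (A : ExactCat) (X Y X' Y' : A -> Prop) :
  same_class X X' -> same_class Y Y' ->
  complete_cotorsion_pair X Y -> complete_cotorsion_pair X' Y'.
Proof.
  intros EX EY ((H1 & H2) & H3 & H4). split; [split|split].
  - intros a. rewrite <- (EX a), (H1 a).
    split; intros K b Hb; apply K; now apply EY.
  - intros b. rewrite <- (EY b), (H2 b).
    split; intros K a Ha; apply K; now apply EX.
  - intros a. destruct (H3 a) as (y & x & i & p & K & Ky & Kx).
    exists y, x, i, p. split; [exact K|]. split; [now apply EY|now apply EX].
  - intros a. destruct (H4 a) as (y & x & i & p & K & Ky & Kx).
    exists y, x, i, p. split; [exact K|]. split; [now apply EY|now apply EX].
Qed.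

Lemma adm_mono_weaken (A : ExactCat) (S S' : A -> Prop) (x y : A) (i : hom x y) :
  subclass S S' -> adm_mono_with_coker_in S i -> adm_mono_with_coker_in S' i.
Proof. intros H (z & p & K & Hz). exists z, p. auto. Qed.

Lemma adm_epi_weaken (A : ExactCat) (S S' : A -> Prop) (x y : A) (p : hom x y) :
  subclass S S' -> adm_epi_with_ker_in S p -> adm_epi_with_ker_in S' p.
Proof. intros H (z & i & K & Hz). exists z, i. auto. Qed.

(** The cofibrant objects determine the trivial ones: approximate by [Ci]. *)
Lemma left_localization_unique (A : ExactCat) (Ci Wi Cj Wj V V' : A -> Prop)
    (hi : projective_cotorsion_pair Ci Wi) :
  thick V -> same_class (capc Ci V) Cj -> same_class (capc V Wj) Wi ->
  thick V' -> same_class (capc Ci V') Cj -> same_class (capc V' Wj) Wi ->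
  subclass V V'.
Proof.
  intros T1 E1 F1 T2 E2 F2 x Hx.
  destruct (cover (pair_complete hi) x) as [q k i p K Hq Hk].
  destruct (proj2 T1 _ _ _ _ _ K) as (_ & Mid & _).
  destruct (proj2 T2 _ _ _ _ _ K) as (Cok & _ & _).
  apply Cok.
  - apply F2 in Hk. apply Hk.
  - apply (E2 q), (E1 q). split; [exact Hq|]. apply Mid; [|exact Hx].
    apply F1 in Hk. apply Hk.
Qed.

(** The two universal properties give inverse functors, which are the identity on
    the maps of [C]. *)
Section SameLocalization.
Context (C : Cat) (V V' : forall x y : C, hom x y -> Prop)
  (H : inverts V (loc_functor V')) (H' : inverts V' (loc_functor V)).

Definition change_localization : Functor (localization V) (localization V') := lift H.

Lemma change_localization_equivalence : is_equivalence change_localization.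
Proof.
  exists (lift H'). split.
  - apply (nat_iso_intro (F := lift H' ⊚ lift H) (G := functor_id (localization V))
             (t := fun x => idm (loc_functor V x))).
    + intros x. apply iso_id.
    + apply (loc_natural (K := lift H' ⊚ lift H) (L := functor_id (localization V))).
      intros x y f. change (idm _ ∘ fmap (loc_functor V) f ≈ fmap (loc_functor V) f ∘ idm _).
      now rewrite comp_id_l, comp_id_r.
  - apply (nat_iso_intro (F := lift H ⊚ lift H') (G := functor_id (localization V'))
             (t := fun x => idm (loc_functor V' x))).
    + intros x. apply iso_id.
    + apply (loc_natural (K := lift H ⊚ lift H') (L := functor_id (localization V'))).
      intros x y f. change (idm _ ∘ fmap (loc_functor V') f ≈ fmap (loc_functor V') f ∘ idm _).
      now rewrite comp_id_l, comp_id_r.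
Qed.

Lemma change_localization_right_kan :
  exists e : NatTrans (change_localization ⊚ loc_functor V) (loc_functor V'),
    is_right_kan e.
Proof.
  unshelve eexists {| component := fun x => idm (loc_functor V' x)
    : hom ((change_localization ⊚ loc_functor V) x) (loc_functor V' x) |}.
  { intros x y f. change (idm _ ∘ fmap (loc_functor V') f ≈ fmap (loc_functor V') f ∘ idm _).
    now rewrite comp_id_l, comp_id_r. }
  apply right_kan_of_deformation with (r := fun x => x) (e := fun x => idm x).
  - intros x y f. exists f. now rewrite comp_id_l, comp_id_r.
  - intros x. apply fmap_iso, iso_id.
  - intros x. apply iso_id.
Qed.

Lemma change_localization_left_kan :
  exists e : NatTrans (loc_functor V') (change_localization ⊚ loc_functor V),
    is_left_kan e.
Proof.
  unshelve eexists {| component := fun x => idm (loc_functor V' x)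
    : hom (loc_functor V' x) ((change_localization ⊚ loc_functor V) x) |}.
  { intros x y f. change (idm _ ∘ fmap (loc_functor V') f ≈ fmap (loc_functor V') f ∘ idm _).
    now rewrite comp_id_l, comp_id_r. }
  apply left_kan_of_deformation with (r := fun x => x) (e := fun x => idm x).
  - intros x y f. exists f. now rewrite comp_id_l, comp_id_r.
  - intros x. apply fmap_iso, iso_id.
  - intros x. apply iso_id.
Qed.
End SameLocalization.

Section Localizations.
Context (A : ExactCat) (C1 W1 C2 W2 C3 W3 : A -> Prop)
  (h1 : projective_cotorsion_pair C1 W1) (h2 : projective_cotorsion_pair C2 W2)
  (h3 : projective_cotorsion_pair C3 W3) (h21 : subclass C2 C1) (h31 : subclass C3 C1)
  (H : same_class (capc W3 C1) C2).
Local Notation P := (epre A).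
Local Notation "0" := (hzero P _ _).
Local Infix "+" := (hadd P).
Local Notation "- f" := (hopp P f).
Local Notation cov1 x := (cover (pair_complete h1) x).
Local Notation cov2 x := (cover (pair_complete h2) x).
Local Notation hull3 x := (the_hull (pair_complete h3) x).

Lemma W2_W3_W1 : same_class (capc W2 W3) W1.
Proof. apply (proj1 (proj1 (orthogonality_conditions h1 h2 h3 h21 h31) H)). Qed.

(** ** The localization at the second pair *)

Definition loc2 : Triple A := {| cofibrant := C1; trivial := W3; fibrant := W2 |}.

Lemma C1_W3 : same_class (capc C1 W3) C2.
Proof. intros x. rewrite <- (H x). unfold capc. tauto. Qed.

Lemma W3_W2 : same_class (capc W3 W2) W1.
Proof. intros x. rewrite <- (W2_W3_W1 x). unfold capc. tauto. Qed.

Lemma loc2_left_localization : is_left_localization C2 W2 C1 W1 loc2.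
Proof.
  assert (T : thick W3) by exact (proj1 (proj2 h3)).
  split; [reflexivity|]. split; [reflexivity|]. split; [|split; [|split; [|split]]].
  - split; [exact T|]. split; [exact C1_W3|exact W3_W2].
  - intros V (T' & E1 & E2) x. split.
    + exact (left_localization_unique h1 T' E1 E2 T C1_W3 W3_W2 (a := x)).
    + exact (left_localization_unique h1 T C1_W3 W3_W2 T' E1 E2 (a := x)).
  - exact T.
  - apply (fun E => cotorsion_pair_same (fun x => iff_refl (C1 x)) E (pair_complete h1)).
    intros x. symmetry. apply W2_W3_W1.
  - apply (fun E => cotorsion_pair_same E (fun x => iff_refl (W2 x)) (pair_complete h2)).
    intros x. symmetry. apply C1_W3.
Qed.

(** Pushing out along the hull of the kernel for the second pair factors [p]
    into a trivial cofibration and a trivial fibration of [loc2]. *)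
Lemma epi_loc2_we (x y z : A) (k : hom x y) (p : hom y z) :
  conf k p -> W3 x -> weak_equivalence loc2 p.
Proof.
  intros K Hx. destruct (the_hull (pair_complete h2) x) as [r q l c L Hr Hq].
  destruct (pushout_monos K L) as (y' & i' & p' & l' & c' & K' & L' & E).
  exists y', l', p'. split; [|split].
  - exists q, c'. split; [exact L'|]. now apply C1_W3.
  - exists r, i'. split; [exact K'|]. split; [exact Hr|].
    exact (W_mid h3 L Hx (C2_W3 H Hq)).
  - now symmetry.
Qed.

(** Every weak equivalence of either structure is inverted by the localization
    at the other, so both derived functors are identities on objects. *)
Lemma loc2_quillen : quillen_equivalence_via_id (projective_triple C3 W3) loc2.
Proof.
  assert (I1 : inverts (weak_equivalence (projective_triple C3 W3)) (gamma loc2)).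
  { apply (inverts_of_epis h3). intros x y z k p K Hx.
    apply loc_functor_inverts. exact (epi_loc2_we K Hx). }
  assert (I2 : inverts (weak_equivalence loc2) (gamma (projective_triple C3 W3))).
  { intros x y f (t & i & p & (q & r & K & Hq) & (k & l & L & Hk) & E).
    apply (iso_heq (f := fmap (gamma (projective_triple C3 W3)) p
                         ∘ fmap (gamma (projective_triple C3 W3)) i)).
    - rewrite <- fmap_comp. apply fmap_proper. now symmetry.
    - apply iso_comp; apply (gamma_iso (C := C3) (W := W3)).
      + exact (trivial_fibration_we h3 L (proj2 Hk)).
      + exact (mono_we h3 K (proj2 Hq)). }
  split; [|split; [|split; [|split; [|split]]]].
  - intros x y f. exact (adm_mono_weaken (S' := C1) h31).
  - intros x y f. apply adm_mono_weaken. intros c [K1 K2]. split; [exact (h31 K1)|exact K2].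
  - intros x y f. apply adm_epi_weaken. intros c _. exact I.
  - intros x y f. apply adm_epi_weaken. intros c [_ K]. split; [exact I|exact K].
  - destruct (change_localization_right_kan I1) as (e & He).
    exists (change_localization I1), e. split; [exact He|].
    exact (change_localization_equivalence I1 I2).
  - destruct (change_localization_left_kan I2) as (e & He).
    exists (change_localization I2), e. split; [exact He|].
    exact (change_localization_equivalence I2 I1).
Qed.

(** ** The localization at the third pair *)

(** The conflation given by the [C3]-cover of [c] is classified by a stable map
    from [c] to the shift of an object of [C2]. As this map vanishes on [b], it
    comes from the shift of [a], which is in [C3], and maps from [C3] to [C2]
    are null. So the cover splits. *)
Lemma C3_cokernel (a b c : A) (u : hom a b) (v : hom b c) :
  conf u v -> C3 a -> C3 b -> C1 c -> C3 c.
Proof.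
  intros K Ha Hb Hc.
  pose proof (cover3_kernel h1 h3 h31 H Hc) as Hk.
  destruct (cover (pair_complete h3) c) as [q k l π L Hq Hk3]. simpl in Hk.
  destruct (the_hull (pair_complete h2) k) as [t s i p N Ht Hs].
  pose proof (syzygy_hull_projective h2 N Hk Ht Hs) as Pt.
  destruct (the_hull (pair_complete h3) a) as [ta sa ia pa Na Hta Hsa].
  pose proof (syzygy_hull_projective h3 Na Ha Hta Hsa) as Pta.
  destruct (connecting h1 L N Hc (projective_W h1 Pt)) as (φ & ω & E1 & E2).
  destruct (connecting h1 K Na Hc (projective_W h1 Pta)) as (ψ & w & F1 & F2).
  destruct (conf_weak_cokernel h1 (k := ω) K Na Hc (h31 Hsa) F1 F2) as (m & Hm).
  { exact (C_to_W_null h3 _ Hb (C2_W3 H Hs)). }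
  assert (Z : ω ~ 0).
  { rewrite Hm, (C_to_W_null h3 m Hsa (C2_W3 H Hs)). now rewrite comp_zero_l. }
  apply (proj1 (stable_zero _)) in Z. destruct Z as (R & α & β & HR & Z).
  destruct (HR _ _ _ _ _ N β) as (β' & Hβ).
  destruct (conf_ker (f := φ + - (β' ∘ α ∘ π)) N) as (ρ & Hρ).
  { expand. rewrite <- E2, (comp_assoc_pre Hβ), Z. expand. apply hadd_opp. }
  destruct (conf_split (r := ρ) L) as (σ & B).
  { apply (conf_monic N). rewrite comp_assoc, Hρ. expand.
    rewrite E1, (conf_zero L). expand. abel. }
  apply (C_retract h3 (y := q)); [|exact Hq]. exists σ, π. apply B.
Qed.

(** By [W_loc3_cover], this says that the cover of [x] for the first pair lies
    in [C3]. *)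
Definition W_loc3 (x : A) : Prop :=
  exists (w q : A) (i : hom w q) (p : hom q x), conf i p /\ W1 w /\ C3 q.

(** Two approximations with kernel in [W1] by objects of [C1] are stable
    retracts of each other. *)
Lemma W_loc3_cover (x w q : A) (i : hom w q) (p : hom q x) :
  conf i p -> W1 w -> C1 q -> W_loc3 x -> C3 q.
Proof.
  intros K Hw Hq (w' & q' & i' & p' & K' & Hw' & Hq').
  destruct (lift_epi h1 p K' Hq Hw') as (a & Ha).
  destruct (lift_epi h1 p' K (h31 Hq') Hw) as (b & Hb).
  apply (C_stable_retract h3 (f := a) (g := b)); [|exact Hq'].
  apply (lift_unique h1 K Hq Hw). now rewrite comp_assoc, Hb, Ha, comp_id_r.
Qed.

(** A cover of the pullback of [y ->> z] along a cover of [z] is also a cover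
    of [y]; the kernel of its map to the cover of [z] is a cover of [x]. *)
Lemma horseshoe (x y z : A) (u : hom x y) (v : hom y z) :
  conf u v -> exists wx qx wy qy wz qz (i : hom wx qx) (p : hom qx x)
    (i' : hom wy qy) (p' : hom qy y) (i'' : hom wz qz) (p'' : hom qz z)
    (u' : hom qx qy) (v' : hom qy qz),
  conf i p /\ conf i' p' /\ conf i'' p'' /\ conf u' v' /\
  (W1 wx /\ C1 qx) /\ (W1 wy /\ C1 qy) /\ (W1 wz /\ C1 qz).
Proof.
  intros K. destruct (cov1 z) as [qz wz iz pz Kz Hqz Hwz].
  destruct (pullback_epis K Kz) as (y' & v1 & e & u1 & l & N & L & _ & _).
  destruct (cov1 y') as [qy w' i' p' Ky Hqy Hw'].
  destruct (noether_kernels Ky N) as (qx & r & a & b & R1 & R2 & _ & _).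
  destruct (noether_kernels Ky L) as (wy & s & c & d & S1 & S2 & _ & _).
  pose proof (W_mid h1 S2 Hw' Hwz) as Hwy.
  pose proof (C_ker h1 R1 Hqy Hqz) as Hqx.
  exists w', qx, wy, qy, wz, qz, a, b, s, (e ∘ p'), iz, pz, r, (v1 ∘ p').
  tauto.
Qed.

Lemma W_loc3_thick : thick W_loc3.
Proof.
  split.
  - intros x y (i & r & E) Hy.
    pose proof (W_loc3_cover (cov_conf (cov1 y)) (cov_ker_in _) (cov_in _) Hy) as Cy.
    exists (cov_ker (cov1 x)), (cov (cov1 x)), (cov_i _), (cov_p _).
    split; [apply cov_conf|]. split; [apply cov_ker_in|].
    apply (C_stable_retract h3 (c := cov (cov1 y))
             (f := fmap (replacement h1) i) (g := fmap (replacement h1) r)); [|exact Cy].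
    exact (fmap_section (replacement h1) E).
  - intros x y z u v K.
    destruct (horseshoe K) as (wx & qx & wy & qy & wz & qz & i & p & i' & p' & i'' & p''
      & u' & v' & Kx & Ky & Kz & K' & [Hwx Hqx] & [Hwy Hqy] & [Hwz Hqz]).
    split; [|split]; intros Ha Hb.
    + exists wz, qz, i'', p''. split; [exact Kz|]. split; [exact Hwz|].
      exact (C3_cokernel K' (W_loc3_cover Kx Hwx Hqx Ha) (W_loc3_cover Ky Hwy Hqy Hb) Hqz).
    + exists wy, qy, i', p'. split; [exact Ky|]. split; [exact Hwy|].
      exact (C_mid h3 K' (W_loc3_cover Kx Hwx Hqx Ha) (W_loc3_cover Kz Hwz Hqz Hb)).
    + exists wx, qx, i, p. split; [exact Kx|]. split; [exact Hwx|].
      exact (C_ker h3 K' (W_loc3_cover Ky Hwy Hqy Ha) (W_loc3_cover Kz Hwz Hqz Hb)).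
Qed.

Lemma C1_W_loc3 : same_class (capc C1 W_loc3) C3.
Proof.
  intros x. destruct (zero_ob A) as (o & Ho).
  pose proof (zero_conf_iso (iso_id x) Ho) as K. split.
  - intros [Hx Hw]. exact (W_loc3_cover K (zero_W h1 Ho) Hx Hw).
  - intros Hx. split; [now apply h31|].
    exists o, x, (hzero P o x), (idm x). split; [exact K|].
    split; [exact (zero_W h1 Ho)|exact Hx].
Qed.

Lemma W_loc3_W3 : same_class (capc W_loc3 W3) W1.
Proof.
  intros x. split.
  - intros [(w & q & i & p & K & Hw & Hq) Hx].
    apply (W_cok h1 K Hw). apply (projective_W h1). apply (CW_projective h3 Hq).
    exact (W_mid h3 K (W1_W3 h1 h3 h31 Hw) Hx).
  - intros Hx. split; [|exact (W1_W3 h1 h3 h31 Hx)].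
    exists (cov_ker (cov1 x)), (cov (cov1 x)), (cov_i _), (cov_p _).
    split; [apply cov_conf|]. split; [apply cov_ker_in|].
    apply (projective_C h3). apply (CW_projective h1 (cov_in _)).
    exact (W_mid h1 (cov_conf _) (cov_ker_in _) Hx).
Qed.

Definition loc3 : Triple A := {| cofibrant := C1; trivial := W_loc3; fibrant := W3 |}.

Lemma W3_W_loc3 : same_class (capc W3 W_loc3) W1.
Proof. intros x. rewrite <- (W_loc3_W3 x). unfold capc. tauto. Qed.

Lemma loc3_left_localization : is_left_localization C3 W3 C1 W1 loc3.
Proof.
  pose proof W_loc3_thick as T.
  split; [reflexivity|]. split; [reflexivity|]. split; [|split; [|split; [|split]]].
  - split; [exact T|]. split; [exact C1_W_loc3|exact W_loc3_W3].
  - intros V (T' & E1 & E2) x. split.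
    + exact (left_localization_unique h1 T' E1 E2 T C1_W_loc3 W_loc3_W3 (a := x)).
    + exact (left_localization_unique h1 T C1_W_loc3 W_loc3_W3 T' E1 E2 (a := x)).
  - exact T.
  - apply (fun E => cotorsion_pair_same (fun x => iff_refl (C1 x)) E (pair_complete h1)).
    intros x. symmetry. apply W3_W_loc3.
  - apply (fun E => cotorsion_pair_same E (fun x => iff_refl (W3 x)) (pair_complete h3)).
    intros x. symmetry. apply C1_W_loc3.
Qed.

End Localizations.

(** ** The homotopy category of the localization at the third pair *)

Section SecondQuillen.
Context (A : ExactCat) (C1 W1 C2 W2 C3 W3 : A -> Prop)
  (h1 : projective_cotorsion_pair C1 W1) (h2 : projective_cotorsion_pair C2 W2)
  (h3 : projective_cotorsion_pair C3 W3) (h21 : subclass C2 C1) (h31 : subclass C3 C1)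
  (H : same_class (capc W3 C1) C2).
Local Notation P := (epre A).
Local Notation cov1 x := (cover (pair_complete h1) x).
Local Notation cov2 x := (cover (pair_complete h2) x).
Local Notation hull3 x := (the_hull (pair_complete h3) x).
Local Notation N := (@loc3 A C1 W1 C3 W3).
Local Notation γN := (gamma N).
Local Notation γ1 := (gamma (projective_triple C1 W1)).
Local Notation γ2 := (gamma (projective_triple C2 W2)).
Local Notation I := (stab_incl h21).
Local Notation E3 := (EM3 h1 h3 h21 h31 H).

Lemma loc3_trivial_fibration (x y z : A) (k : hom x y) (p : hom y z) :
  conf k p -> W1 x -> weak_equivalence N p.
Proof.
  intros K Hx. exists y, (idm y), p. split; [|split].
  - destruct (zero_ob A) as (o & Ho). exists o, (hzero P y o). split.
    + apply conf_iso_zero; [apply iso_id|exact Ho].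
    + apply (C1_W_loc3 h1 h3 h31). exact (zero_C h3 Ho).
  - exists x, k. split; [exact K|]. now apply (W3_W_loc3 h1 h3 h31).
  - now rewrite comp_id_r.
Qed.

Lemma loc3_trivial_cofibration (x y z : A) (i : hom x y) (q : hom y z) :
  conf i q -> C3 z -> weak_equivalence N i.
Proof.
  intros K Hz. exists y, i, (idm y). split; [|split].
  - exists z, q. split; [exact K|]. now apply (C1_W_loc3 h1 h3 h31).
  - destruct (zero_ob A) as (o & Ho). exists o, (hzero P o y). split.
    + apply zero_conf_iso; [apply iso_id|exact Ho].
    + apply (W3_W_loc3 h1 h3 h31). exact (zero_W h1 Ho).
  - now rewrite comp_id_l.
Qed.

Lemma γN_iso (x y : A) (f : hom x y) : weak_equivalence N f -> is_iso (fmap γN f).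
Proof. apply loc_functor_inverts. Qed.

Lemma γN_inverts : inverts (weak_equivalence (projective_triple C1 W1)) γN.
Proof.
  apply (inverts_of_epis h1). intros x y z k p K Hx.
  apply γN_iso. exact (loc3_trivial_fibration K Hx).
Qed.

(** Localizing at the first pair comes first, so stably equal maps are identified. *)
Definition Ho1_to_N : Functor (Ho (projective_triple C1 W1)) (Ho N) := lift γN_inverts.

Lemma Ho1_to_N_gamma (x y : A) (f : hom x y) :
  fmap Ho1_to_N (fmap γ1 f) ≈ fmap γN f.
Proof. exact (lift_gamma γN_inverts f). Qed.

Lemma γN_proper (x y : A) (f g : hom x y) : f ~ g -> fmap γN f ≈ fmap γN g.
Proof.
  intros E. etransitivity; [symmetry; apply Ho1_to_N_gamma|].
  etransitivity; [|apply Ho1_to_N_gamma].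
  exact (fmap_eq Ho1_to_N (gamma_proper h1 E)).
Qed.

Definition stab_to_N : Functor (stab C2) (Ho N) := Ho1_to_N ⊚ stab_to_Ho C2 h1.

Lemma stab_to_N_map (x y : stab C2) (f : hom x y) :
  fmap stab_to_N f ≈ fmap γN (f : @hom A (proj1_sig x) (proj1_sig y)).
Proof. exact (Ho1_to_N_gamma (f : @hom A (proj1_sig x) (proj1_sig y))). Qed.

(** Cofibrant-fibrant replacement in [loc3]. *)
Definition bifibrant : Functor A (stab C2) := E3 ⊚ replacement h1.

(** For a trivial cofibration [i : x >-> t] with cokernel [c], the kernel [e]
    of [cov t ->> t ->> c] approximates [x], and [e >-> cov t] has its cokernel
    [c] in [C3], so that its hull in [W3] is that of [cov t]. *)
Lemma bifibrant_inverts : inverts (weak_equivalence N) bifibrant.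
Proof.
  intros x y f (t & i & p & (c & q & K & Hc) & (k & l & L & Hk) & E).
  apply (C1_W_loc3 h1 h3 h31) in Hc. apply (W3_W_loc3 h1 h3 h31) in Hk.
  apply (iso_heq (f := fmap bifibrant p ∘ fmap bifibrant i)).
  { rewrite <- fmap_comp. apply fmap_proper. now symmetry. }
  apply iso_comp.
  - apply (fmap_iso E3). apply (replacement_inverts h1).
    exact (trivial_fibration_we h1 L Hk).
  - destruct (noether_kernels (cov_conf (cov1 t)) K) as (e & r & a & b & N1 & N2 & N3 & N4).
    pose proof (C_ker h1 N1 (cov_in _) (h31 Hc)) as He.
    destruct (lift_epi h1 b (cov_conf (cov1 x)) He (cov_ker_in _)) as (a0 & Ha0).
    pose proof (approximation_iso He N2 (cov_ker_in _) Ha0) as Ia.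
    set (a1 := a0 : @hom (stab C1) (exist _ e He) (replacement h1 x)).
    apply (iso_cancel_r (f := fmap E3 a1)); [exact (fmap_iso E3 Ia)|].
    apply (iso_heq (f := fmap E3 (r : @hom (stab C1) (exist _ e He) (replacement h1 t)))).
    + symmetry. etransitivity.
      { apply comp_proper; [exact (fmap_functor_comp E3 (replacement h1) i)|reflexivity]. }
      etransitivity; [symmetry; exact (fmap_comp E3 (fmap (replacement h1) i) a1)|]. symmetry. apply fmap_proper.
      apply (lift_unique h1 (cov_conf (cov1 t)) He (cov_ker_in _)).
      change (cov_p (cov1 t) ∘ r ~ cov_p (cov1 t) ∘
               ((fmap (replacement h1) i : hom (cov (cov1 x)) (cov (cov1 t))) ∘ a0)).
      rewrite comp_assoc, (replacement_spec h1 i), <- comp_assoc, Ha0. now rewrite N4.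
    + exact (hull_functor_inverts _ _ _ (x := exist _ e He) (y := replacement h1 t) N1 Hc).
Qed.

Definition N_to_stab : Functor (Ho N) (stab C2) := lift bifibrant_inverts.

Lemma N_to_stab_gamma (x y : A) (f : hom x y) :
  fmap N_to_stab (fmap γN f) ≈ fmap bifibrant f.
Proof. exact (lift_gamma bifibrant_inverts f). Qed.

Definition bif (x : A) : A := hull (hull3 (cov (cov1 x))).

Lemma bifibrant_spec (x y : A) (f : hom x y) :
  (fmap bifibrant f : hom (bif x) (bif y)) ∘ hull_i (hull3 (cov (cov1 x)))
  ~ hull_i (hull3 (cov (cov1 y))) ∘ (fmap (replacement h1) f : hom (cov (cov1 x)) (cov (cov1 y))).
Proof.
  etransitivity.
  { apply stable_comp_proper; [|reflexivity].
    exact (fmap_functor_comp E3 (replacement h1) f). }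
  exact (EM3_natural h1 h3 h21 h31 H (fmap (replacement h1) f)).
Qed.

(** The zigzag [x <- cov x -> bif x] compares an object with its replacement
    wherever covers are inverted and stably equal maps agree. *)
Section Zigzag.
Context (D : Cat) (F : Functor A D)
  (F_proper : forall x y (f g : hom x y), f ~ g -> fmap F f ≈ fmap F g)
  (F_cov : forall x, is_iso (fmap F (cov_p (cov1 x)))).

Definition zigzag (x : A) : hom (F x) (F (bif x)) :=
  fmap F (hull_i (hull3 (cov (cov1 x)))) ∘ inv_of (F_cov x).

Lemma zigzag_natural (x y : A) (f : hom x y) :
  zigzag y ∘ fmap F f ≈ fmap F (fmap bifibrant f : hom (bif x) (bif y)) ∘ zigzag x.
Proof.
  unfold zigzag. apply (iso_epi (F_cov x)).
  set (c := fmap (replacement h1) f : hom (cov (cov1 x)) (cov (cov1 y))).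
  assert (E : fmap F f ∘ fmap F (cov_p (cov1 x)) ≈ fmap F (cov_p (cov1 y)) ∘ fmap F c).
  { rewrite <- !fmap_comp. apply F_proper. symmetry. apply replacement_spec. }
  rewrite <- !comp_assoc, E, inv_of_l, comp_id_r.
  rewrite (comp_assoc (inv_of _)), inv_of_l, comp_id_l, <- !fmap_comp.
  apply F_proper. symmetry. apply bifibrant_spec.
Qed.

Lemma zigzag_iso (x : A) :
  is_iso (fmap F (hull_i (hull3 (cov (cov1 x))))) -> is_iso (zigzag x).
Proof. intros K. apply iso_comp; [exact K|]. exact (iso_inv (inv_of_l _) (inv_of_r _)). Qed.
End Zigzag.

Lemma stab_N_stab : naturally_isomorphic (N_to_stab ⊚ stab_to_N) (functor_id (stab C2)).
Proof.
  apply nat_iso_trans with (E3 ⊚ I).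
  - apply (nat_iso_intro (F := N_to_stab ⊚ stab_to_N) (G := E3 ⊚ I)
      (t := fun x => fmap E3 (cov_p (cov1 (proj1_sig x))
              : @hom (stab C1) (replacement h1 (proj1_sig x)) (I x)))).
    + intros x. apply (fmap_iso E3). exact (cover_iso_in_C h1 (I x)).
    + intros x y f.
      set (f0 := f : @hom A (proj1_sig x) (proj1_sig y)).
      set (ex := cov_p (cov1 (proj1_sig x)) : @hom (stab C1) (replacement h1 (proj1_sig x)) (I x)).
      set (ey := cov_p (cov1 (proj1_sig y)) : @hom (stab C1) (replacement h1 (proj1_sig y)) (I y)).
      assert (K : fmap (N_to_stab ⊚ stab_to_N) f ≈ fmap E3 (fmap (replacement h1) f0)).
      { etransitivity; [exact (fmap_eq N_to_stab (stab_to_N_map f))|].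
        etransitivity; [exact (N_to_stab_gamma f0)|].
        exact (fmap_functor_comp E3 (replacement h1) f0). }
      etransitivity; [apply comp_proper; [reflexivity|exact K]|].
      etransitivity; [symmetry; exact (fmap_comp E3 ey (fmap (replacement h1) f0))|].
      symmetry.
      etransitivity; [apply comp_proper; [exact (fmap_functor_comp E3 I f)|reflexivity]|].
      etransitivity; [symmetry; exact (fmap_comp E3 (fmap I f) ex)|].
      assert (K' : fmap I f ∘ ex ≈ ey ∘ fmap (replacement h1) f0)
        by (symmetry; exact (replacement_spec h1 f0)).
      exact (fmap_eq E3 K').
  - apply nat_iso_sym.
    apply (nat_iso_intro (F := functor_id (stab C2)) (G := E3 ⊚ I)
      (t := fun x => hull_i (hull3 (proj1_sig x)) : @hom (stab C2) x (E3 (I x)))).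
    + intros x. destruct (hull_of_W h3 (C2_W3 H (proj2_sig x))) as (g & G1 & G2).
      exists g. split; assumption.
    + intros x y f. symmetry. rewrite (fmap_functor_comp E3 I f).
      exact (EM3_natural h1 h3 h21 h31 H (fmap I f)).
Qed.

Lemma γN_cov (x : A) : is_iso (fmap γN (cov_p (cov1 x))).
Proof. apply γN_iso. exact (loc3_trivial_fibration (cov_conf _) (cov_ker_in _)). Qed.

Lemma γN_hull (x : A) : is_iso (fmap γN (hull_i (hull3 x))).
Proof. apply γN_iso. exact (loc3_trivial_cofibration (hull_conf _) (hull_cok_in _)). Qed.

Lemma N_stab_N : naturally_isomorphic (stab_to_N ⊚ N_to_stab) (functor_id (Ho N)).
Proof.
  apply nat_iso_sym.
  apply (nat_iso_intro (F := functor_id (Ho N)) (G := stab_to_N ⊚ N_to_stab)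
           (t := zigzag γN_cov)).
  - intros x. apply zigzag_iso, γN_hull.
  - apply (loc_natural (K := functor_id (Ho N)) (L := stab_to_N ⊚ N_to_stab)).
    intros x y f. change (fmap (functor_id (Ho N)) (fmap γN f)) with (fmap γN f).
    etransitivity; [exact (zigzag_natural γN_proper γN_cov f)|].
    apply comp_proper; [|reflexivity]. symmetry.
    etransitivity; [exact (fmap_eq stab_to_N (N_to_stab_gamma f))|].
    apply stab_to_N_map.
Qed.

Lemma stab_to_N_equivalence : is_equivalence stab_to_N.
Proof. exists N_to_stab. split; [exact stab_N_stab|exact N_stab_N]. Qed.

Lemma N_to_stab_equivalence : is_equivalence N_to_stab.
Proof. exists stab_to_N. split; [exact N_stab_N|exact stab_N_stab]. Qed.

(** The total left derived functor of the identity is computed on the cofibrant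
    replacements for the second pair. *)
Definition left_derived : Functor (Ho (projective_triple C2 W2)) (Ho N) :=
  stab_to_N ⊚ Ho_to_stab h2.

Lemma left_derived_gamma (x y : A) (f : hom x y) :
  fmap left_derived (fmap γ2 f) ≈ fmap γN (fmap (replacement h2) f : hom (cov (cov2 x)) (cov (cov2 y))).
Proof.
  etransitivity; [exact (fmap_functor_comp stab_to_N (Ho_to_stab h2) (fmap γ2 f))|].
  etransitivity; [exact (fmap_eq stab_to_N (Ho_to_stab_gamma h2 f))|].
  apply stab_to_N_map.
Qed.

Lemma left_derived_kan :
  exists e : NatTrans (left_derived ⊚ γ2) γN, is_right_kan e.
Proof.
  unshelve eexists {| component := fun x => fmap γN (cov_p (cov2 x))
                       : hom ((left_derived ⊚ γ2) x) (γN x) |}.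
  { intros x y f.
    change (fmap γN (cov_p (cov2 y)) ∘ fmap left_derived (fmap γ2 f)
            ≈ fmap γN f ∘ fmap γN (cov_p (cov2 x))).
    etransitivity; [apply comp_proper; [reflexivity|exact (left_derived_gamma f)]|].
    set (c := fmap (replacement h2) f : hom (cov (cov2 x)) (cov (cov2 y))).
    change (fmap γN (cov_p (cov2 y)) ∘ fmap γN c ≈ fmap γN f ∘ fmap γN (cov_p (cov2 x))).
    rewrite <- !fmap_comp. apply γN_proper, replacement_spec. }
  apply right_kan_of_deformation with (r := fun x => cov (cov2 x)) (e := fun x => cov_p (cov2 x)).
  - intros x y f. destruct (replacement_strict h2 f) as (g & _ & E). now exists g.
  - intros x. exact (Ho_eps_iso h2 x).
  - intros x.
    set (c := exist _ _ (cov_in (cov2 x)) : stab C2).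
    set (f := cov_p (cov2 (proj1_sig c)) : @hom (stab C2) (exist _ _ (cov_in _)) c).
    apply (iso_heq (stab_to_N_map f)). apply fmap_iso. exact (cover_iso_in_C h2 c).
Qed.

Definition right_derived : Functor (Ho N) (Ho (projective_triple C2 W2)) :=
  stab_to_Ho C2 h2 ⊚ N_to_stab.

Lemma γ2_cov (x : A) : is_iso (fmap γ2 (cov_p (cov1 x))).
Proof.
  apply (gamma_iso (C := C2) (W := W2)). apply (trivial_fibration_we h2 (cov_conf _)).
  exact (W1_W2 h1 h2 h21 (cov_ker_in _)).
Qed.

Lemma right_derived_gamma (x y : A) (f : hom x y) :
  fmap right_derived (fmap γN f) ≈ fmap γ2 (fmap bifibrant f : hom (bif x) (bif y)).
Proof.
  etransitivity; [exact (fmap_functor_comp (stab_to_Ho C2 h2) N_to_stab (fmap γN f))|].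
  etransitivity; [exact (fmap_eq (stab_to_Ho C2 h2) (N_to_stab_gamma f))|].
  apply (stab_to_Ho_map h2).
Qed.

(** An object of [W3] has its cover in [W3], so the hull of the cover is a
    stable isomorphism, and the zigzag is already inverted in the homotopy
    category of the second pair. *)
Lemma right_derived_kan :
  exists e : NatTrans γ2 (right_derived ⊚ γN), is_left_kan e.
Proof.
  unshelve eexists {| component := zigzag γ2_cov
     : forall x, hom (γ2 x) ((right_derived ⊚ γN) x) |}.
  { intros x y f.
    etransitivity; [exact (zigzag_natural (@gamma_proper _ _ _ h2) γ2_cov f)|].
    apply comp_proper; [|reflexivity]. symmetry. exact (right_derived_gamma f). }
  apply left_kan_of_deformation with (r := fun x => hull (hull3 x)) (e := fun x => hull_i (hull3 x)).
  - intros x y f.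
    destruct (extend h3 (hull_i (hull3 y) ∘ f) (hull_conf (hull3 x)) (hull_cok_in _) (hull_in _))
      as (g & E). now exists g.
  - intros x. apply γN_hull.
  - intros x. apply zigzag_iso.
    assert (K : W3 (cov (cov1 (hull (hull3 x))))).
    { apply (W_mid h3 (cov_conf _) (W1_W3 h1 h3 h31 (cov_ker_in _)) (hull_in _)). }
    destruct (hull_of_W h3 K) as (g & G1 & G2).
    exists (fmap γ2 g). rewrite <- !fmap_comp, <- !fmap_id.
    split; now apply (gamma_proper h2).
Qed.

Lemma loc3_quillen : quillen_equivalence_via_id (projective_triple C2 W2) N.
Proof.
  split; [|split; [|split; [|split; [|split]]]].
  - intros x y f. exact (adm_mono_weaken (S' := C1) h21).
  - intros x y f. apply adm_mono_weaken. intros c [K1 K2].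
    apply (C1_W_loc3 h1 h3 h31). apply (projective_C h3). exact (CW_projective h2 K1 K2).
  - intros x y f. apply adm_epi_weaken. intros c _. exact Logic.I.
  - intros x y f. apply adm_epi_weaken. intros c K. split; [exact Logic.I|].
    apply (W1_W2 h1 h2 h21). now apply (W3_W_loc3 h1 h3 h31).
  - destruct left_derived_kan as (e & He). exists left_derived, e. split; [exact He|].
    exact (equivalence_comp (Ho_to_stab_equivalence h2) stab_to_N_equivalence).
  - destruct right_derived_kan as (e & He). exists right_derived, e. split; [exact He|].
    exact (equivalence_comp N_to_stab_equivalence (stab_to_Ho_equivalence h2)).
Qed.

End SecondQuillen.

(** * The recollement *)

Lemma recollement_exists (A : ExactCat)
  (hproj : enough_projectives A)
  (C1 W1 C2 W2 C3 W3 : A -> Prop)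
  (h1 : projective_cotorsion_pair C1 W1)
  (h2 : projective_cotorsion_pair C2 W2)
  (h3 : projective_cotorsion_pair C3 W3)
  (h21 : subclass C2 C1) (h31 : subclass C3 C1) (H : same_class (capc W3 C1) C2) :
  recollement (stab_triangulation h2 hproj) (stab_triangulation h1 hproj)
    (Ho_triangulation h3 hproj) (stab_incl h21) (stab_to_Ho C1 h3)
    (EM3 h1 h3 h21 h31 H) (CM2 h2 h21) (lambda h3 h31) (rho h1 h2 h3 h21 h31).
Proof.
  split; [apply stab_incl_exact|].
  split; [apply stab_to_Ho_exact; exact (W1_W3 h1 h3 h31)|].
  split; [apply hull_functor_adjoint|].
  split; [apply cover_functor_adjoint|].
  split; [exact (lambda_adjoint h3 h31)|].
  split; [exact (rho_adjoint h1 h2 h3 h21 h31 H)|].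
  split; [exact (I_ff h21)|].
  split; [exact (lambda_ff h3 h31)|].
  split; [exact (rho_ff h1 h2 h3 h21 h31 H)|].
  exact (Q_zero h3 h21 H).
Qed.

Theorem theorem3p5 (A : ExactCat) (hwic : weakly_idempotent_complete A)
  (hproj : enough_projectives A)
  (C1 W1 C2 W2 C3 W3 : A -> Prop)
  (h1 : projective_cotorsion_pair C1 W1)
  (h2 : projective_cotorsion_pair C2 W2)
  (h3 : projective_cotorsion_pair C3 W3)
  (h21 : subclass C2 C1) (h31 : subclass C3 C1) :
  (same_class (capc W3 C1) C2 <->
     same_class (capc W2 W3) W1 /\ subclass C2 W3) /\
  (same_class (capc W3 C1) C2 ->
    (exists N : Triple A,
        is_left_localization C2 W2 C1 W1 N /\
        quillen_equivalence_via_id (projective_triple C3 W3) N) /\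
    (exists N : Triple A,
        is_left_localization C3 W3 C1 W1 N /\
        quillen_equivalence_via_id (projective_triple C2 W2) N) /\
    let HoM3 := Ho (projective_triple C3 W3) in
    let gamma3 : Functor A HoM3 := gamma (projective_triple C3 W3) in
    let I : Functor (stab C2) (stab C1) := stab_incl h21 in
    let Q : Functor (stab C1) HoM3 := stab_to_Ho C1 h3 in
    let j3 : Functor (stab C3) (stab C1) := stab_incl h31 in
    let j21 : Functor (stab (capc W2 C1)) (stab C1) :=
      stab_incl (@capc_r A W2 C1) in
    exists (T2 : Triangulation (stab C2)) (T1 : Triangulation (stab C1))
           (T3 : Triangulation HoM3)
           (EM3 : Functor (stab C1) (stab C2))
           (CM2 : Functor (stab C1) (stab C2))
           (lambda rho : Functor HoM3 (stab C1))
           (CM1 : Functor A (stab C1))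
           (EM2 : Functor (stab C1) (stab (capc W2 C1))),
      stable_triangulation T2 /\ stable_triangulation T1 /\
      homotopy_triangulation T3 /\
      is_E_functor C3 W3 (full_sub_incl C1) (EM3 ⊚ stab_quot C1) /\
      is_C_functor C2 W2 (full_sub_incl C1) (CM2 ⊚ stab_quot C1) /\
      is_C_functor C3 W3 (functor_id A) (lambda ⊚ gamma3) /\
      is_C_functor C1 W1 (functor_id A) CM1 /\
      is_E_functor C2 W2 (full_sub_incl C1) (EM2 ⊚ stab_quot C1) /\
      naturally_isomorphic (rho ⊚ gamma3) (j21 ⊚ (EM2 ⊚ CM1)) /\
      recollement T2 T1 T3 I Q EM3 CM2 lambda rho /\
      (forall x : stab C1, in_essential_image lambda x <-> C3 (proj1_sig x)) /\
      (forall x : stab C1,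
          in_essential_image rho x <-> W2 (proj1_sig x)) /\
      (exists (lambda' : Functor (stab (capc W2 C1)) (stab C3))
              (rho' : Functor (stab C3) (stab (capc W2 C1))),
          naturally_isomorphic (j3 ⊚ lambda') (lambda ⊚ Q ⊚ j21) /\
          naturally_isomorphic (j21 ⊚ rho') (rho ⊚ Q ⊚ j3) /\
          naturally_isomorphic (rho' ⊚ lambda') (functor_id (stab (capc W2 C1))) /\
          naturally_isomorphic (lambda' ⊚ rho') (functor_id (stab C3)))).
Proof.
  split; [exact (orthogonality_conditions h1 h2 h3 h21 h31)|]. intros H.
  split.
  { exists (@loc2 A C1 W2 W3). split.
    - exact (loc2_left_localization h1 h2 h3 h21 h31 H).
    - exact (loc2_quillen h2 h3 h31 H). }
  split.
  { exists (@loc3 A C1 W1 C3 W3). split.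
    - exact (loc3_left_localization h1 h2 h3 h31 H).
    - exact (loc3_quillen h1 h2 h3 h21 h31 H). }
  exists (stab_triangulation h2 hproj), (stab_triangulation h1 hproj),
    (Ho_triangulation h3 hproj), (EM3 h1 h3 h21 h31 H), (CM2 h2 h21),
    (lambda h3 h31), (rho h1 h2 h3 h21 h31), (CM1 h1), (EM2 h1 h2 h21).
  split; [apply stab_triangulation_stable|].
  split; [apply stab_triangulation_stable|].
  split; [apply Ho_triangulation_homotopy|].
  split; [apply hull_functor_is_E|].
  split; [apply CM2_is_C|].
  split; [apply lambda_is_C|].
  split; [apply CM1_is_C|].
  split; [apply hull_functor_is_E|].
  split; [exact (rho_gamma h1 h2 h3 h21 h31 H)|].
  split; [apply recollement_exists|].
  split; [exact (lambda_image h3 h31)|].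
  split; [exact (rho_image h1 h2 h3 h21 h31 H)|].
  exists (lambda' C1 W2 h3), (rho' h1 h2 h21 h31).
  split; [exact (@lambda'_lambda A C1 W2 C3 W3 h3 h31)|].
  split; [exact (rho'_rho h1 h2 h3 h21 h31 H)|].
  split; [exact (rho'_lambda' h1 h2 h3 h21 h31 H)|].
  exact (lambda'_rho' h1 h2 h3 h21 h31 H).
Qed.
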